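(* Let $(a_n)_{n \geq 1}$ be a strictly increasing sequence of positive integers, and let $(\eta(N))_{N \geq 1}$ be a sequence of non-negative reals. Let $\mathcal{A}$ be the set of those $\alpha \in [0,1]$ for which $\delta_{\min}^{\alpha}(N) \leq \eta(N)$ holds for infinitely many $N$. Then $\lambda(\mathcal{A}) = 0$ or $\lambda(\mathcal{A}) = 1$, according to whether the series $$\sum_{k=1}^{\infty} \varphi(k) \sup_{b \geq 1} \left\{ \frac{\sup_{\ell \geq \mathcal{N}(bk)} \eta(\ell)}{bk} \right\}$$ is convergent or divergent, respectively.
   Context: $\lambda$ denotes Lebesgue measure and $\varphi$ Euler's totient function. For $\alpha \in [0,1]$ and $N \geq 2$, $\delta_{\min}^{\alpha}(N) = \min\{\|(a_m - a_n)\alpha\| : 1 \leq m,n \leq N,\ m \neq n\}$, where $\|x\|$ is the distance from $x$ to the nearest integer. Let $A_N = \{a_1,\dots,a_N\}$, and let $(A_N - A_N)^+$ denote the set of positive elements of $\{a-b : a,b \in A_N\}$. For a positive integer $k$ lying in $\bigcup_{N \geq 1}(A_N - A_N)^+$, set $\mathcal{N}(k) = \min\{M \geq 1 : k \in (A_M - A_M)^+\}$; otherwise set $\mathcal{N}(k) = \infty$. The supremum of the empty set (e.g. $\sup_{\ell \geq \infty}$) is understood to be $0$. *)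

(* Defs.v *)
From HB Require Import structures.
From mathcomp Require Import all_boot all_order all_algebra.
From mathcomp Require Import all_classical all_reals all_analysis.
Set Implicit Arguments. Unset Strict Implicit. Unset Printing Implicit Defensive.
Import Order.TTheory GRing.Theory Num.Theory.
Local Open Scope classical_set_scope.
Local Open Scope ring_scope.

Definition dist_int {R : realType} (x : R) : R :=
  inf [set `|x - z%:~R| | z in [set: int]].

(* delta_min^alpha(N) = min { ||(a_m - a_n) alpha|| : 1 <= m,n <= N, m <> n }
   (meaningful for N >= 2, where the set is finite and nonempty) *)
Definition delta_min {R : realType} (a : nat -> nat) (alpha : R) (N : nat) : R :=
  inf [set dist_int (((a mn.1)%:Z - (a mn.2)%:Z)%:~R * alpha) |
        mn in [set mn : nat * nat | (1 <= mn.1 <= N)%N /\ (1 <= mn.2 <= N)%N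
                                    /\ mn.1 <> mn.2]].

Definition in_posdiff (a : nat -> nat) (M k : nat) : Prop :=
  (0 < k)%N /\ exists i j : nat, (1 <= i <= M)%N /\ (1 <= j <= M)%N /\
    ((a i)%:Z - (a j)%:Z = k%:Z).

Lemma NN_ex_bool (a : nat -> nat) (k : nat) :
  (exists M, (1 <= M)%N /\ in_posdiff a M k) ->
  exists M, `[< (1 <= M)%N /\ in_posdiff a M k >].
Proof. by move=> [M HM]; exists M; apply/asboolP. Qed.

(* calN(k) = min { M >= 1 : k \in (A_M - A_M)^+ }, None encodes infinity *)
Definition calN (a : nat -> nat) (k : nat) : option nat :=
  match pselect (exists M, (1 <= M)%N /\ in_posdiff a M k) with
  | left H => Some (ex_minn (NN_ex_bool H))
  | right _ => None
  end.

Local Open Scope ereal_scope.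

(* sup_{l >= calN(k)} eta(l), with the convention sup over l >= infinity = 0 *)
Definition sup_tail {R : realType} (a : nat -> nat) (eta : nat -> R) (k : nat)
  : \bar R :=
  match calN a k with
  | Some n => ereal_sup [set (eta l)%:E | l in [set l : nat | (n <= l)%N]]
  | None => 0
  end.

Definition series_term {R : realType} (a : nat -> nat) (eta : nat -> R) (k : nat)
  : \bar R :=
  ereal_sup [set sup_tail a eta (b * k) * ((b * k)%:R^-1)%:E
            | b in [set b : nat | (1 <= b)%N]].

Definition calA {R : realType} (a : nat -> nat) (eta : nat -> R) : set R :=
  [set alpha : R | (0 <= alpha <= 1)%R /\
     infinite_set [set N : nat | (2 <= N)%N /\ (delta_min a alpha N <= eta N)%R]].

(* Main.v *)
Require Import Defs.
From HB Require Import structures.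
From mathcomp Require Import all_boot all_order all_algebra.
From mathcomp Require Import all_classical all_reals all_analysis measurable_realfun.
From mathcomp Require Import cyclic ring lra zify.
Import Order.TTheory GRing.Theory Num.Theory.
(** The set [calA] is compared with the limsup set of the balls with reduced centres [a/k] and
    radii [s_k = series_term k].

    Convergence. An irrational point of [calA] lies in infinitely many balls of radius [2 s_k],
    unless [eta] stays above a positive constant along a subsequence; by [sum_{d | n} phi(d) = n] the
    latter forces divergence of the series. Borel-Cantelli concludes.

    Divergence. For [c > 0] put [rho_k = c s_k], truncated so that the terms [phi(k) rho_k] are
    small, and cut the series into blocks of mass [M] close to a small absolute constant. A
    sieve bounds the number of overlaps between balls with denominators [v] and [w], up to a
    product over the large primes [p] dividing [v w / gcd(v,w)^2]. The resulting sum over pairs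
    is the one of the Duffin-Schaeffer conjecture; it is [O(M^2 + M^(4/3))] by an inequality of
    the type [energy <= C (tau mu nu)^(2/3)] for bipartite graphs whose edges [v w] satisfy [w
    f(v), v g(w) <= tau gcd(v,w)], [mu] and [nu] being the masses of the two sides. The
    inequality is proved by induction on the set of primes allowed to divide the gcds: splitting
    the vertices by their [p]-adic valuations reduces one prime to an inequality about sequences
    of cube roots of masses, with a loss [1 + O(p^(-4/3) + [p > t] t/p^2)], and the product of
    the losses converges, uniformly in [t]. Bonferroni's inequality then gives each block a
    measure at least [M], so the limsup set has measure bounded below independently of [c].
    Hence the points which are approximable for every [c > 0] have positive measure; as
    multiplication by [m] turns [c] into [m c], they form a set invariant under integer
    translations and multiplications, which must have full measure. *)

Set Implicit Arguments. Unset Strict Implicit. Unset Printing Implicit Defensive.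
Local Open Scope ring_scope.

(** * The inequality attached to one prime *)

(** The exponent 2/3 comes from coprime labels: pruning gives [e^2 <= 16 tau^2 mu nu], and the
    trivial [e <= mu nu] turns this into [e^3 <= 16 (tau mu nu)^2]. As 2/3 + 2/3 > 1, spreading the
    masses over several valuations costs energy, so an instance with almost no such cost is
    concentrated on one valuation, the same on both sides. The obstacle is that the losses must be
    summable over the primes. With [r = p^(-1/3)], a loss of order [r^3 = 1/p] would diverge; the
    terms of that order cancel exactly, except those that carry a factor [t/p] from the weight. The
    parameter [t] follows the dyadic level [j] of the difference of numerators. It is small enough
    for the primes up to [t] to have a product [O(2^j)], so that the sieve can sum over whole
    periods, and large enough for the primes beyond [t] dividing that difference to matter only by a
    constant. The sieve leaves a product of [1 + 2/p] over large primes; with [t = 4 u], the [u]-th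
    power of such a factor is at most [1 + t/p]. An overlap [O(M^2 + M^(4/3))] is below [M] once [M]
    is small: any exponent above 1 would do for the blocks. *)

Definition ndist (i j : nat) : nat := (i - j + (j - i))%N.

Lemma sum_ndist_le (R : realFieldType) n (f : nat -> R) (i : 'I_n) :
  (forall d, 0 <= f d) ->
  \sum_(j < n | j != i) f (ndist i j) <= 2 * \sum_(0 <= d < n) f d.+1.
Proof.
move=> f0.
have split1 : \sum_(j < n | j != i) f (ndist i j) =
    \sum_(0 <= j < i) f (i - j)%N + \sum_(i.+1 <= j < n) f (j - i)%N.
  rewrite -(big_mkord (fun j => j != i :> nat) (fun j => f (ndist i j))).
  rewrite (big_cat_nat (leq0n i) (ltnW (ltn_ord i))) /=.
  rewrite [X in _ + X]big_ltn_cond ?ltn_ord// eqxx /=; congr (_ + _).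
    rewrite big_nat_cond [RHS]big_nat_cond; apply: eq_big => j.
      by case: ltngtP => //=; rewrite ?andbF ?andbT.
    move=> /andP[/andP[_ ji] _]; congr f; rewrite /ndist; lia.
  rewrite big_nat_cond [RHS]big_nat_cond; apply: eq_big => j.
    by case: ltngtP => //=; rewrite ?andbF ?andbT.
  move=> /andP[/andP[ij _] _]; congr f; rewrite /ndist; lia.
have ext m : (m <= n)%N -> \sum_(0 <= d < m) f d.+1 <= \sum_(0 <= d < n) f d.+1.
  move=> mn; rewrite [leRHS](big_cat_nat (leq0n m) mn) /= lerDl.
  by apply: sumr_ge0.
rewrite split1 mulr_natl mulr2n; apply: lerD.
  rewrite big_nat_rev add0n.
  rewrite [leLHS](_ : _ = \sum_(0 <= d < i) f d.+1).
    by apply: ext; apply: ltnW.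
  by rewrite big_nat_cond [RHS]big_nat_cond; apply: eq_bigr => j /andP[/andP[_ ji] _]; congr f; lia.
rewrite -{1}[i.+1]add0n big_addn.
rewrite [leLHS](_ : _ = \sum_(0 <= d < n - i.+1) f d.+1).
  by apply: ext; lia.
by apply: eq_bigr => j _; congr f; lia.
Qed.

Lemma geom_le (R : realFieldType) n (r : R) : 0 <= r < 1 ->
  \sum_(0 <= d < n) r ^+ d.+1 <= r / (1 - r).
Proof.
move=> /andP[r0 r1]; rewrite ler_pdivlMr ?subr_gt0//.
have -> : (\sum_(0 <= d < n) r ^+ d.+1) * (1 - r) = r - r ^+ n.+1.
  elim: n => [|n IH]; first by rewrite big_geq// mul0r expr1 subrr.
  by rewrite big_nat_recr//= mulrDl IH !exprS; ring.
by rewrite lerBlDr lerDl exprn_ge0.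
Qed.

Lemma sum_geom_ndist (R : realFieldType) n (r : R) (i : 'I_n) : 0 <= r < 1 ->
  \sum_(j < n | j != i) r ^+ ndist i j <= 2 * (r / (1 - r)).
Proof.
move=> r01; have /andP[r0 _] := r01.
apply: le_trans (sum_ndist_le i (fun d => exprn_ge0 d r0)) _.
by rewrite ler_pM2l ?ltr0n// geom_le.
Qed.

Lemma ndistC i j : ndist i j = ndist j i.
Proof. by rewrite /ndist addnC. Qed.

(** Schur's test for the kernel [r ^+ ndist i j] off the diagonal: after
    [x^2 y^2 <= (x^4 + y^4) / 2], each row sums to at most [2 r / (1 - r)]. The predicate [P] allows
    the dominant index to be left out. *)
Lemma schur_le (R : realFieldType) n (r : R) (P : pred 'I_n) (x y : 'I_n -> R) :
  0 <= r < 1 ->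
  \sum_(i < n | P i) \sum_(j < n | P j && (j != i)) r ^+ ndist i j * (x i ^+ 2 * y j ^+ 2)
    <= r / (1 - r) * (\sum_(i < n | P i) x i ^+ 4 + \sum_(i < n | P i) y i ^+ 4).
Proof.
move=> r01; have /andP[r0 _] := r01.
pose Q := r / (1 - r).
have amgm (i j : 'I_n) : r ^+ ndist i j * (x i ^+ 2 * y j ^+ 2) <=
   2^-1 * (r ^+ ndist i j * x i ^+ 4) + 2^-1 * (r ^+ ndist i j * y j ^+ 4).
  have : 0 <= r ^+ ndist i j * (x i ^+ 2 - y j ^+ 2) ^+ 2.
    by rewrite mulr_ge0 ?sqr_ge0 ?exprn_ge0.
  rewrite (exprM (x i) 2 2 : x i ^+ 4 = _) (exprM (y j) 2 2 : y j ^+ 4 = _).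
  move: (r ^+ _) (x i ^+ 2) (y j ^+ 2) => d a b h; lra.
have row (z : 'I_n -> R) : \sum_(i < n | P i) \sum_(j < n | P j && (j != i))
    r ^+ ndist i j * z i ^+ 4 <= 2 * Q * \sum_(i < n | P i) z i ^+ 4.
  rewrite mulr_sumr; apply: ler_sum => i Pi.
  rewrite -mulr_suml; apply: ler_wpM2r; first by rewrite (_ : 4 = 2 * 2)%N// exprM sqr_ge0.
  apply: le_trans (sum_geom_ndist i r01).
  rewrite big_mkcondl; apply: ler_sum => j _; case: ifP => // _.
  by rewrite exprn_ge0.
have col : \sum_(i < n | P i) \sum_(j < n | P j && (j != i))
    r ^+ ndist i j * y j ^+ 4 = \sum_(i < n | P i) \sum_(j < n | P j && (j != i))
    r ^+ ndist i j * y i ^+ 4.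
  rewrite (exchange_big_dep P) => [|i j _ /andP[]//] /=.
  apply: eq_bigr => i Pi; apply: eq_big => j; first by rewrite Pi eq_sym.
  by rewrite ndistC.
have := row x; have := row y; rewrite -col => ry rx.
apply: (@le_trans _ _ (2^-1 * (\sum_(i < n | P i) \sum_(j < n | P j && (j != i))
    r ^+ ndist i j * x i ^+ 4) + 2^-1 * (\sum_(i < n | P i) \sum_(j < n | P j && (j != i))
    r ^+ ndist i j * y j ^+ 4))).
  rewrite !mulr_sumr -big_split /=; apply: ler_sum => i _.
  by rewrite !mulr_sumr -big_split /=; apply: ler_sum => j _.
by move: ry rx; rewrite -/Q; lra.
Qed.

Lemma pow34 (R : realDomainType) (x c : R) : 0 <= x <= c -> x ^+ 4 <= c * x ^+ 3.
Proof.
move=> /andP[x0 xc]; rewrite exprS; apply: ler_wpM2r => //; exact: exprn_ge0.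
Qed.

Lemma cube_le (R : realDomainType) (x c : R) : 0 <= x -> 0 <= c -> x ^+ 3 <= c ^+ 3 -> x <= c.
Proof. by move=> x0 c0; rewrite ler_pXn2r. Qed.

(** The concave function [w^(2/3)] lies below its tangent at [w = 1], with [w = z^3]. The slope 2/3
    is the rate at which lost mass is charged to the main cell. *)
Lemma sq_le_cube (R : realFieldType) (z : R) : 0 <= z -> z ^+ 2 <= 1 - 2 / 3 * (1 - z ^+ 3).
Proof.
move=> z0; have : 0 <= (z - 1) ^+ 2 * (2 * z + 1).
  by apply: mulr_ge0; [exact: sqr_ge0|lra].
by lra.
Qed.

(** A weighted Young inequality. The cubes get the small coefficient 1/96, so that the row and the
    column of the dominant index can be absorbed in [concentration]. *)
Lemma cube_amgm (R : realFieldType) (a z : R) : 0 <= a -> 0 <= z ->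
  a * z ^+ 2 <= z ^+ 3 / 96 + 96 ^+ 2 * a ^+ 3.
Proof.
move=> a0 z0; have [h|h] := lerP (96 * a) z.
  have : 0 <= z ^+ 2 * (z - 96 * a) by rewrite mulr_ge0 ?sqr_ge0 ?subr_ge0.
  have : 0 <= a ^+ 3 by exact: exprn_ge0.
  lra.
have : z ^+ 2 <= (96 * a) ^+ 2.
  by rewrite ler_pXn2r ?nnegrE//; [exact: ltW|lra].
have : 0 <= z ^+ 3 by exact: exprn_ge0.
move=> h1 /(ler_wpM2l a0) h2; lra.
Qed.

Lemma one_sub_cube_le (R : realFieldType) (z : R) : 96 / 100 <= z -> 1 - z ^+ 3 <= 1 / 8.
Proof.
move=> h; have : (96 / 100) ^+ 3 <= z ^+ 3 by rewrite ler_pXn2r ?nnegrE//; lra.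
lra.
Qed.

(* If the total exceeds [1], both mass distributions concentrate on a common index: the index maximising [x i * y i]. *)
Lemma concentration (R : rcfType) n (r : R) (x y : 'I_n -> R) (e : 'I_n -> 'I_n -> R) :
  0 <= r <= 400^-1 ->
  (forall i, 0 <= x i) -> (forall i, 0 <= y i) ->
  \sum_i x i ^+ 3 = 1 -> \sum_i y i ^+ 3 = 1 ->
  (forall i j, 0 <= e i j <= r ^+ ndist i j * (x i ^+ 2 * y j ^+ 2)) ->
  1 < \sum_i e i i + 2 * \sum_i \sum_(j | j != i) e i j ->
  exists k, \sum_(i | i != k) x i ^+ 3 <= (150 * r) ^+ 3 /\
            \sum_(i | i != k) y i ^+ 3 <= (150 * r) ^+ 3.
Proof.
move=> /andP[r0 r400] x0 y0 sx sy eb S1.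
have r01 : 0 <= r < 1 by apply/andP; split=> //; lra.
pose Q := r / (1 - r).
have Q0 : 0 <= Q by rewrite divr_ge0// subr_ge0; lra.
have Qr : Q <= 1 / 399.
  by rewrite /Q ler_pdivrMr ?subr_gt0; lra.
have le1 (z : 'I_n -> R) i : (forall i, 0 <= z i) -> \sum_i z i ^+ 3 = 1 -> z i <= 1.
  move=> z0 sz; apply: cube_le => //; rewrite expr1n -sz (bigD1 i)//= lerDl.
  by apply: sumr_ge0 => j _; apply: exprn_ge0.
have x1 i := le1 x i x0 sx; have y1 i := le1 y i y0 sy.
pose T (i j : 'I_n) := r ^+ ndist i j * (x i ^+ 2 * y j ^+ 2).
have T0 i j : 0 <= T i j by rewrite !mulr_ge0 ?exprn_ge0.
have offT : \sum_i \sum_(j | j != i) e i j <= \sum_i \sum_(j | j != i) T i j.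
  by apply: ler_sum => i _; apply: ler_sum => j _; have /andP[] := eb i j.
have diagT : \sum_i e i i <= \sum_i x i ^+ 2 * y i ^+ 2.
  apply: ler_sum => i _; have /andP[_] := eb i i.
  by rewrite /ndist subnn expr0 mul1r.
have s4 (z : 'I_n -> R) : (forall i, 0 <= z i) -> (forall i, z i <= 1) ->
    \sum_i z i ^+ 3 = 1 -> \sum_i z i ^+ 4 <= 1.
  move=> z0 z1 sz; rewrite -sz; apply: ler_sum => i _.
  by have := @pow34 _ (z i) 1; rewrite mul1r; apply; rewrite z0 z1.
have off1 : \sum_i \sum_(j | j != i) T i j <= Q * 2.
  apply: (le_trans (schur_le xpredT x y r01)); apply: ler_wpM2l => //.
  by have := s4 x x0 x1 sx; have := s4 y y0 y1 sy; lra.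
have [i0] : exists i : 'I_n, true.
  case: n x y e x0 y0 sx {sy eb S1 le1 x1 y1 T T0 offT diagT s4 off1} => [|n] x y e x0 y0 sx; last by exists ord0.
  by move: sx; rewrite big_ord0 => /esym/eqP; rewrite oner_eq0.
move=> _; pose k := [arg max_(i > i0) x i * y i]%O.
have kmax i : x i * y i <= x k * y k.
  by rewrite /k; case: Order.TotalTheory.arg_maxP => // k' _; apply.
pose s : R := Num.sqrt (x k * y k).
have xyk0 : 0 <= x k * y k by rewrite mulr_ge0.
have s0 : 0 <= s by exact: sqrtr_ge0.
have s2 : s ^+ 2 = x k * y k by exact: sqr_sqrtr.
(* As [x i * y i <= s ^+ 2], each term is at most [s] times the power 3/2 of [x i * y i], hence at
   most [s] times the mean of the two cubes. Squares are compared to avoid the half-integer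
   power. *)
have d1 : \sum_i x i ^+ 2 * y i ^+ 2 <= s.
  apply: (@le_trans _ _ (\sum_i s * (2^-1 * (x i ^+ 3 + y i ^+ 3)))); last first.
    by rewrite -mulr_sumr -mulr_sumr big_split /= sx sy; lra.
  apply: ler_sum => i _.
  have p3 : 0 <= x i ^+ 3 /\ 0 <= y i ^+ 3 by rewrite !exprn_ge0.
  rewrite -(@ler_pXn2r _ 2)// ?nnegrE; [|by rewrite mulr_ge0 ?exprn_ge0| by rewrite mulr_ge0//; lra].
  rewrite [leRHS]exprMn s2.
  apply: (@le_trans _ _ ((x k * y k) * (x i ^+ 3 * y i ^+ 3))).
    rewrite [leLHS](_ : _ = (x i * y i) * (x i ^+ 3 * y i ^+ 3)); last by ring.
    by apply: ler_wpM2r => //; rewrite mulr_ge0 //; case: p3.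
  apply: ler_wpM2l => //.
  have := sqr_ge0 (x i ^+ 3 - y i ^+ 3); move: (x i ^+ 3) (y i ^+ 3) => a b; lra.
have sge : 98 / 100 <= s by lra.
have xyk : 96 / 100 <= x k * y k.
  have : (98 / 100) ^+ 2 <= s ^+ 2 by rewrite ler_pXn2r ?nnegrE//; lra.
  by rewrite s2 => ?; lra.
have xk : 96 / 100 <= x k by have := ler_piMr (x0 k) (y1 k); lra.
have yk : 96 / 100 <= y k by have := ler_piMl (y0 k) (x1 k); lra.
pose X := \sum_(i | i != k) x i ^+ 3; pose Y := \sum_(i | i != k) y i ^+ 3.
have XE : X = 1 - x k ^+ 3 by rewrite -sx [in RHS](bigD1 k)//= [RHS]addrC addKr.
have YE : Y = 1 - y k ^+ 3 by rewrite -sy [in RHS](bigD1 k)//= [RHS]addrC addKr.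
have X8 : X <= 1 / 8 by rewrite XE one_sub_cube_le.
have Y8 : Y <= 1 / 8 by rewrite YE one_sub_cube_le.
have half (z : 'I_n -> R) i : (forall i, 0 <= z i) -> \sum_(i | i != k) z i ^+ 3 <= 1 / 8 -> i != k -> z i <= 1 / 2.
  move=> z0 sz ik; apply: cube_le; [exact: z0|by clear; lra|].
  apply: (@le_trans _ _ (1 / 8)); last by clear; lra.
  apply: le_trans sz; rewrite (bigD1 i)//= lerDl.
  by apply: sumr_ge0 => j _; apply: exprn_ge0.
have s4k (z : 'I_n -> R) : (forall i, 0 <= z i) -> \sum_(i | i != k) z i ^+ 3 <= 1 / 8 ->
    \sum_(i | i != k) z i ^+ 4 <= 1 / 2 * \sum_(i | i != k) z i ^+ 3.
  move=> z0 sz; rewrite mulr_sumr; apply: ler_sum => i ik.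
  by apply: pow34; rewrite z0 half.
have x4 := s4k x x0 X8; have y4 := s4k y y0 Y8.
have X0 : 0 <= X by apply: sumr_ge0 => j _; apply: exprn_ge0.
have Y0 : 0 <= Y by apply: sumr_ge0 => j _; apply: exprn_ge0.
(* At [k] the tangent bound loses [(X + Y) / 3]; the other entries are at most 1/2 and return at
   most [(X + Y) / 4]. The net loss [(X + Y) / 12] has to be paid by the off-diagonal terms. *)
have dk : \sum_i x i ^+ 2 * y i ^+ 2 <= 1 - (X + Y) / 3 + (X + Y) / 4.
  rewrite (bigD1 k)//=; apply: lerD.
    have := sq_le_cube (x0 k); have := sq_le_cube (y0 k).
    rewrite -XE -YE; have := sqr_ge0 (x k ^+ 2 - y k ^+ 2).
    have := exprn_ile1 2 (x0 k) (x1 k); have := exprn_ile1 2 (y0 k) (y1 k).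
    have := sqr_ge0 (x k); have := sqr_ge0 (y k).
    move: (x k ^+ 2) (y k ^+ 2) => a b b0 a0 b1 a1 ab hb ha.
    have : a * a <= a by rewrite ler_piMr.
    have : b * b <= b by rewrite ler_piMr.
    by clear -ab hb ha; lra.
  apply: (@le_trans _ _ (2^-1 * (\sum_(i | i != k) x i ^+ 4 + \sum_(i | i != k) y i ^+ 4))).
    rewrite -big_split mulr_sumr; apply: ler_sum => i _ /=.
    rewrite (exprM (x i) 2 2 : x i ^+ 4 = _) (exprM (y i) 2 2 : y i ^+ 4 = _).
    have := sqr_ge0 (x i ^+ 2 - y i ^+ 2); move: (x i ^+ 2) (y i ^+ 2) => a b; clear; lra.
  by clear -x4 y4; move: x4 y4; rewrite -/X -/Y; lra.
have r3 : 0 <= r ^+ 3 by exact: exprn_ge0.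
have r3b : r ^+ 3 <= 1 / 3.
  apply: (@le_trans _ _ (3^-1 ^+ 3)); last by clear; lra.
  by rewrite ler_pXn2r ?nnegrE//; clear -r400; lra.
have rowk (z : 'I_n -> R) : (forall i, 0 <= z i) ->
    \sum_(i | i != k) r ^+ ndist i k * z i ^+ 2 <= (\sum_(i | i != k) z i ^+ 3) / 96 + 3 * 96 ^+ 2 * r ^+ 3.
  move=> z0; apply: (@le_trans _ _ (\sum_(i | i != k) (z i ^+ 3 / 96 + 96 ^+ 2 * (r ^+ 3) ^+ ndist k i))).
    apply: ler_sum => i _; rewrite (ndistC k) -exprM mulnC exprM.
    by apply: cube_amgm => //; exact: exprn_ge0.
  rewrite big_split /= -mulr_suml lerD2l -mulr_sumr.
  rewrite (_ : 3 * 96 ^+ 2 * r ^+ 3 = 96 ^+ 2 * (3 * r ^+ 3)); last by clear; ring.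
  rewrite ler_pM2l ?exprn_gt0//.
  apply: le_trans (sum_geom_ndist k _) _; first by rewrite r3; clear -r3b; lra.
  have : r ^+ 3 / (1 - r ^+ 3) <= r ^+ 3 * (3 / 2).
    apply: ler_wpM2l => //.
    by rewrite invf_ple ?posrE ?subr_gt0; clear -r3b; lra.
  by clear; lra.
have rx := rowk x x0; have ry := rowk y y0.
have offk : \sum_i \sum_(j | j != i) T i j <=
    \sum_(i | i != k) r ^+ ndist i k * y i ^+ 2 + \sum_(i | i != k) r ^+ ndist i k * x i ^+ 2 +
    Q * ((X + Y) / 2).
  rewrite (bigD1 k)//= -addrA; apply: lerD.
    apply: ler_sum => j jk; rewrite ndistC /T; apply: ler_wpM2l; first exact: exprn_ge0.
    by apply: ler_piMl; rewrite ?exprn_ile1// sqr_ge0.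
  rewrite (eq_bigr (fun i => T i k + \sum_(j | (j != k) && (j != i)) T i j)); last first.
    move=> i ik; rewrite (bigD1 k) 1?eq_sym//=; congr (_ + _); apply: eq_bigl => j.
    by rewrite andbC.
  rewrite big_split /=; apply: lerD.
    apply: ler_sum => j jk; rewrite /T; apply: ler_wpM2l; first exact: exprn_ge0.
    by apply: ler_piMr; rewrite ?exprn_ile1// sqr_ge0.
  apply: le_trans (schur_le (fun i => i != k) x y r01) _.
  by apply: ler_wpM2l => //; clear -x4 y4; move: x4 y4; rewrite -/X -/Y; lra.
have QXY : Q * ((X + Y) / 2) <= 1 / 399 * ((X + Y) / 2).
  by apply: ler_wpM2r => //; clear -X0 Y0; lra.
(* A total above 1 gives [(X + Y) (1/12 - 1/48 - 1/399) <= 12 * 96^2 * r^3], and the resulting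
   constant is below [150^3]. *)
have fin : X + Y <= (150 * r) ^+ 3.
  rewrite exprMn.
  move: rx ry; rewrite -/X -/Y => rx ry.
  clear -S1 offT diagT dk offk QXY rx ry X0 Y0 r3.
  lra.
by exists k; rewrite -/X -/Y; split; clear -fin X0 Y0; lra.
Qed.

Definition cbrt (R : realType) (x : R) : R := x `^ 3^-1.

Lemma cbrt_ge0 (R : realType) (x : R) : 0 <= cbrt x.
Proof. exact: powR_ge0. Qed.

Lemma cbrtK (R : realType) (x : R) : 0 <= x -> cbrt x ^+ 3 = x.
Proof.
by move=> x0; rewrite /cbrt -powR_mulrn ?powR_ge0// -powRrM mulVf ?pnatr_eq0// powRr1.
Qed.

Lemma cbrt_uniq (R : realType) (x z : R) : 0 <= z -> z ^+ 3 = x -> cbrt x = z.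
Proof.
move=> z0 <-; apply/eqP; rewrite -(@eqrXn2 _ 3)// ?cbrt_ge0//.
by rewrite cbrtK// exprn_ge0.
Qed.

Lemma cbrtM (R : realType) (x y : R) : 0 <= x -> 0 <= y -> cbrt (x * y) = cbrt x * cbrt y.
Proof. by move=> x0 y0; rewrite /cbrt powRM. Qed.

Lemma le_cbrt (R : realType) (x y : R) : 0 <= x -> x <= y -> cbrt x <= cbrt y.
Proof.
by move=> x0 xy; apply: ge0_ler_powR => //; rewrite nnegrE//; apply: le_trans xy.
Qed.

Lemma sum_lt_geom (R : realFieldType) n (s : R) (k : 'I_n) : 0 <= s < 1 ->
  \sum_(i < n | (i < k)%N) s ^+ (k - i) <= s / (1 - s).
Proof.
move=> s01; apply: le_trans (geom_le k s01).
rewrite -(big_mkord (fun i => (i < k)%N) (fun i => s ^+ (k - i))).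
rewrite (big_cat_nat (leq0n k) (ltnW (ltn_ord k))) /= [X in _ + X]big1_seq; last first.
  by move=> i /andP[ik]; rewrite mem_index_iota => /andP[+ _]; rewrite leqNgt ik.
rewrite addr0 big_nat_rev /= add0n le_eqVlt; apply/orP; left; apply/eqP.
rewrite big_nat_cond [RHS]big_nat_cond; apply: eq_big => i; first lia.
by move=> /andP[/andP[_ ik] _]; congr (_ ^+ _); lia.
Qed.

(** The coefficient 2/3 equals the slope in [sq_le_cube], so that the masses below [k] cancel in
    [one_prime_total]; the term [a^3 / 3], taken once for [x] and once for [y], matches the loss
    [2/3 r^3] due to [lam]. *)
Lemma amgm3 (R : realFieldType) (a z : R) : 0 <= a -> 0 <= z -> a * z ^+ 2 <= 2 / 3 * z ^+ 3 + 1 / 3 * a ^+ 3.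
Proof.
move=> a0 z0; have : 0 <= (z - a) ^+ 2 * (2 * z + a).
  by apply: mulr_ge0; [exact: sqr_ge0|lra].
lra.
Qed.

Lemma prod3_le (R : realFieldType) (a b c m : R) :
  0 <= a <= m -> 0 <= b <= m -> 0 <= c <= m ->
  (1 - a) * ((1 - b) * (1 - c)) <= 1 - a - b - c + 3 * m ^+ 2.
Proof.
move=> /andP[a0 am] /andP[b0 bm] /andP[c0 cm].
have h (u v : R) : 0 <= u -> u <= m -> 0 <= v -> v <= m -> u * v <= m ^+ 2.
  by move=> *; rewrite expr2 ler_pM.
have := h a b a0 am b0 bm; have := h b c b0 bm c0 cm; have := h a c a0 am c0 cm.
have : 0 <= a * (b * c) by rewrite !mulr_ge0.
lra.
Qed.

(** For [r > 1/400], that is for finitely many primes, a constant suffices. On the range [r <= 4/5]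
    one has [r / (1 - r) <= 4], and 17 is 1 from the diagonal plus twice [4 * 2]. *)
Lemma one_prime_crude (R : realType) (n : nat) (r : R) (x y : 'I_n -> R) (e : 'I_n -> 'I_n -> R)
  (r0 : 0 <= r) (x0 : forall i, 0 <= x i) (y0 : forall i, 0 <= y i)
  (sx : \sum_i x i ^+ 3 = 1) (sy : \sum_i y i ^+ 3 = 1)
  (eb : forall i j, 0 <= e i j <= r ^+ ndist i j * (x i ^+ 2 * y j ^+ 2)) : r <= 4 / 5 ->
  \sum_i e i i + 2 * \sum_i \sum_(j | j != i) e i j <= 17.
Proof.
move=> r45.
have r01 : 0 <= r < 1 by rewrite r0; clear -r45; lra.
have Q4 : r / (1 - r) <= 4.
  by rewrite ler_pdivrMr ?subr_gt0; clear -r45; lra.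
have Q0 : 0 <= r / (1 - r) by rewrite divr_ge0// subr_ge0; clear -r45; lra.
have s4 (z : 'I_n -> R) : (forall i, 0 <= z i) -> \sum_i z i ^+ 3 = 1 -> \sum_i z i ^+ 4 <= 1.
  move=> z0 sz; rewrite -[leRHS]sz; apply: ler_sum => i _.
  rewrite exprS; apply: ler_piMl; first exact: exprn_ge0.
  apply: cube_le => //; rewrite expr1n -[leRHS]sz (bigD1 i)//= lerDl.
  by apply: sumr_ge0 => j _; apply: exprn_ge0.
have x4 := s4 x x0 sx; have y4 := s4 y y0 sy.
have d : \sum_i e i i <= 2^-1 * (\sum_i x i ^+ 4 + \sum_i y i ^+ 4).
  rewrite -big_split mulr_sumr; apply: ler_sum => i _ /=.
  have /andP[_] := eb i i; rewrite /ndist subnn expr0 mul1r => /le_trans; apply.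
  rewrite (exprM (x i) 2 2 : x i ^+ 4 = _) (exprM (y i) 2 2 : y i ^+ 4 = _).
  have := sqr_ge0 (x i ^+ 2 - y i ^+ 2); move: (x i ^+ 2) (y i ^+ 2) => a b; clear; lra.
have o : \sum_i \sum_(j | j != i) e i j <= 4 * 2.
  apply: (@le_trans _ _ (r / (1 - r) * (\sum_i x i ^+ 4 + \sum_i y i ^+ 4))); last first.
    apply: ler_pM => //; last by clear -x4 y4; lra.
    by rewrite addr_ge0// sumr_ge0// => i _; rewrite exprn_ge0.
  apply: le_trans (schur_le xpredT x y r01).
  by apply: ler_sum => i _; apply: ler_sum => j _; have /andP[] := eb i j.
by clear -x4 y4 d o; lra.
Qed.

Lemma ratio_bounds (R : realFieldType) (r : R) : 0 <= r -> r <= 1 / 3 ->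
  [/\ 0 <= r < 1, 0 <= r / (1 - r) & r / (1 - r) <= 2 * r].
Proof.
move=> r0 r3; split; first by rewrite r0; clear -r3; lra.
  by rewrite divr_ge0// subr_ge0; clear -r3; lra.
by rewrite [leRHS]mulrC; apply: ler_wpM2l => //; rewrite invf_ple ?posrE ?subr_gt0; clear -r3; lra.
Qed.

Lemma sum_cubes_off (R : realFieldType) n (k : 'I_n) (a : R) (z : 'I_n -> R) :
  0 <= a -> (forall i, 0 <= z i) -> \sum_(i | i != k) z i ^+ 3 <= a ^+ 3 ->
  (forall i, i != k -> z i <= a) /\ \sum_(i | i != k) z i ^+ 4 <= a ^+ 4.
Proof.
move=> cr0 z0 sz.
have zi i : i != k -> z i <= a.
  move=> ik; apply: cube_le => //; apply: le_trans sz.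
  by rewrite (bigD1 i)//= lerDl sumr_ge0// => j _; rewrite exprn_ge0.
split=> //; rewrite [leRHS]exprS.
apply: (@le_trans _ _ (\sum_(i | i != k) a * z i ^+ 3)).
  by apply: ler_sum => i ik; apply: pow34; rewrite z0 zi.
by rewrite -mulr_sumr; apply: ler_wpM2l.
Qed.

Lemma cubes_le1 (R : realFieldType) n (z : 'I_n -> R) i :
  (forall i, 0 <= z i) -> \sum_i z i ^+ 3 = 1 -> z i <= 1.
Proof.
move=> z0 sz; apply: cube_le => //; rewrite expr1n -[leRHS]sz (bigD1 i)//= lerDl.
by apply: sumr_ge0 => j _; apply: exprn_ge0.
Qed.

Lemma one_prime_offk (R : realType) (n : nat) (r : R) (x y : 'I_n -> R) (e : 'I_n -> 'I_n -> R)
  (r0 : 0 <= r) (x0 : forall i, 0 <= x i) (y0 : forall i, 0 <= y i)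
  (eb : forall i j, 0 <= e i j <= r ^+ ndist i j * (x i ^+ 2 * y j ^+ 2))
  (k : 'I_n) (c : R) (c1 : 1 <= c) (r3 : r <= 1 / 3)
  (sxk : \sum_(i | i != k) x i ^+ 3 <= (c * r) ^+ 3)
  (syk : \sum_(i | i != k) y i ^+ 3 <= (c * r) ^+ 3) : \sum_(i | i != k) \sum_(j | (j != k) && (j != i)) e i j <= 2 * r * (2 * (c * r) ^+ 4).
Proof.
have [r01 Q0 Q2] := ratio_bounds r0 r3.
have cr0 : 0 <= c * r by rewrite mulr_ge0//; apply: le_trans c1.
have [_ x4] := sum_cubes_off cr0 x0 sxk; have [_ y4] := sum_cubes_off cr0 y0 syk.
apply: (@le_trans _ _ (r / (1 - r) * (\sum_(i | i != k) x i ^+ 4 + \sum_(i | i != k) y i ^+ 4))); last first.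
  apply: ler_pM => //; last by clear -x4 y4; lra.
  by rewrite addr_ge0// sumr_ge0// => i _; rewrite exprn_ge0.
apply: le_trans (schur_le _ x y r01).
by apply: ler_sum => i _; apply: ler_sum => j _; have /andP[] := eb i j.
Qed.

Lemma one_prime_row (R : realType) (n : nat) (r : R) (x y : 'I_n -> R) (e : 'I_n -> 'I_n -> R)
  (r0 : 0 <= r) (x0 : forall i, 0 <= x i) (y0 : forall i, 0 <= y i)
  (sx : \sum_i x i ^+ 3 = 1) (sy : \sum_i y i ^+ 3 = 1)
  (eb : forall i j, 0 <= e i j <= r ^+ ndist i j * (x i ^+ 2 * y j ^+ 2)) (k i : 'I_n) : e i k <= r ^+ ndist i k * x i ^+ 2 /\ e k i <= r ^+ ndist i k * y i ^+ 2.
Proof.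
split.
  have /andP[_ /le_trans] := eb i k; apply; apply: ler_wpM2l; first exact: exprn_ge0.
  by apply: ler_piMr; rewrite ?exprn_ile1// ?sqr_ge0// cubes_le1.
have /andP[_ /le_trans] := eb k i; apply; rewrite ndistC; apply: ler_wpM2l; first exact: exprn_ge0.
by apply: ler_piMl; rewrite ?exprn_ile1// ?sqr_ge0// cubes_le1.
Qed.

(** The pairs containing [k] dominate: one [r] comes from the kernel and [(c r)^2] from the small
    entry. The order [r^3] is affordable because this bound is only used multiplied by [th]. *)
Lemma one_prime_off (R : realType) (n : nat) (r : R) (x y : 'I_n -> R) (e : 'I_n -> 'I_n -> R)
  (r0 : 0 <= r) (x0 : forall i, 0 <= x i) (y0 : forall i, 0 <= y i)
  (sx : \sum_i x i ^+ 3 = 1) (sy : \sum_i y i ^+ 3 = 1)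
  (eb : forall i j, 0 <= e i j <= r ^+ ndist i j * (x i ^+ 2 * y j ^+ 2))
  (k : 'I_n) (c : R) (c1 : 1 <= c) (r3 : r <= 1 / 3)
  (sxk : \sum_(i | i != k) x i ^+ 3 <= (c * r) ^+ 3)
  (syk : \sum_(i | i != k) y i ^+ 3 <= (c * r) ^+ 3) :
  \sum_i \sum_(j | j != i) e i j <= 12 * c ^+ 4 * r ^+ 3.
Proof.
have [r01 Q0 Q2] := ratio_bounds r0 r3.
have cr0 : 0 <= c * r by rewrite mulr_ge0//; apply: le_trans c1.
have offk := one_prime_offk r0 x0 y0 eb c1 r3 sxk syk.
have ek := one_prime_row r0 x0 y0 sx sy eb k.
have [xi _] := sum_cubes_off cr0 x0 sxk; have [yi _] := sum_cubes_off cr0 y0 syk.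
have row (z : 'I_n -> R) : (forall i, 0 <= z i) -> (forall i, i != k -> z i <= c * r) ->
    \sum_(i | i != k) r ^+ ndist i k * z i ^+ 2 <= 4 * c ^+ 2 * r ^+ 3.
  move=> z0 zi.
  apply: (@le_trans _ _ (\sum_(i | i != k) r ^+ ndist k i * (c * r) ^+ 2)).
    apply: ler_sum => i ik; rewrite ndistC; apply: ler_wpM2l; first exact: exprn_ge0.
    by rewrite ler_pXn2r ?nnegrE// zi.
  rewrite -mulr_suml.
  apply: (@le_trans _ _ (2 * (2 * r) * (c * r) ^+ 2)).
    apply: ler_wpM2r; first exact: exprn_ge0.
    apply: le_trans (sum_geom_ndist k r01) _.
    by rewrite ler_pM2l ?ltr0n.
  by rewrite le_eqVlt; apply/orP; left; apply/eqP; clear; ring.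
rewrite (bigD1 k)//=.
rewrite [X in _ + X](eq_bigr (fun i => e i k + \sum_(j | (j != k) && (j != i)) e i j)); last first.
  move=> i ik; rewrite (bigD1 k) 1?eq_sym//=; congr (_ + _); apply: eq_bigl => j.
  by rewrite andbC.
rewrite big_split /=.
have h1 : \sum_(j | j != k) e k j <= 4 * c ^+ 2 * r ^+ 3.
  by apply: le_trans (row y y0 yi); apply: ler_sum => i _; case: (ek i).
have h2 : \sum_(j | j != k) e j k <= 4 * c ^+ 2 * r ^+ 3.
  by apply: le_trans (row x x0 xi); apply: ler_sum => i _; case: (ek i).
have c24 : c ^+ 2 * r ^+ 3 <= c ^+ 4 * r ^+ 3.
  by apply: ler_wpM2r; [exact: exprn_ge0|exact: ler_weXn2l].
have r53 : r * (c * r) ^+ 4 <= 1 / 3 * (c ^+ 4 * r ^+ 3).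
  rewrite (_ : r * _ = (r ^+ 2) * (c ^+ 4 * r ^+ 3)); last by clear; ring.
  apply: ler_wpM2r; first by rewrite mulr_ge0// exprn_ge0// (le_trans _ c1).
  by apply: (le_trans _ r3); rewrite expr2; apply: ler_piMr => //; clear -r3; lra.
have := offk; have : 0 <= c ^+ 4 * r ^+ 3 by rewrite mulr_ge0// exprn_ge0// (le_trans _ c1).
by clear -h1 h2 c24 r53; lra.
Qed.

(* The off-diagonal terms are [O(r^3)], which is too much; the bound [eB] on the terms with [minn i j = k] recovers the missing factor, by comparing the mass lost below [k] (a cube) with its contribution (a square). *)
Lemma one_prime_total (R : realType) (n : nat) (r : R) (x y : 'I_n -> R) (e : 'I_n -> 'I_n -> R)
  (r0 : 0 <= r) (x0 : forall i, 0 <= x i) (y0 : forall i, 0 <= y i)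
  (sx : \sum_i x i ^+ 3 = 1) (sy : \sum_i y i ^+ 3 = 1)
  (eb : forall i j, 0 <= e i j <= r ^+ ndist i j * (x i ^+ 2 * y j ^+ 2))
  (k : 'I_n) (c : R) (c1 : 1 <= c) (r3 : r <= 1 / 3)
  (sxk : \sum_(i | i != k) x i ^+ 3 <= (c * r) ^+ 3)
  (syk : \sum_(i | i != k) y i ^+ 3 <= (c * r) ^+ 3)
  (lam u v : R) (lam0 : 0 <= lam) (lam3 : lam ^+ 3 = 1 - r ^+ 3) (u0 : 0 <= u) (v0 : 0 <= v)
  (u3 : u ^+ 3 = \sum_(i < n | (k <= i)%N) x i ^+ 3)
  (v3 : v ^+ 3 = \sum_(i < n | (k <= i)%N) y i ^+ 3)
  (eB : \sum_(i < n) \sum_(j < n | minn i j == k) e i j <=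
    (if k == 0%N :> nat then 1 else lam ^+ 2) * (u ^+ 2 * v ^+ 2)) : \sum_i \sum_j e i j <= 1 + (4 * c ^+ 4 + 3 * c ^+ 6 + 2) * r ^+ 4.
Proof.
have [r01 Q0 Q2] := ratio_bounds r0 r3.
have cr0 : 0 <= c * r by rewrite mulr_ge0//; apply: le_trans c1.
have offk := one_prime_offk r0 x0 y0 eb c1 r3 sxk syk.
have ek := one_prime_row r0 x0 y0 sx sy eb k.
have [_ x4] := sum_cubes_off cr0 x0 sxk; have [_ y4] := sum_cubes_off cr0 y0 syk.
(* A pair with [minn i j] different from [k] either avoids [k] altogether or joins [k] to a smaller
   index. *)
have split3 : \sum_i \sum_j e i j <= \sum_(i < n) \sum_(j < n | minn i j == k) e i j +
   \sum_(i | i != k) \sum_(j | j != k) e i j +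
   (\sum_(i < n | (i < k)%N) e i k + \sum_(j < n | (j < k)%N) e k j).
  have -> : \sum_(i < n | (i < k)%N) e i k = \sum_(i < n) \sum_(j < n) (if (i < k)%N && (j == k) then e i j else 0).
    rewrite big_mkcond; apply: eq_bigr => i _; case: ifP => ik.
      by rewrite -big_mkcond big_pred1_eq.
    by rewrite big1.
  have -> : \sum_(j < n | (j < k)%N) e k j = \sum_(i < n) \sum_(j < n) (if (j < k)%N && (i == k) then e i j else 0).
    rewrite exchange_big /= big_mkcond; apply: eq_bigr => j _; case: ifP => ik.
      by rewrite -big_mkcond big_pred1_eq.
    by rewrite big1.
  have -> : \sum_(i | i != k) \sum_(j | j != k) e i j =
      \sum_(i < n) \sum_(j < n) (if (i != k) && (j != k) then e i j else 0).
    rewrite big_mkcond; apply: eq_bigr => i _; case: ifP => ik.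
      by rewrite big_mkcond.
    by rewrite big1.
  rewrite -!big_split /=; apply: ler_sum => i _.
  rewrite [X in _ <= X + _ + _]big_mkcond -!big_split /=; apply: ler_sum => j _.
  have /andP[e0 _] := eb i j.
  rewrite -!(inj_eq val_inj) /=.
  have : [|| minn i j == k :> nat, (i != k :> nat) && (j != k :> nat),
     (i < k)%N && (j == k :> nat) | (j < k)%N && (i == k :> nat)].
    by clear; lia.
  by case: (minn i j == k) => /=; case: ((i != k :> nat) && _) => /=; case: ((i < k)%N && _) => /=;
    case: ((j < k)%N && _) => //= _; clear -e0; lra.
have both : \sum_(i | i != k) \sum_(j | j != k) e i j <= (c * r) ^+ 4 + 2 * r * (2 * (c * r) ^+ 4).
  rewrite (eq_bigr (fun i => e i i + \sum_(j | (j != k) && (j != i)) e i j)); last first.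
    by move=> i ik; rewrite (bigD1 i).
  rewrite big_split /=; apply: lerD; last exact: offk.
  apply: (@le_trans _ _ (2^-1 * (\sum_(i | i != k) x i ^+ 4 + \sum_(i | i != k) y i ^+ 4))).
    rewrite -big_split mulr_sumr; apply: ler_sum => i _ /=.
    have /andP[_] := eb i i; rewrite /ndist subnn expr0 mul1r => /le_trans; apply.
    rewrite (exprM (x i) 2 2 : x i ^+ 4 = _) (exprM (y i) 2 2 : y i ^+ 4 = _).
    have := sqr_ge0 (x i ^+ 2 - y i ^+ 2); move: (x i ^+ 2) (y i ^+ 2) => a b; clear; lra.
  by clear -x4 y4; lra.
have r4 : 0 <= r ^+ 4 by exact: exprn_ge0.
have c4 : 1 <= c ^+ 4 by exact: exprn_ege1.
have c6 : 1 <= c ^+ 6 by exact: exprn_ege1.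
have r34 : r * (c * r) ^+ 4 <= 1 / 3 * (c ^+ 4 * r ^+ 4).
  by rewrite exprMn; apply: ler_wpM2r => //; rewrite mulr_ge0// (le_trans _ c4).
have both2 : \sum_(i | i != k) \sum_(j | j != k) e i j <= 3 * (c ^+ 4 * r ^+ 4).
  have : 0 <= c ^+ 4 * r ^+ 4 by rewrite mulr_ge0// (le_trans _ c4).
  by move: both; rewrite exprMn => both; rewrite exprMn in r34; clear -both r34; lra.
have c6r : 0 <= c ^+ 6 * r ^+ 4 by rewrite mulr_ge0// (le_trans _ c6).
have c4r : 0 <= c ^+ 4 * r ^+ 4 by rewrite mulr_ge0// (le_trans _ c4).
(* If [k = 0], no index lies below [k], and the factor 1 in [eB] suffices. *)
have [k0|k0] := boolP (k == 0%N :> nat).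
  rewrite k0 mul1r in eB.
  have all (z : 'I_n -> R) : \sum_(i < n | (k <= i)%N) z i ^+ 3 = \sum_i z i ^+ 3.
    by apply: eq_bigl => i; rewrite (eqP k0).
  have u1 : u <= 1 by apply: cube_le => //; rewrite u3 all sx expr1n.
  have v1 : v <= 1 by apply: cube_le => //; rewrite v3 all sy expr1n.
  have uv : u ^+ 2 * v ^+ 2 <= 1.
    by rewrite mulr_ile1 ?exprn_ge0 ?exprn_ile1.
  have z1 : \sum_(i < n | (i < k)%N) e i k = 0.
    by rewrite big1// => i; rewrite (eqP k0).
  have z2 : \sum_(i < n | (i < k)%N) e k i = 0.
    by rewrite big1// => i; rewrite (eqP k0).
  rewrite z1 z2 in split3.
  by clear -split3 both2 uv eB r4 c4 c6 c6r c4r; lra.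
rewrite (negbTE k0) in eB.
pose xm := \sum_(i < n | (i < k)%N) x i ^+ 3; pose ym := \sum_(i < n | (i < k)%N) y i ^+ 3.
have mE (z : 'I_n -> R) : \sum_i z i ^+ 3 = 1 ->
    \sum_(i < n | (i < k)%N) z i ^+ 3 = 1 - \sum_(i < n | (k <= i)%N) z i ^+ 3.
  rewrite (bigID (fun i : 'I_n => (k <= i)%N)) /= => <-; rewrite [RHS]addrC addKr.
  by apply: eq_bigl => i; rewrite ltnNge.
have mle (z : 'I_n -> R) : (forall i, 0 <= z i) ->
    0 <= \sum_(i < n | (i < k)%N) z i ^+ 3 <= \sum_(i | i != k) z i ^+ 3.
  move=> z0; apply/andP; split; first by apply: sumr_ge0 => i _; apply: exprn_ge0.
  rewrite big_mkcond [leRHS]big_mkcond; apply: ler_sum => i _.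
  rewrite -(inj_eq val_inj) /=; case: ltngtP => _ //=; exact: exprn_ge0.
have /andP[xm0 xmc] := mle x x0; have /andP[ym0 ymc] := mle y y0.
have cr3 : (c * r) ^+ 3 = c ^+ 3 * r ^+ 3 by rewrite exprMn.
have m3 : 0 <= c ^+ 3 * r ^+ 3 by rewrite -cr3 exprn_ge0.
have c3 : 1 <= c ^+ 3 by exact: exprn_ege1.
have rr3 : 0 <= r ^+ 3 by exact: exprn_ge0.
have rc3 : r ^+ 3 <= c ^+ 3 * r ^+ 3 by rewrite ler_peMl.
(* The three factors are linearised at 1. Their linear losses are exactly what [s1] and [s2] add
   below, so that only terms of order [r^6] remain from these three bounds. *)
have B1 : lam ^+ 2 * (u ^+ 2 * v ^+ 2) <=
   1 - 2 / 3 * r ^+ 3 - 2 / 3 * xm - 2 / 3 * ym + 3 * (c ^+ 3 * r ^+ 3) ^+ 2.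
  have hl := sq_le_cube lam0; have hu := sq_le_cube u0; have hv := sq_le_cube v0.
  rewrite lam3 in hl; rewrite u3 -(mE _ sx) -/xm in hu; rewrite v3 -(mE _ sy) -/ym in hv.
  apply: le_trans (prod3_le (a := 2 / 3 * r ^+ 3) (b := 2 / 3 * xm) (c := 2 / 3 * ym) (m := c ^+ 3 * r ^+ 3) _ _ _); last 3 first.
  - by clear -rr3 rc3; lra.
  - by move: xm0 (le_trans xmc sxk); rewrite cr3 -/xm; clear; lra.
  - by move: ym0 (le_trans ymc syk); rewrite cr3 -/ym; clear; lra.
  have l0 := sqr_ge0 lam; have uu := sqr_ge0 u; have vv := sqr_ge0 v.
  apply: ler_pM => //; first exact: mulr_ge0.
    by clear -hl; lra.
  by apply: ler_pM.
have side (z : 'I_n -> R) : (forall i, 0 <= z i) ->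
    \sum_(i < n | (i < k)%N) r ^+ ndist i k * z i ^+ 2 <=
    2 / 3 * (\sum_(i < n | (i < k)%N) z i ^+ 3) + 1 / 3 * (r ^+ 3 + 2 * r ^+ 6).
  move=> z0; apply: (@le_trans _ _ (\sum_(i < n | (i < k)%N) (2 / 3 * z i ^+ 3 + 1 / 3 * (r ^+ 3) ^+ (k - i)))).
    apply: ler_sum => i ik; rewrite (_ : ndist i k = k - i)%N; last by rewrite /ndist; clear -ik; lia.
    by rewrite -exprM mulnC exprM; apply: amgm3 => //; exact: exprn_ge0.
  rewrite big_split /= -!mulr_sumr lerD2l ler_pM2l; last by clear; lra.
  have r31 : 0 <= r ^+ 3 < 1.
    rewrite rr3 /= (@le_lt_trans _ _ ((1/3) ^+ 3))//; last by clear; lra.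
    by rewrite ler_pXn2r ?nnegrE//; clear; lra.
  apply: le_trans (sum_lt_geom k r31) _.
  have r33 : r ^+ 3 <= 1 / 2.
    apply: (@le_trans _ _ ((1 / 3) ^+ 3)); last by clear; lra.
    by rewrite ler_pXn2r ?nnegrE//; clear; lra.
  rewrite ler_pdivrMr; last by clear -r33; lra.
  rewrite (exprM r 3 2 : r ^+ 6 = _); move: (r ^+ 3) rr3 r33 => w w0 w1; clear -w0 w1.
  have : 0 <= w ^+ 2 * (1 - 2 * w) by rewrite mulr_ge0 ?sqr_ge0//; lra.
  by lra.
have s1 : \sum_(i < n | (i < k)%N) e i k <= 2 / 3 * xm + 1 / 3 * (r ^+ 3 + 2 * r ^+ 6).
  by apply: le_trans (side x x0); apply: ler_sum => i _; case: (ek i).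
have s2 : \sum_(i < n | (i < k)%N) e k i <= 2 / 3 * ym + 1 / 3 * (r ^+ 3 + 2 * r ^+ 6).
  by apply: le_trans (side y y0); apply: ler_sum => i _; case: (ek i).
have r64 : r ^+ 6 <= r ^+ 4 by rewrite ler_wiXn2l//; clear -r3; lra.
have c6e : (c ^+ 3 * r ^+ 3) ^+ 2 <= c ^+ 6 * r ^+ 4.
  by rewrite exprMn -!exprM; apply: ler_wpM2l => //; exact: le_trans c6.
by clear -split3 both2 eB r4 c4 c6 c6r c4r B1 s1 s2 r64 c6e; lra.
Qed.

(* Here [r = p^(-1/3)], and [x i], [y j] are the cube roots of the proportions of the masses carried by valuation [i], resp. [j]. *)
Lemma one_prime (R : realType) : exists2 A : R, 0 <= A &
  forall n (r th lam : R) (x y : 'I_n -> R) (e : 'I_n -> 'I_n -> R),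
  0 <= r <= 4 / 5 -> 0 <= th <= 1 ->
  0 <= lam -> lam ^+ 3 = 1 - r ^+ 3 ->
  (forall i, 0 <= x i) -> (forall i, 0 <= y i) ->
  \sum_i x i ^+ 3 = 1 -> \sum_i y i ^+ 3 = 1 ->
  (forall i j, 0 <= e i j <= r ^+ ndist i j * (x i ^+ 2 * y j ^+ 2)) ->
  (forall k : 'I_n, \sum_(i < n) \sum_(j < n | minn i j == k) e i j <=
    (if k == 0%N :> nat then 1 else lam ^+ 2) *
    (cbrt (\sum_(i < n | (k <= i)%N) x i ^+ 3) ^+ 2 *
     cbrt (\sum_(i < n | (k <= i)%N) y i ^+ 3) ^+ 2)) ->
  \sum_i e i i + (1 + th) * \sum_i \sum_(j | j != i) e i j <= 1 + A * (r ^+ 4 + th * r ^+ 3).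
Proof.
have conc := @concentration R.
have c1 : 1 <= 150 :> R by lra.
move: (150 : R) c1 conc => c c1 conc.
have cp m : 0 <= c ^+ m by rewrite exprn_ge0// (le_trans _ c1).
have [A0 A0E] : exists A0 : R, A0 = 4 * c ^+ 4 + 3 * c ^+ 6 + 2 by eexists.
have A00 : 0 <= A0 by rewrite A0E; have := cp 4%N; have := cp 6%N; clear; lra.
(* This makes the crude bound 17 at most [1 + A1 * r ^+ 4] when [r > 1/400]. *)
have [A1 A10 A1P] : exists2 A1 : R, 0 <= A1 & forall r, 400^-1 < r -> 16 <= A1 * r ^+ 4.
  exists (16 * 400 ^+ 4).
    by apply: mulr_ge0; [exact: ler0n|apply: exprn_ge0; exact: ler0n].
  move=> r rlt; rewrite -mulrA -exprMn -[leLHS]mulr1; apply: ler_wpM2l; first exact: ler0n.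
  by apply: exprn_ege1; rewrite mulrC -ler_pdivrMr ?ltr0n// div1r ltW.
exists (A1 + A0 + 12 * c ^+ 4); first by have := cp 4%N; clear -A00 A10; lra.
move=> n r th lam x y e /andP[r0 r45] /andP[th0 th1] lam0 lam3 x0 y0 sx sy eb eB.
have e0 i j : 0 <= e i j by have /andP[] := eb i j.
have off0 : 0 <= \sum_i \sum_(j | j != i) e i j.
  by apply: sumr_ge0 => i _; apply: sumr_ge0.
have r4 : 0 <= r ^+ 4 by exact: exprn_ge0.
have r3 : 0 <= th * r ^+ 3 by rewrite mulr_ge0// exprn_ge0.
have le2 : \sum_i e i i + (1 + th) * \sum_i \sum_(j | j != i) e i j <=
   \sum_i e i i + 2 * \sum_i \sum_(j | j != i) e i j.
  by rewrite lerD2l; apply: ler_wpM2r => //; clear -th1; lra.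
have AA (X : R) : 0 <= X -> 0 <= A1 * X /\ 0 <= A0 * X /\ 0 <= c ^+ 4 * X.
  by move=> X0; do ?split; apply: mulr_ge0.
have [A14 [A04 c44]] := AA _ r4; have [A13 [A03 c43]] := AA _ r3.
have [S1|S1] := lerP (\sum_i e i i + 2 * \sum_i \sum_(j | j != i) e i j) 1.
  apply: (le_trans le2); apply: (le_trans S1).
  by clear -A14 A04 c44 A13 A03 c43; lra.
have [r400|r400] := lerP r 400^-1; last first.
  apply: (le_trans le2); apply: (le_trans (one_prime_crude r0 x0 y0 sx sy eb r45)).
  have := A1P r r400.
  by clear -A14 A04 c44 A13 A03 c43; lra.
have rr : 0 <= r <= 400^-1 by rewrite r0.
have [k [sxk syk]] := conc _ _ _ _ _ rr x0 y0 sx sy eb S1.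
have r13 : r <= 1 / 3 by clear -r400; lra.
have sge (z : 'I_n -> R) : (forall i, 0 <= z i) -> 0 <= \sum_(i < n | (k <= i)%N) z i ^+ 3.
  by move=> z0; apply: sumr_ge0 => i _; apply: exprn_ge0.
have tot := one_prime_total r0 x0 y0 sx sy eb c1 r13 sxk syk lam0 lam3
  (cbrt_ge0 _) (cbrt_ge0 _) (cbrtK (sge x x0)) (cbrtK (sge y y0)) (eB k).
have off := one_prime_off r0 x0 y0 sx sy eb c1 r13 sxk syk.
have toff := ler_wpM2l th0 off.
have totE : \sum_i \sum_j e i j = \sum_i e i i + \sum_i \sum_(j | j != i) e i j.
  by rewrite -big_split; apply: eq_bigr => i _; rewrite (bigD1 i).
rewrite totE -A0E in tot.
by clear -A14 A04 c44 A13 A03 c43 tot toff; lra.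
Qed.

Lemma card_le_inj (T : finType) (S : {set T}) (a : T -> nat) (M : nat) :
  {in S &, injective a} -> (forall v, v \in S -> (0 < a v <= M)%N) -> (#|S| <= M)%N.
Proof.
case: M => [|M] ainj aM.
  rewrite leqn0 cards_eq0; apply/eqP/setP => v; rewrite inE; apply/negP => vS.
  by have := aM v vS; lia.
pose h v : 'I_M.+1 := inord (a v).-1.
have hinj : {in S &, injective h}.
  move=> v w vS wS /(congr1 val) /=; rewrite !inordK; last 2 first.
  - by have := aM w wS; lia.
  - by have := aM v vS; lia.
  by move=> E; apply: ainj => //; have := aM w wS; have := aM v vS; lia.
by rewrite -(card_in_imset hinj) -[leqRHS](card_ord M.+1) max_card.
Qed.

(** * The energy inequality *)

(* Prune to a subgraph of large minimal degrees by maximising the edge weight minus a multiple of the masses, then compare with [tau] at the vertex with the largest label and at its neighbour with the largest label. *)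
Lemma coprime_edges (R : realFieldType) (T1 T2 : finType) (a : T1 -> nat) (b : T2 -> nat)
  (f : T1 -> R) (g : T2 -> R) (E : T1 -> T2 -> bool) (tau : R) :
  0 <= tau -> (forall v, 0 <= f v) -> (forall w, 0 <= g w) ->
  (forall v, 0 < a v)%N -> (forall w, 0 < b w)%N ->
  (forall v v', f v != 0 -> f v' != 0 -> a v = a v' -> v = v') ->
  (forall v v', g v != 0 -> g v' != 0 -> b v = b v' -> v = v') ->
  (forall v w, E v w -> (b w)%:R * f v <= tau /\ (a v)%:R * g w <= tau) ->
  (\sum_v \sum_(w | E v w) f v * g w) ^+ 2 <= 16 * tau ^+ 2 * ((\sum_v f v) * (\sum_w g w)).
Proof.
move=> tau0 f0 g0 a0 b0 fa gb HE.
pose mu := \sum_v f v; pose nu := \sum_w g w; pose e := \sum_v \sum_(w | E v w) f v * g w.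
rewrite -/mu -/nu -/e.
have mu0 : 0 <= mu by apply: sumr_ge0.
have nu0 : 0 <= nu by apply: sumr_ge0.
have e0 : 0 <= e by apply: sumr_ge0 => v _; apply: sumr_ge0 => w _; rewrite mulr_ge0.
have emn : e <= mu * nu.
  rewrite /mu mulr_suml; apply: ler_sum => v _; rewrite /nu mulr_sumr.
  by rewrite big_mkcond; apply: ler_sum => w _; case: ifP => // _; rewrite mulr_ge0.
have rhs0 : 0 <= 16 * tau ^+ 2 * (mu * nu) by rewrite !mulr_ge0// exprn_ge0.
have [e_eq|e_neq] := eqVneq e 0; first by rewrite e_eq expr0n.
have e_gt : 0 < e by rewrite lt_neqAle eq_sym e_neq.
have mn_gt : 0 < mu * nu by exact: lt_le_trans emn.
have mu_gt : 0 < mu by rewrite lt_neqAle mu0 andbT eq_sym; apply: contraTneq mn_gt => ->; rewrite mul0r ltxx.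
have nu_gt : 0 < nu by rewrite lt_neqAle nu0 andbT eq_sym; apply: contraTneq mn_gt => ->; rewrite mulr0 ltxx.
(* A quarter of the mean degree on each side: the penalties of the full graph then add up to
   [e / 2], so the maximum of [Phi] is positive. *)
pose al := e / (4 * mu); pose be := e / (4 * nu).
have al0 : 0 < al by rewrite divr_gt0// mulr_gt0.
have be0 : 0 < be by rewrite divr_gt0// mulr_gt0.
pose ee (A : {set T1}) (B : {set T2}) := \sum_(v in A) \sum_(w in B | E v w) f v * g w.
pose Phi (X : {set T1} * {set T2}) := ee X.1 X.2 - al * \sum_(v in X.1) f v - be * \sum_(w in X.2) g w.
have PhiT : Phi (finset.setTfor T1, finset.setTfor T2) = e / 2.
  rewrite /Phi /ee /= [X in _ - al * X](_ : _ = mu); last by apply: eq_bigl => v; rewrite inE.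
  rewrite [X in _ - be * X](_ : _ = nu); last by apply: eq_bigl => v; rewrite inE.
  rewrite [X in X - _ - _](_ : _ = e); last first.
    apply: eq_big => [v|v _]; first by rewrite inE.
    by apply: eq_bigl => w; rewrite inE.
  rewrite /al /be; field.
  by rewrite !gt_eqF.
pose X0 := [arg max_(X > (finset.setTfor T1, finset.setTfor T2)) Phi X]%O.
have Xmax X : Phi X <= Phi X0.
  by rewrite /X0; case: Order.TotalTheory.arg_maxP => // X' _; apply.
case: X0 Xmax => A B Xmax.
have PhiAB : 0 < Phi (A, B).
  by apply: lt_le_trans (Xmax (finset.setTfor T1, finset.setTfor T2)); rewrite PhiT divr_gt0.
(* Deleting [v] from an optimal pair cannot increase [Phi], which bounds the degree of [v] from
   below. *)
have degA v : v \in A -> f v != 0 -> al <= \sum_(w in B | E v w) g w.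
  move=> vA fv; have fv0 : 0 < f v by rewrite lt_neqAle eq_sym fv f0.
  have := Xmax (A :\ v, B); rewrite /Phi /ee /=.
  rewrite (big_setD1 v vA) /= [X in _ <= _ - al * X - _](big_setD1 v vA) /=.
  rewrite -mulr_sumr => H; rewrite -(ler_pM2l fv0).
  move: H; set s1 := \sum_(i in A :\ v) _; set s2 := \sum_(i in A :\ v) _; clear; lra.
have degB w : w \in B -> g w != 0 -> be <= \sum_(v in A | E v w) f v.
  move=> wB gw; have gw0 : 0 < g w by rewrite lt_neqAle eq_sym gw g0.
  have := Xmax (A, B :\ w); rewrite /Phi /=.
  have -> : ee A B = g w * \sum_(v in A | E v w) f v + ee A (B :\ w).
    rewrite /ee mulr_sumr [X in _ = X + _]big_mkcondr -big_split /=.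
    apply: eq_bigr => v vA; rewrite big_mkcondr (big_setD1 w wB) /= [in RHS]big_mkcondr /=.
    by congr (_ + _); case: ifP => //; rewrite mulrC.
  rewrite [X in _ <= _ - _ - be * X](big_setD1 w wB) /= => H; rewrite -(ler_pM2l gw0).
  move: H; set s1 := ee _ _; set s2 := \sum_(i in B :\ w) _; clear; lra.
have eAB : 0 < ee A B.
  move: PhiAB; rewrite /Phi /=; have : 0 <= al * \sum_(v in A) f v.
    by apply: mulr_ge0 (ltW al0) _; apply: sumr_ge0.
  have : 0 <= be * \sum_(v in B) g v by apply: mulr_ge0 (ltW be0) _; apply: sumr_ge0.
  clear; lra.
have [v0 /andP[v0A fv0]] : exists v, (v \in A) && (f v != 0).
  apply/existsP; apply: contraTT eAB => /existsPn H; rewrite -leNgt le_eqVlt; apply/orP; left; apply/eqP.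
  apply: big1 => v vA; apply: big1 => w _; have := H v; rewrite vA /= negbK => /eqP ->.
  by rewrite mul0r.
pose v1 := [arg max_(v > v0 | (v \in A) && (f v != 0)%R) a v]%N.
have [v1A fv1 v1max] : [/\ v1 \in A, f v1 != 0 & forall v, v \in A -> f v != 0 -> (a v <= a v1)%N].
  rewrite /v1; case: arg_maxnP => [|v /andP[? ?] H]; first by rewrite v0A fv0.
  by split=> // v' v'A fv'; apply: H; rewrite v'A.
have [w0 /andP[w0B /andP[Ew0 gw0]]] : exists w, (w \in B) && (E v1 w && (g w != 0)).
  apply/existsP; apply: contraTT al0 => /existsPn H; rewrite -leNgt.
  apply: le_trans (degA v1 v1A fv1) _; rewrite big1// => w /andP[wB Ew].
  by have := H w; rewrite wB Ew /= negbK => /eqP.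
pose w1 := [arg max_(w > w0 | (w \in B) && (E v1 w && (g w != 0)%R)) b w]%N.
have [w1B Ew1 gw1 w1max] : [/\ w1 \in B, E v1 w1, g w1 != 0 &
    forall w, w \in B -> E v1 w -> g w != 0 -> (b w <= b w1)%N].
  rewrite /w1; case: arg_maxnP => [|w /andP[? /andP[? ?]] H]; first by rewrite w0B Ew0.
  by split=> // w' ? ? ?; apply: H; apply/andP; split => //; apply/andP.
have av1 : 0 < (a v1)%:R :> R by rewrite ltr0n.
have bw1 : 0 < (b w1)%:R :> R by rewrite ltr0n.
(* The neighbours of [v1] in the support have distinct labels, at most [b w1], and each weighs at
   most [tau / a v1]. In the product of [hal] and [hbe] the labels cancel. *)
have hal : al <= (b w1)%:R * (tau / (a v1)%:R).
  apply: le_trans (degA v1 v1A fv1) _.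
  pose S := [set w in B | E v1 w && (g w != 0)].
  have -> : \sum_(w in B | E v1 w) g w = \sum_(w in S) g w.
    rewrite [RHS](eq_bigl (fun w => ((w \in B) && E v1 w) && (g w != 0))); last first.
      by move=> w; rewrite inE andbA.
    by rewrite [RHS]big_mkcondr; apply: eq_bigr => w _; case: eqVneq.
  apply: (@le_trans _ _ (\sum_(w in S) tau / (a v1)%:R)).
    apply: ler_sum => w; rewrite inE => /andP[_ /andP[Ew _]].
    by rewrite ler_pdivlMr// mulrC; case: (HE _ _ Ew).
  rewrite sumr_const -[leLHS]mulr_natl; apply: ler_wpM2r; first by rewrite divr_ge0// ltW.
  rewrite ler_nat; apply: card_le_inj => [w w'|w].
    by rewrite !inE => /andP[_ /andP[_ gw]] /andP[_ /andP[_ gw']]; apply: gb.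
  by rewrite inE => /andP[wB /andP[Ew gw]]; rewrite b0 w1max.
have hbe : be <= (a v1)%:R * (tau / (b w1)%:R).
  apply: le_trans (degB w1 w1B gw1) _.
  pose S := [set v in A | E v w1 && (f v != 0)].
  have -> : \sum_(v in A | E v w1) f v = \sum_(v in S) f v.
    rewrite [RHS](eq_bigl (fun v => ((v \in A) && E v w1) && (f v != 0))); last first.
      by move=> w; rewrite inE andbA.
    by rewrite [RHS]big_mkcondr; apply: eq_bigr => w _; case: eqVneq.
  apply: (@le_trans _ _ (\sum_(w in S) tau / (b w1)%:R)).
    apply: ler_sum => w; rewrite inE => /andP[_ /andP[Ew _]].
    by rewrite ler_pdivlMr// mulrC; case: (HE _ _ Ew).
  rewrite sumr_const -[leLHS]mulr_natl; apply: ler_wpM2r; first by rewrite divr_ge0// ltW.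
  rewrite ler_nat; apply: card_le_inj => [w w'|w].
    by rewrite !inE => /andP[_ /andP[_ gw]] /andP[_ /andP[_ gw']]; apply: fa.
  by rewrite inE => /andP[wB /andP[Ew gw]]; rewrite a0 v1max.
have : al * be <= tau ^+ 2.
  apply: (le_trans (ler_pM (ltW al0) (ltW be0) hal hbe)).
  rewrite le_eqVlt; apply/orP; left; apply/eqP; field.
  by rewrite !gt_eqF.
have -> : al * be = e ^+ 2 / (16 * (mu * nu)).
  by rewrite /al /be; field; rewrite !gt_eqF.
by rewrite ler_pdivrMr ?mulr_gt0// => /le_trans; apply; rewrite le_eqVlt; apply/orP; left; apply/eqP; ring.
Qed.

(* With [P] containing the primes dividing [v], this is [phi(v) / v]. *)
Definition kap (R : realType) (P : seq nat) (v : nat) : R :=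
  \prod_(p <- P | (p %| v)%N) (1 - p%:R^-1).

(* The condition [logn p v != logn p w] says that [p] divides [v w / gcd(v,w)^2]. *)
Definition wt (R : realType) (t : nat) (P : seq nat) (v w : nat) : R :=
  \prod_(p <- P | (t < p)%N && (logn p v != logn p w)) (1 + t%:R / p%:R).

(** In the application [f v] is [v * rho v], and the first edge condition reads
    [lcm(v,w) * rho v <= tau]. Injectivity is asked on the supports only, so that [energy_reduce]
    can keep the vertex types and switch vertices off by giving them weight 0. *)
Definition instance (R : realType) (P : seq nat) (tau : R) (T1 T2 : finType)
    (a : T1 -> nat) (b : T2 -> nat) (f : T1 -> R) (g : T2 -> R) (E : T1 -> T2 -> bool) : Prop :=
  [/\ (forall v, 0 <= f v) /\ (forall w, 0 <= g w),
      (forall v, 0 < a v)%N /\ (forall w, 0 < b w)%N,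
      (forall v v', f v != 0 -> f v' != 0 -> a v = a v' -> v = v') /\
      (forall w w', g w != 0 -> g w' != 0 -> b w = b w' -> w = w') &
      forall v w, E v w -> [/\ (b w)%:R * f v <= tau * (gcdn (a v) (b w))%:R,
        (a v)%:R * g w <= tau * (gcdn (a v) (b w))%:R &
        forall p, prime p -> (p %| gcdn (a v) (b w))%N -> p \in P]].

Definition mass (R : realType) (P : seq nat) (T : finType) (a : T -> nat) (f : T -> R) : R :=
  \sum_v f v * kap R P (a v).

Definition energy (R : realType) (t : nat) (P : seq nat) (T1 T2 : finType)
    (a : T1 -> nat) (b : T2 -> nat) (f : T1 -> R) (g : T2 -> R) (E : T1 -> T2 -> bool) : R :=
  \sum_v \sum_(w | E v w) (f v * kap R P (a v)) * (g w * kap R P (b w)) * wt R t P (a v) (b w).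

Definition energy_bound (R : realType) (t : nat) (P : seq nat) (C : R) : Prop :=
  forall (tau : R) (T1 T2 : finType) (a : T1 -> nat) (b : T2 -> nat) (f : T1 -> R) (g : T2 -> R)
    (E : T1 -> T2 -> bool), 0 < tau -> instance P tau a b f g E ->
  energy t P a b f g E <= C * cbrt (tau * (mass P a f * mass P b g)) ^+ 2.

Lemma kap_ge0 (R : realType) P v : all prime P -> 0 <= kap R P v.
Proof.
move=> /allP Pp; rewrite /kap big_seq_cond; apply: prodr_ge0 => p /andP[/Pp pp _].
by rewrite subr_ge0 invf_le1 ?ltr0n ?prime_gt0// ler1n prime_gt0.
Qed.

Lemma wt_ge0 (R : realType) t P v w : 0 <= wt R t P v w.
Proof. by apply: prodr_ge0 => p _; rewrite addr_ge0// divr_ge0. Qed.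

Lemma prime_dvd_pmul (p q k n : nat) : prime p -> prime q -> q != p ->
  (q %| p ^ k * n)%N = (q %| n)%N.
Proof.
move=> pp pq qp; rewrite Gauss_dvdr//; apply: coprimeXr.
by rewrite prime_coprime// dvdn_prime2.
Qed.

Lemma logn_pmul (p q k n : nat) : prime p -> prime q -> q != p -> (0 < n)%N ->
  logn q (p ^ k * n)%N = logn q n.
Proof.
move=> pp pq qp n0.
have pk : (0 < p ^ k)%N by rewrite expn_gt0 prime_gt0.
by rewrite (lognM q pk n0) lognX logn_prime// (negbTE qp) muln0.
Qed.

Lemma kap_pmul (R : realType) P p k n : prime p -> all prime P -> p \notin P ->
  kap R P (p ^ k * n)%N = kap R P n.
Proof.
move=> pp /allP Pp pP; rewrite /kap big_seq_cond [RHS]big_seq_cond; apply: eq_bigl => q.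
case: (boolP (q \in P)) => //= qP; apply: prime_dvd_pmul => //; first exact: Pp.
by apply: contraNneq pP => <-.
Qed.

Lemma wt_pmul (R : realType) t P p k l m n : prime p -> all prime P -> p \notin P ->
  (0 < m)%N -> (0 < n)%N -> wt R t P (p ^ k * m)%N (p ^ l * n)%N = wt R t P m n.
Proof.
move=> pp /allP Pp pP m0 n0; rewrite /wt big_seq_cond [RHS]big_seq_cond; apply: eq_bigl => q.
case: (boolP (q \in P)) => //= qP; have qp : q != p by apply: contraNneq pP => <-.
by rewrite !logn_pmul// Pp.
Qed.

Lemma kap_cons (R : realType) P p v :
  kap R (p :: P) v = (if (p %| v)%N then 1 - p%:R^-1 else 1) * kap R P v.
Proof. by rewrite /kap big_cons; case: ifP => //; rewrite mul1r. Qed.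

Lemma wt_cons (R : realType) t P p v w : wt R t (p :: P) v w =
  (if (t < p)%N && (logn p v != logn p w) then 1 + t%:R / p%:R else 1) * wt R t P v w.
Proof. by rewrite /wt big_cons; case: ifP => //; rewrite mul1r. Qed.

Lemma mass_ge0 (R : realType) P (T : finType) (a : T -> nat) (f : T -> R) :
  all prime P -> (forall v, 0 <= f v) -> 0 <= mass P a f.
Proof. by move=> Pp f0; apply: sumr_ge0 => v _; rewrite mulr_ge0// kap_ge0. Qed.

(** With no prime allowed the gcds are 1 and [coprime_edges] applies. Multiplied by [e <= mu nu] it
    bounds [e^3] by [16 (tau mu nu)^2], and [16 <= 3^3]. *)
Lemma energy_nil (R : realType) t : @energy_bound R t [::] 3.
Proof.
move=> tau T1 T2 a b f g E tau0 [[f0 g0] [a0 b0] [fa gb] HE].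
have k1 v : kap R [::] v = 1 by rewrite /kap big_nil.
have w1 v w : wt R t [::] v w = 1 by rewrite /wt big_nil.
have mE (T : finType) (c : T -> nat) (h : T -> R) : mass [::] c h = \sum_v h v.
  by apply: eq_bigr => v _; rewrite k1 mulr1.
rewrite !mE.
have -> : energy t [::] a b f g E = \sum_v \sum_(w | E v w) f v * g w.
  by apply: eq_bigr => v _; apply: eq_bigr => w _; rewrite !k1 w1 !mulr1.
have HE' v w : E v w -> (b w)%:R * f v <= tau /\ (a v)%:R * g w <= tau.
  move=> Evw; have [h1 h2 h3] := HE v w Evw.
  suff g1 : gcdn (a v) (b w) = 1%N by rewrite g1 mulr1 in h1 h2.
  apply/eqP; rewrite eqn_leq gcdn_gt0 a0 /= andbT leqNgt; apply/negP => lt1.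
  by have := h3 _ (pdiv_prime lt1) (pdiv_dvd _).
have := coprime_edges (ltW tau0) f0 g0 a0 b0 fa gb HE'.
set e := \sum_v \sum_(w | E v w) _; set mn := (\sum_v f v) * (\sum_w g w) => e2.
have e0 : 0 <= e by apply: sumr_ge0 => v _; apply: sumr_ge0 => w _; rewrite mulr_ge0.
have mn0 : 0 <= mn by rewrite /mn; apply: mulr_ge0; apply: sumr_ge0.
have emn : e <= mn.
  rewrite /mn mulr_suml; apply: ler_sum => v _; rewrite mulr_sumr.
  by rewrite big_mkcond; apply: ler_sum => w _; case: ifP => // _; rewrite mulr_ge0.
apply: cube_le => //; first by rewrite mulr_ge0// exprn_ge0// cbrt_ge0.
rewrite exprMn -exprM mulnC exprM cbrtK; last by rewrite mulr_ge0// ltW.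
rewrite exprSr; apply: le_trans (ler_pM (exprn_ge0 2 e0) e0 e2 emn) _.
rewrite [leLHS](_ : _ = 16 * (tau * mn) ^+ 2); last by ring.
by apply: ler_wpM2r; [exact: sqr_ge0|clear; lra].
Qed.

Lemma energy_mul0 (R : realType) t P (T1 T2 : finType) (a : T1 -> nat) (b : T2 -> nat)
   (f : T1 -> R) (g : T2 -> R) (E : T1 -> T2 -> bool) :
  all prime P -> (forall v, 0 <= f v) -> (forall w, 0 <= g w) ->
  mass P a f * mass P b g = 0 -> energy t P a b f g E = 0.
Proof.
move=> Pp f0 g0 /eqP; rewrite mulf_eq0 => mz.
rewrite /energy big1// => v _; rewrite big1// => w _.
case/orP: mz => /eqP mz.
  suff -> : f v * kap R P (a v) = 0 by rewrite !mul0r.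
  by apply: (psumr_eq0P _ mz) => // i _; rewrite mulr_ge0// kap_ge0.
suff -> : g w * kap R P (b w) = 0 by rewrite mulr0 mul0r.
by apply: (psumr_eq0P _ mz) => // i _; rewrite mulr_ge0// kap_ge0.
Qed.

Lemma gcdn_pmul_le (p i j m n : nat) : prime p -> ~~ (p %| m)%N -> ~~ (p %| n)%N -> (0 < m)%N ->
  (gcdn (p ^ i * m) (p ^ j * n) <= p ^ minn i j * gcdn m n)%N.
Proof.
move=> pp pm pn m0.
have key k : gcdn m (p ^ k * n) = gcdn m n.
  by rewrite Gauss_gcdr// coprimeXr// coprime_sym prime_coprime.
have key2 k : (0 < n)%N -> gcdn (p ^ k * m) n = gcdn m n.
  by move=> n0; rewrite gcdnC Gauss_gcdr 1?gcdnC// coprimeXr// coprime_sym prime_coprime.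
have n0 : (0 < n)%N by case: n pn {key key2} => //; rewrite dvdn0.
case: (leqP i j) => ij.
  by rewrite -(subnKC ij) expnD -mulnA -muln_gcdr key.
by rewrite -(subnKC (ltnW ij)) expnD -mulnA -muln_gcdr key2.
Qed.

Definition kap1 (R : realType) (p n : nat) : R := if (p %| n)%N then 1 - p%:R^-1 else 1.

Lemma kap1_bounds (R : realType) p n : prime p -> 0 < kap1 R p n <= 1.
Proof.
move=> pp; rewrite /kap1; case: ifP => _; last by rewrite ltr01 lexx.
rewrite subr_gt0 invf_lt1 ?ltr0n ?prime_gt0// ltr1n prime_gt1//= gerBl invr_ge0 ler0n.
Qed.

(* Dividing the labels by [p ^ K1], [p ^ K2] removes [p] from the gcds; [cf], [cg] rescale [f], [g] accordingly. *)
Lemma energy_reduce (R : realType) t P p (C tau : R) (T1 T2 : finType)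
    (a : T1 -> nat) (b : T2 -> nat) (f : T1 -> R) (g : T2 -> R) (E E' : T1 -> T2 -> bool)
    (SA : pred T1) (SB : pred T2) (K1 K2 L : nat) (cf cg : R) :
  energy_bound t P C -> prime p -> all prime P -> p \notin P -> 0 < tau ->
  instance (p :: P) tau a b f g E -> 0 < cf -> 0 < cg ->
  (forall v, SA v -> (p ^ K1 %| a v)%N /\ kap1 R p (a v) * (p ^ L)%:R <= cf * (p ^ K2)%:R) ->
  (forall w, SB w -> (p ^ K2 %| b w)%N /\ kap1 R p (b w) * (p ^ L)%:R <= cg * (p ^ K1)%:R) ->
  (forall v w, E' v w -> [/\ SA v, SB w, E v w,
     (gcdn (a v) (b w) <= p ^ L * gcdn (a v %/ p ^ K1) (b w %/ p ^ K2))%N &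
     ~~ (p %| gcdn (a v %/ p ^ K1) (b w %/ p ^ K2))%N]) ->
  \sum_(v | SA v) \sum_(w | E' v w)
     (f v * kap R (p :: P) (a v)) * (g w * kap R (p :: P) (b w)) * wt R t P (a v) (b w)
  <= C * cbrt (cf * cg) *
     cbrt (tau * ((\sum_(v | SA v) f v * kap R (p :: P) (a v)) *
                  (\sum_(w | SB w) g w * kap R (p :: P) (b w)))) ^+ 2.
Proof.
move=> IH pp Pp pP tau0 [[f0 g0] [a0 b0] [fa gb] HE] cf0 cg0 HA HB HE'.
pose a' v := if SA v then (a v %/ p ^ K1)%N else 1%N.
pose b' w := if SB w then (b w %/ p ^ K2)%N else 1%N.
pose f' v := if SA v then f v * kap1 R p (a v) / cf else 0.
pose g' w := if SB w then g w * kap1 R p (b w) / cg else 0.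
have aE v : SA v -> a v = (p ^ K1 * a' v)%N.
  by move=> Sv; rewrite /a' Sv mulnC divnK//; case: (HA v Sv).
have bE w : SB w -> b w = (p ^ K2 * b' w)%N.
  by move=> Sw; rewrite /b' Sw mulnC divnK//; case: (HB w Sw).
have k0 n : 0 < kap1 R p n by have /andP[] := kap1_bounds R n pp.
have a'0 v : (0 < a' v)%N.
  rewrite /a'; case: ifP => // Sv; rewrite divn_gt0 ?expn_gt0 ?prime_gt0//.
  by apply: dvdn_leq => //; case: (HA v Sv).
have b'0 v : (0 < b' v)%N.
  rewrite /b'; case: ifP => // Sv; rewrite divn_gt0 ?expn_gt0 ?prime_gt0//.
  by apply: dvdn_leq => //; case: (HB v Sv).
have f'0 v : 0 <= f' v.
  by rewrite /f'; case: ifP => // _; rewrite divr_ge0 ?mulr_ge0// ltW.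
have g'0 v : 0 <= g' v.
  by rewrite /g'; case: ifP => // _; rewrite divr_ge0 ?mulr_ge0// ltW.
have fk v : SA v -> f v * kap R (p :: P) (a v) = cf * (f' v * kap R P (a' v)).
  move=> Sv; rewrite kap_cons -/(kap1 R p (a v)) (_ : kap R P (a v) = kap R P (a' v)).
    by rewrite /f' Sv; field; rewrite gt_eqF.
  by rewrite aE// kap_pmul.
have gk w : SB w -> g w * kap R (p :: P) (b w) = cg * (g' w * kap R P (b' w)).
  move=> Sw; rewrite kap_cons -/(kap1 R p (b w)) (_ : kap R P (b w) = kap R P (b' w)).
    by rewrite /g' Sw; field; rewrite gt_eqF.
  by rewrite bE// kap_pmul.
have gE v w : E' v w -> [/\ SA v, SB w, E v w,
     (gcdn (a v) (b w) <= p ^ L * gcdn (a' v) (b' w))%N & ~~ (p %| gcdn (a' v) (b' w))%N].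
  by move=> /HE'[Sv Sw Evw h1 h2]; rewrite /a' /b' Sv Sw; split.
have inst : instance P tau a' b' f' g' E'.
  split=> //.
    split=> v v'; rewrite /f' /g'.
      case: ifP => [Sv|_]; last by rewrite eqxx.
      move=> fv; case: ifP => [Sv'|_]; last by rewrite eqxx.
      move=> fv' aa; apply: fa; last by rewrite aE// aa -aE.
        by apply: contraNneq fv => ->; rewrite !mul0r.
      by apply: contraNneq fv' => ->; rewrite !mul0r.
    case: ifP => [Sv|_]; last by rewrite eqxx.
    move=> fv; case: ifP => [Sv'|_]; last by rewrite eqxx.
    move=> fv' aa; apply: gb; last by rewrite bE// aa -bE.
      by apply: contraNneq fv => ->; rewrite !mul0r.
    by apply: contraNneq fv' => ->; rewrite !mul0r.
  move=> v w /gE[Sv Sw Evw gle pg]; have [h1 h2 h3] := HE v w Evw.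
  have pow0 m : 0 < (p ^ m)%:R :> R by rewrite ltr0n expn_gt0 prime_gt0.
  have gle' : tau * (gcdn (a v) (b w))%:R <= tau * ((p ^ L)%:R * (gcdn (a' v) (b' w))%:R).
    by rewrite -natrM ler_pM2l// ler_nat.
  split.
  - rewrite -(ler_pM2r (pow0 K2)) -(ler_pM2r cf0).
    rewrite [leLHS](_ : _ = (b w)%:R * f v * kap1 R p (a v)); last first.
      by rewrite /f' Sv (bE w Sw) natrM; field; rewrite gt_eqF.
    apply: (@le_trans _ _ (tau * ((p ^ L)%:R * (gcdn (a' v) (b' w))%:R) * kap1 R p (a v))).
      by apply: ler_wpM2r; [exact: ltW|exact: le_trans h1 gle'].
    rewrite [leLHS](_ : _ = (tau * (gcdn (a' v) (b' w))%:R) * (kap1 R p (a v) * (p ^ L)%:R)); last by ring.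
    rewrite -[leRHS]mulrA; apply: ler_wpM2l; first by rewrite mulr_ge0// ltW.
    by rewrite [leRHS]mulrC; case: (HA v Sv).
  - rewrite -(ler_pM2r (pow0 K1)) -(ler_pM2r cg0).
    rewrite [leLHS](_ : _ = (a v)%:R * g w * kap1 R p (b w)); last first.
      by rewrite /g' Sw (aE v Sv) natrM; field; rewrite gt_eqF.
    apply: (@le_trans _ _ (tau * ((p ^ L)%:R * (gcdn (a' v) (b' w))%:R) * kap1 R p (b w))).
      by apply: ler_wpM2r; [exact: ltW|exact: le_trans h2 gle'].
    rewrite [leLHS](_ : _ = (tau * (gcdn (a' v) (b' w))%:R) * (kap1 R p (b w) * (p ^ L)%:R)); last by ring.
    rewrite -[leRHS]mulrA; apply: ler_wpM2l; first by rewrite mulr_ge0// ltW.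
    by rewrite [leRHS]mulrC; case: (HB w Sw).
  - move=> q pq; rewrite dvdn_gcd => /andP[qa qb].
    have : q \in p :: P.
      by apply: h3 => //; rewrite dvdn_gcd aE// bE// !dvdn_mull.
    rewrite inE => /orP[/eqP qp|//].
    by move: pg; rewrite -qp dvdn_gcd qa qb.
have := IH _ _ _ _ _ _ _ _ tau0 inst.
set en := energy _ _ _ _ _ _ _ => Hen.
have -> : \sum_(v | SA v) \sum_(w | E' v w)
     (f v * kap R (p :: P) (a v)) * (g w * kap R (p :: P) (b w)) * wt R t P (a v) (b w) =
     cf * cg * en.
  rewrite /en /energy mulr_sumr big_mkcond; apply: eq_bigr => v _.
  rewrite mulr_sumr; case: ifP => Sv.
    apply: eq_bigr => w /gE[_ Sw _ _ _].
    rewrite (fk v Sv) (gk w Sw) (_ : wt R t P (a v) (b w) = wt R t P (a' v) (b' w)).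
      by ring.
    by rewrite aE// bE// wt_pmul.
  by rewrite big1// => w /gE[]; rewrite Sv.
have massA : \sum_(v | SA v) f v * kap R (p :: P) (a v) = cf * mass P a' f'.
  rewrite /mass mulr_sumr big_mkcond; apply: eq_bigr => v _; case: ifP => Sv; first exact: fk.
  by rewrite /f' Sv mul0r mulr0.
have massB : \sum_(v | SB v) g v * kap R (p :: P) (b v) = cg * mass P b' g'.
  rewrite /mass mulr_sumr big_mkcond; apply: eq_bigr => v _; case: ifP => Sv; first exact: gk.
  by rewrite /g' Sv mul0r mulr0.
rewrite massA massB; have mA := mass_ge0 a' Pp f'0; have mB := mass_ge0 b' Pp g'0.
have cfg : 0 < cf * cg by rewrite mulr_gt0.
rewrite [tau * _](_ : _ = (cf * cg) * (tau * (mass P a' f' * mass P b' g'))); last by ring.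
rewrite [cbrt (cf * cg * _)]cbrtM; [|exact: ltW|by apply: mulr_ge0; [exact: ltW|exact: mulr_ge0]]; rewrite exprMn.
set c := cf * cg in cfg *.
(* Passing to [f'] and [g'] divides the energy by [c] and the squared cube root by [c^(2/3)]; the
   factor [cbrt c] is what remains. *)
rewrite [leRHS](_ : _ = cbrt c ^+ 3 * (C * cbrt (tau * (mass P a' f' * mass P b' g')) ^+ 2)); last by ring.
rewrite cbrtK; last exact: ltW.
by apply: ler_wpM2l; [exact: ltW|exact: Hen].
Qed.

Lemma partition2 (R : realType) (T1 T2 : finType) n (l1 : T1 -> 'I_n) (l2 : T2 -> 'I_n)
   (E : T1 -> T2 -> bool) (Q : 'I_n -> 'I_n -> bool) (H : T1 -> T2 -> R) :
  \sum_v \sum_(w | E v w && Q (l1 v) (l2 w)) H v w =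
  \sum_i \sum_(j | Q i j) \sum_(v | l1 v == i) \sum_(w | E v w && (l2 w == j)) H v w.
Proof.
rewrite (partition_big l1 xpredT)//=; apply: eq_bigr => i _.
rewrite [RHS](exchange_big_dep (fun v => l1 v == i))//=; apply: eq_bigr => v /eqP lv.
rewrite (partition_big l2 (fun j => Q i j)) => [|w /andP[_]]; last by rewrite lv.
rewrite [RHS](eq_bigl (Q i)) => [|j]; last by rewrite lv eqxx andbT.
apply: eq_bigr => j Qij; apply: eq_bigl => w.
by case: eqVneq => [->|]; rewrite ?andbF// lv Qij !andbT.
Qed.

Definition rootp (R : realType) (p : nat) : R := (cbrt p%:R)^-1.
(* [1 + tilt t p] is the factor contributed by [p] to [wt]. *)
Definition tilt (R : realType) (t p : nat) : R := if (t < p)%N then t%:R / p%:R else 0.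

Lemma rootp3 (R : realType) p : rootp R p ^+ 3 = p%:R^-1.
Proof. by rewrite /rootp exprVn cbrtK. Qed.

Lemma rootp_ge0 (R : realType) p : 0 <= rootp R p.
Proof. by rewrite invr_ge0 cbrt_ge0. Qed.

Lemma tilt01 (R : realType) t p : 0 <= tilt R t p <= 1.
Proof.
rewrite /tilt; case: ifP => [tp|_]; last by rewrite lexx ler01.
have p0 : 0 < p%:R :> R by rewrite ltr0n; case: p tp.
by rewrite divr_ge0//= ler_pdivrMr// mul1r ler_nat ltnW.
Qed.

Lemma dvdn_logn p n : prime p -> (0 < n)%N -> (p %| n)%N = (0 < logn p n)%N.
Proof. by move=> pp n0; rewrite logn_gt0 mem_primes pp n0. Qed.

Lemma dvdn_divX p n k : prime p -> (0 < n)%N -> k = logn p n ->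
  [/\ (p ^ k %| n)%N, n = (p ^ k * (n %/ p ^ k))%N & ~~ (p %| n %/ p ^ k)%N].
Proof.
move=> pp n0 ->.
have d : (p ^ logn p n %| n)%N by rewrite pfactor_dvdn.
have nE : n = (p ^ logn p n * (n %/ p ^ logn p n))%N by rewrite mulnC divnK.
split=> //; rewrite dvdn_logn//; last by rewrite divn_gt0 ?expn_gt0 ?prime_gt0// dvdn_leq.
by rewrite logn_div// pfactorK// subnn.
Qed.

(** The vertices are sorted by the [p]-adic valuations of their labels into cells [eh i j]. Each
    cell is bounded alone by stripping [p ^ i] and [p ^ j] ([ehA]), and all cells with the same
    [minn i j] are bounded together by stripping that common power ([ehB]). After normalisation
    these are the hypotheses of [one_prime]. *)
Lemma energy_step (R : realType) : exists2 A : R, 0 <= A &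
  forall t P p C, energy_bound t P C -> 0 < C -> prime p -> all prime P -> p \notin P ->
  energy_bound t (p :: P) (C * (1 + A * (rootp R p ^+ 4 + tilt R t p * rootp R p ^+ 3))).
Proof.
have [A A0 one] := one_prime R; exists A => // t P p C IH C0 pp Pp pP.
move=> tau T1 T2 a b f g E tau0 inst.
have [[f0 g0] [a0 b0] [fa gb] HE] := inst.
have Ppp : all prime (p :: P) by rewrite /= pp.
set r := rootp R p; set th := tilt R t p.
set mu := mass (p :: P) a f; set nu := mass (p :: P) b g.
have mu0 : 0 <= mu by exact: mass_ge0.
have nu0 : 0 <= nu by exact: mass_ge0.
have r0 : 0 <= r by exact: rootp_ge0.
have /andP[th0 th1] := tilt01 R t p; rewrite -/th in th0 th1.
have K0 : 0 <= C * (1 + A * (r ^+ 4 + th * r ^+ 3)).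
  by rewrite mulr_ge0 ?ltW// ltr_wpDr// mulr_ge0// addr_ge0 ?mulr_ge0 ?exprn_ge0.
have [mn0|mn0] := eqVneq (mu * nu) 0.
  by rewrite energy_mul0// mulr_ge0// exprn_ge0// cbrt_ge0.
have mu1 : 0 < mu by rewrite lt_neqAle mu0 andbT eq_sym; apply: contraNneq mn0 => ->; rewrite mul0r.
have nu1 : 0 < nu by rewrite lt_neqAle nu0 andbT eq_sym; apply: contraNneq mn0 => ->; rewrite mulr0.
pose n := maxn (\max_v logn p (a v)) (\max_w logn p (b w)).
pose la v : 'I_n.+1 := inord (logn p (a v)); pose lb w : 'I_n.+1 := inord (logn p (b w)).
have laE v : la v = logn p (a v) :> nat.
  by rewrite inordK// ltnS leq_max (leq_bigmax v).
have lbE w : lb w = logn p (b w) :> nat.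
  by rewrite inordK// ltnS leq_max (leq_bigmax w) orbT.
pose F v := f v * kap R (p :: P) (a v); pose G w := g w * kap R (p :: P) (b w).
have F0 v : 0 <= F v by rewrite mulr_ge0// kap_ge0.
have G0 w : 0 <= G w by rewrite mulr_ge0// kap_ge0.
pose m i := \sum_(v | la v == i) F v; pose m' i := \sum_(w | lb w == i) G w.
have m0 i : 0 <= m i by apply: sumr_ge0.
have m'0 i : 0 <= m' i by apply: sumr_ge0.
pose x i := cbrt (m i / mu); pose y i := cbrt (m' i / nu).
have x3 i : x i ^+ 3 = m i / mu by rewrite cbrtK// divr_ge0.
have y3 i : y i ^+ 3 = m' i / nu by rewrite cbrtK// divr_ge0.
have sm (Q : pred 'I_n.+1) : \sum_(i | Q i) m i = \sum_(v | Q (la v)) F v.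
  rewrite [RHS](partition_big la Q)//; apply: eq_bigr => i Qi; apply: eq_bigl => v.
  by case: eqVneq => [->|]; rewrite ?andbF ?andbT.
have sm' (Q : pred 'I_n.+1) : \sum_(i | Q i) m' i = \sum_(v | Q (lb v)) G v.
  rewrite [RHS](partition_big lb Q)//; apply: eq_bigr => i Qi; apply: eq_bigl => v.
  by case: eqVneq => [->|]; rewrite ?andbF ?andbT.
have sx : \sum_i x i ^+ 3 = 1.
  by rewrite (eq_bigr _ (fun i _ => x3 i)) -mulr_suml sm divff// gt_eqF.
have sy : \sum_i y i ^+ 3 = 1.
  by rewrite (eq_bigr _ (fun i _ => y3 i)) -mulr_suml sm' divff// gt_eqF.
pose Z := C * cbrt (tau * (mu * nu)) ^+ 2.
have tmn : 0 < tau * (mu * nu) by rewrite !mulr_gt0.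
have Z0 : 0 < Z.
  rewrite mulr_gt0// exprn_gt0// lt_neqAle cbrt_ge0 andbT eq_sym.
  by apply/eqP => z; have := cbrtK (ltW tmn); rewrite z expr0n => /esym/eqP; rewrite gt_eqF.
have cbrt_mn (X Y : R) : 0 <= X -> 0 <= Y ->
    C * cbrt (tau * ((mu * X) * (nu * Y))) ^+ 2 = Z * (cbrt X ^+ 2 * cbrt Y ^+ 2).
  move=> X0 Y0; rewrite (_ : tau * _ = (tau * (mu * nu)) * (X * Y)); last by ring.
  rewrite cbrtM; [|exact: ltW|exact: mulr_ge0].
  by rewrite (cbrtM X0 Y0) /Z; ring.
pose eh (i j : 'I_n.+1) := \sum_(v | la v == i) \sum_(w | E v w && (lb w == j)) F v * G w * wt R t P (a v) (b w).
have eh0 i j : 0 <= eh i j.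
  by apply: sumr_ge0 => v _; apply: sumr_ge0 => w _; exact: mulr_ge0 (mulr_ge0 (F0 v) (G0 w)) (wt_ge0 _ _ _ _ _).
have p0 : 0 < p%:R :> R by rewrite ltr0n prime_gt0.
have pX k : 0 < (p ^ k)%:R :> R by rewrite ltr0n expn_gt0 prime_gt0.
have ehA i j : eh i j <= Z * (r ^+ ndist i j * (x i ^+ 2 * y j ^+ 2)).
  pose kp (i : nat) : R := if (0 < i)%N then 1 - p%:R^-1 else 1.
  have kpE q : (0 < q)%N -> kap1 R p q = kp (logn p q) by move=> q0; rewrite /kap1 /kp dvdn_logn.
  have kp01 q : 0 < kp q <= 1.
    by have := kap1_bounds R (p ^ q) pp; rewrite kpE ?expn_gt0 ?prime_gt0// pfactorK.
  (* The gcds in the cell carry [p ^ minn i j], so [cf * cg] is the inverse of [p ^ ndist i j] up to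
     the factors [kp], which are at most 1. Its cube root is at most [r ^+ ndist i j]. *)
  pose cf := kp i * (p ^ minn i j)%:R / (p ^ j)%:R; pose cg := kp j * (p ^ minn i j)%:R / (p ^ i)%:R.
  have cf0 : 0 < cf by rewrite divr_gt0// mulr_gt0//; case/andP: (kp01 i).
  have cg0 : 0 < cg by rewrite divr_gt0// mulr_gt0//; case/andP: (kp01 j).
  have := @energy_reduce R t P p C tau T1 T2 a b f g E (fun v w => [&& E v w, la v == i & lb w == j])
     (fun v => la v == i) (fun w => lb w == j) i j (minn i j) cf cg IH pp Pp pP tau0 inst cf0 cg0.
  move=> H; have {H} := H _ _ _.
  rewrite -/F -/G => H.
  apply: le_trans (_ : C * cbrt (cf * cg) * cbrt (tau * (m i * m' j)) ^+ 2 <= _).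
    rewrite /eh (eq_bigr (fun v => \sum_(w | [&& E v w, la v == i & lb w == j])
      F v * G w * wt R t P (a v) (b w))); last first.
      by move=> v ->; apply: eq_bigl.
    apply: H.
    - move=> v /eqP lv; have iE : i = logn p (a v) :> nat by rewrite -laE lv.
      have [d _ _] := dvdn_divX pp (a0 v) iE; split=> //.
      by rewrite kpE// -iE /cf divfK// gt_eqF.
    - move=> w /eqP lw; have jE : j = logn p (b w) :> nat by rewrite -lbE lw.
      have [d _ _] := dvdn_divX pp (b0 w) jE; split=> //.
      by rewrite kpE// -jE /cg divfK// gt_eqF.
    - move=> v w /and3P[Evw lv lw].
      have iE : i = logn p (a v) :> nat by rewrite -laE (eqP lv).
      have jE : j = logn p (b w) :> nat by rewrite -lbE (eqP lw).
      have [_ av pa] := dvdn_divX pp (a0 v) iE; have [_ bw pb] := dvdn_divX pp (b0 w) jE.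
      split=> //; last by rewrite dvdn_gcd negb_and pa.
      rewrite {1}av {1}bw; apply: gcdn_pmul_le => //.
      by have := a0 v; rewrite {1}av muln_gt0 => /andP[].
  have -> : m i = mu * (m i / mu) by rewrite mulrC divfK// gt_eqF.
  have -> : m' j = nu * (m' j / nu) by rewrite mulrC divfK// gt_eqF.
  rewrite mulrAC cbrt_mn ?divr_ge0// -/(x i) -/(y j) mulrC mulrCA.
  apply: ler_wpM2l; first exact: ltW.
  apply: ler_wpM2r; first by rewrite mulr_ge0// exprn_ge0// cbrt_ge0.
  have -> : r ^+ ndist i j = cbrt (p%:R^-1 ^+ ndist i j).
    apply/esym/cbrt_uniq; first exact: exprn_ge0.
    by rewrite -exprM mulnC exprM rootp3.
  apply: le_cbrt; first by apply: mulr_ge0; exact: ltW.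
  have -> : p%:R^-1 ^+ ndist i j = (p ^ minn i j)%:R / (p ^ j)%:R * ((p ^ minn i j)%:R / (p ^ i)%:R) :> R.
    rewrite !natrX exprVn; apply: (mulIf (x := p%:R ^+ ndist i j * p%:R ^+ j * p%:R ^+ i)).
      by rewrite !mulf_neq0// expf_neq0// gt_eqF.
    have pn m1 : p%:R ^+ m1 != 0 :> R by rewrite expf_neq0// gt_eqF.
    rewrite [LHS](_ : _ = p%:R ^+ j * p%:R ^+ i); last by field; exact: pn.
    rewrite [RHS](_ : _ = p%:R ^+ minn i j * p%:R ^+ minn i j * p%:R ^+ ndist i j); last first.
      by field; rewrite !pn.
    by rewrite -!exprD; congr (_ ^+ _); rewrite /ndist; clear; lia.
  set q1 := _ / _; set q2 := _ / (p ^ i)%:R.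
  rewrite [leLHS](_ : _ = (kp i * kp j) * (q1 * q2)); last by rewrite /cf /cg /q1 /q2; ring.
  have /andP[ki0 ki1] := kp01 i; have /andP[kj0 kj1] := kp01 j.
  apply: ler_piMl; first by rewrite mulr_ge0// divr_ge0.
  by apply: mulr_ile1 => //; exact: ltW.
pose lam := cbrt (1 - p%:R^-1 : R).
have kap0 : 0 <= 1 - p%:R^-1 :> R.
  by rewrite subr_ge0 invf_le1// ler1n prime_gt0.
have lam3 : lam ^+ 3 = 1 - r ^+ 3 by rewrite cbrtK// rootp3.
have ehB (k : 'I_n.+1) : \sum_(i < n.+1) \sum_(j < n.+1 | minn i j == k) eh i j <=
   Z * ((if k == 0%N :> nat then 1 else lam ^+ 2) *
        (cbrt (\sum_(i < n.+1 | (k <= i)%N) x i ^+ 3) ^+ 2 *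
         cbrt (\sum_(i < n.+1 | (k <= i)%N) y i ^+ 3) ^+ 2)).
  rewrite -(partition2 la lb E (fun i j : 'I_n.+1 => minn i j == k) (fun v w => F v * G w * wt R t P (a v) (b w))).
  (* For [k > 0] all labels concerned are divisible by [p]; this gains [1 - 1/p] on each side,
     whence the [lam ^+ 2]. *)
  pose ck : R := if k == 0%N :> nat then 1 else 1 - p%:R^-1.
  have ck0 : 0 < ck.
    rewrite /ck; case: ifP => // _; rewrite subr_gt0 invf_lt1//.
    by rewrite ltr1n prime_gt1.
  have ckE q : (k <= logn p q)%N -> (0 < q)%N -> kap1 R p q <= ck.
    move=> kq q0; rewrite /ck /kap1 dvdn_logn//; case: ifP => [_|/negbT k1].
      by case: ifP => // _; rewrite gerBl invr_ge0 ltW.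
    by case: ifP => //; move: k1 kq; clear; lia.
  have := @energy_reduce R t P p C tau T1 T2 a b f g E (fun v w => E v w && (minn (la v) (lb w) == k))
     (fun v => (k <= la v)%N) (fun w => (k <= lb w)%N) k k k ck ck IH pp Pp pP tau0 inst ck0 ck0.
  move=> H; have {H} := H _ _ _.
  rewrite -/F -/G => H.
  apply: le_trans (_ : C * cbrt (ck * ck) * cbrt (tau * ((\sum_(v | (k <= la v)%N) F v) *
      (\sum_(v | (k <= lb v)%N) G v))) ^+ 2 <= _).
    rewrite (bigID (fun v => (k <= la v)%N)) /= [X in _ + X]big1 => [|v kv]; last first.
      rewrite big1// => w /andP[_ /eqP mk]; move: kv; rewrite -mk; clear; lia.
    rewrite addr0; apply: H.
    - move=> v kv; rewrite laE in kv; split; first by rewrite pfactor_dvdn.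
      by apply: ler_wpM2r; [exact: ltW|exact: ckE].
    - move=> v kv; rewrite lbE in kv; split; first by rewrite pfactor_dvdn.
      by apply: ler_wpM2r; [exact: ltW|exact: ckE].
    - move=> v w /andP[Evw /eqP mk].
      have kv : (k <= la v)%N by rewrite -mk geq_minl.
      have kw : (k <= lb w)%N by rewrite -mk geq_minr.
      have dv : (p ^ k %| a v)%N by rewrite pfactor_dvdn// -laE.
      have dw : (p ^ k %| b w)%N by rewrite pfactor_dvdn// -lbE.
      split=> //; first by rewrite muln_gcdr ![(p ^ k * _)%N]mulnC !divnK.
      rewrite dvdn_gcd negb_and.
      have : (la v == k) || (lb w == k) by rewrite -!(inj_eq val_inj) /= -mk; clear; lia.
      case/orP => /eqP lk; apply/orP; [left|right].
        by have [] := dvdn_divX pp (a0 v) (etrans (congr1 val (esym lk)) (laE v)).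
      by have [] := dvdn_divX pp (b0 w) (etrans (congr1 val (esym lk)) (lbE w)).
  rewrite -(sm (fun i : 'I_n.+1 => k <= i)%N) -(sm' (fun i : 'I_n.+1 => k <= i)%N).
  have -> : \sum_(i < n.+1 | (k <= i)%N) m i = mu * \sum_(i < n.+1 | (k <= i)%N) x i ^+ 3.
    rewrite mulr_sumr; apply: eq_bigr => i _; rewrite x3 mulrC divfK// gt_eqF//.
  have -> : \sum_(i < n.+1 | (k <= i)%N) m' i = nu * \sum_(i < n.+1 | (k <= i)%N) y i ^+ 3.
    rewrite mulr_sumr; apply: eq_bigr => i _; rewrite y3 mulrC divfK// gt_eqF//.
  rewrite mulrAC cbrt_mn; last 2 first.
  - by apply: sumr_ge0 => i _; rewrite x3 divr_ge0.
  - by apply: sumr_ge0 => i _; rewrite y3 divr_ge0.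
  rewrite le_eqVlt; apply/orP; left; apply/eqP.
  have -> : cbrt (ck * ck) = if k == 0%N :> nat then 1 else lam ^+ 2.
    rewrite /ck; case: ifP => _; first by apply: cbrt_uniq; rewrite ?mulr1 ?expr1n.
    by rewrite cbrtM// expr2.
  by rewrite mulrAC mulrA.
pose e i j := eh i j / Z.
have eE i j : eh i j = Z * e i j by rewrite mulrC divfK// gt_eqF.
(* The worst case is [p = 2], where [2^(-1/3) < 4/5]. *)
have r45 : 0 <= r <= 4 / 5.
  have cp0 : 0 < cbrt p%:R :> R by exact: powR_gt0.
  have c45 : 0 < 4 / 5 :> R by clear; lra.
  rewrite r0 /= /r /rootp invf_ple//.
  apply: cube_le; [by rewrite invr_ge0 ltW|exact: cbrt_ge0|rewrite cbrtK ?ler0n//].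
  apply: (@le_trans _ _ 2); first by clear; lra.
  by rewrite ler_nat prime_gt1.
have bnd : \sum_i e i i + (1 + th) * \sum_i \sum_(j | j != i) e i j <=
    1 + A * (r ^+ 4 + th * r ^+ 3).
  apply: (one n.+1 r th lam x y e) => //.
  - by rewrite th0.
  - exact: cbrt_ge0.
  - by move=> i; exact: cbrt_ge0.
  - by move=> i; exact: cbrt_ge0.
  - move=> i j; rewrite divr_ge0 ?eh0 ?(ltW Z0)//= ler_pdivrMr// [leRHS]mulrC.
    exact: ehA.
  - move=> k; rewrite -(ler_pM2l Z0) mulr_sumr.
    under eq_bigr do rewrite mulr_sumr.
    under eq_bigr do under eq_bigr do rewrite -eE.
    exact: ehB.
have -> : energy t (p :: P) a b f g E =
    Z * (\sum_i e i i + (1 + th) * \sum_i \sum_(j | j != i) e i j).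
  rewrite mulrDr mulrCA 2!mulr_sumr.
  under eq_bigr do rewrite -eE.
  under [X in _ = _ + _ * X]eq_bigr do rewrite mulr_sumr.
  under [X in _ = _ + _ * X]eq_bigr do under eq_bigr do rewrite -eE.
  pose H v w := F v * G w * wt R t P (a v) (b w).
  have -> : \sum_i eh i i = \sum_v \sum_(w | E v w && (lb w == la v)) H v w.
    rewrite (partition2 la lb E (fun i j => j == i)); apply: eq_bigr => i _.
    by rewrite big_pred1_eq.
  have -> : \sum_i \sum_(j | j != i) eh i j = \sum_v \sum_(w | E v w && (lb w != la v)) H v w.
    by rewrite (partition2 la lb E (fun i j => j != i)).
  rewrite mulr_sumr -big_split; apply: eq_bigr => v _ /=.
  rewrite (bigID (fun w => lb w == la v)) /= mulr_sumr; congr (_ + _); apply: eq_bigr => w /andP[_ lvw].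
    rewrite wt_cons -laE -lbE (inj_eq val_inj) eq_sym lvw andbF mul1r //.
  rewrite wt_cons -laE -lbE (inj_eq val_inj) eq_sym lvw andbT /th /tilt /H /F /G.
  by case: ifP => _; ring.
by rewrite [leRHS]mulrAC -/Z; apply: ler_wpM2l; [exact: ltW|exact: bnd].
Qed.

(** * Convergence of the product of the losses *)

Lemma telescope_le (R : realType) (z h : nat -> R) N :
  (forall n, 0 <= h n) -> (forall n, (0 < n)%N -> z n.+1 <= h n - h n.+1) ->
  \sum_(2 <= n < N) z n <= h 1%N.
Proof.
move=> h0 zh; case: N => [|[|N]]; [by rewrite big_geq ?h0|by rewrite big_geq ?h0|].
suff H : \sum_(2 <= n < N.+2) z n <= h 1%N - h N.+1.
  by apply: le_trans H _; rewrite gerBl.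
elim: N => [|N IH]; first by rewrite big_geq// subrr.
rewrite big_nat_recr//=; have := zh N.+1 isT; clear -IH; lra.
Qed.

(** Telescoping against [3 n^(-1/3)]. With [a], [b] the inverse cube roots of [n] and [n + 1], the
    identity [a^3 - b^3 = a^3 b^3] replaces differentiation. *)
Lemma sum_rootp4 (R : realType) N : \sum_(2 <= n < N) rootp R n ^+ 4 <= 3.
Proof.
apply: le_trans (telescope_le (h := fun n => 3 * rootp R n) _ _ _) _.
- by move=> n; rewrite mulr_ge0// rootp_ge0.
- move=> n n0; set a := rootp R n; set b := rootp R n.+1.
  have a0 : 0 < a.
    by rewrite invr_gt0 powR_gt0// ltr0n.
  have b0 : 0 < b by rewrite invr_gt0 powR_gt0// ltr0n.
  have ba : b <= a.
    by rewrite lef_pV2 ?posrE ?powR_gt0 ?ltr0n// le_cbrt// ler_nat.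
  have E : a ^+ 3 - b ^+ 3 = a ^+ 3 * b ^+ 3.
    rewrite !rootp3 -[n.+1]addn1 natrD; field.
    by rewrite !gt_eqF ?ltr0n// ltr_wpDl ?ltr01.
  have F : a ^+ 3 * b ^+ 3 <= (a - b) * (3 * a ^+ 2).
    rewrite -E (_ : a ^+ 3 - b ^+ 3 = (a - b) * (a ^+ 2 + a * b + b ^+ 2)); last by ring.
    apply: ler_wpM2l; first by rewrite subr_ge0.
    have : a * b <= a ^+ 2 by rewrite expr2 ler_pM2l.
    have : b ^+ 2 <= a ^+ 2 by rewrite ler_pXn2r// nnegrE ltW.
    by clear; lra.
  have G : a * b ^+ 3 <= 3 * (a - b).
    rewrite -(ler_pM2l (exprn_gt0 2 a0)).
    rewrite [leLHS](_ : _ = a ^+ 3 * b ^+ 3); last by ring.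
    by apply: le_trans F _; rewrite le_eqVlt; apply/orP; left; apply/eqP; ring.
  rewrite -mulrBr; apply: le_trans G; rewrite exprS; apply: ler_wpM2r => //.
  by rewrite exprn_ge0// ltW.
by rewrite /rootp /cbrt powR1 invr1 mulr1.
Qed.

(** The sum of [t / n^2] over [n > t] telescopes against [t / n]. The bound is uniform in [t], as it
    must be, since [t] grows with the dyadic level. *)
Lemma sum_tilt (R : realType) t N : \sum_(2 <= n < N) tilt R t n * rootp R n ^+ 3 <= 1.
Proof.
pose h n : R := if (t < n)%N then t%:R / n%:R else 1.
have h0 n : 0 <= h n by rewrite /h; case: ifP => // _; rewrite divr_ge0.
apply: le_trans (telescope_le (h := h) _ h0 _) _.
  move=> n n0; rewrite /tilt /h rootp3 ltnS.
  have pn : 0 < n%:R :> R by rewrite ltr0n.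
  have pn1 : 0 < n.+1%:R :> R by rewrite ltr0n.
  have [tn|tn] := leqP t n; last by rewrite ltnNge (ltnW tn) /= mul0r subrr.
  have key : t%:R / n.+1%:R / n.+1%:R <= t%:R / n%:R - t%:R / n.+1%:R :> R.
    rewrite [leRHS](_ : _ = t%:R / n.+1%:R * n%:R^-1).
      by apply: ler_wpM2l; [rewrite divr_ge0|rewrite lef_pV2 ?posrE// ler_nat].
    by rewrite -natr1 in pn1 *; field; rewrite !gt_eqF.
  case: ifP => // nt; apply: le_trans key _.
  have -> : n = t by clear -tn nt; lia.
  by rewrite divff// gt_eqF// (_ : t = n)//; clear -tn nt; lia.
rewrite /h; case: ifP => // t1; have -> : t = 0%N by clear -t1; lia.
by rewrite mul0r ler01.
Qed.

Definition primes_below (N : nat) : seq nat := [seq p <- index_iota 2 N | prime p].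

Lemma energy_main (R : realType) : exists2 C : R, 0 < C &
  forall t N, energy_bound t (primes_below N) C.
Proof.
have [A A0 step] := energy_step R.
pose z t p : R := A * (rootp R p ^+ 4 + tilt R t p * rootp R p ^+ 3).
have z0 t p : 0 <= z t p.
  rewrite mulr_ge0// addr_ge0 ?exprn_ge0 ?rootp_ge0// mulr_ge0 ?exprn_ge0 ?rootp_ge0//.
  by case/andP: (tilt01 R t p).
have gen t P : all prime P -> uniq P ->
    energy_bound t P (3 * \prod_(p <- P) (1 + z t p)) /\ 0 < 3 * \prod_(p <- P) (1 + z t p).
  elim: P => [|p P IH].
    by rewrite big_nil mulr1 => _ _; split; [exact: energy_nil|exact: ltr0n].
  move=> /= /andP[pp Pp] /andP[pP uP]; have [IH1 IH2] := IH Pp uP.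
  have -> : 3 * \prod_(q <- p :: P) (1 + z t q) = 3 * \prod_(q <- P) (1 + z t q) * (1 + z t p).
    by rewrite big_cons [(1 + _) * _]mulrC mulrA.
  by split; [exact: step|rewrite mulr_gt0// ltr_wpDr].
(* The 3 is the constant of [energy_nil]; [4 = 3 + 1] adds the bounds of [sum_rootp4] and
   [sum_tilt], the primes being replaced by all integers from 2 on. *)
exists (3 * expR (A * 4)); first by rewrite mulr_gt0// expR_gt0.
move=> t N tau T1 T2 a b f g E tau0 inst.
have Pp : all prime (primes_below N) by apply/allP => p; rewrite mem_filter => /andP[].
have [+ _] := gen t (primes_below N) Pp (filter_uniq _ (iota_uniq _ _)).
move=> /(_ _ _ _ _ _ _ _ _ tau0 inst) /le_trans; apply.
apply: ler_wpM2r; first by rewrite exprn_ge0// cbrt_ge0.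
apply: ler_wpM2l; first exact: ler0n.
apply: (@le_trans _ _ (\prod_(p <- primes_below N) expR (z t p))).
  by apply: ler_prod => p _; rewrite addr_ge0//= expR_ge1Dx.
rewrite -expR_sum ler_expR big_filter.
apply: (@le_trans _ _ (\sum_(2 <= p < N) z t p)).
  by rewrite big_mkcond; apply: ler_sum => p _; case: ifP.
rewrite -mulr_sumr; apply: ler_wpM2l => //; rewrite big_split /=.
by have := sum_rootp4 R N; have := sum_tilt R t N; clear; lra.
Qed.

(** * Sums over residue classes *)

Lemma sum_periodic (R : nmodType) (f : nat -> R) M k :
  (forall h, f (h + M)%N = f h) ->
  \sum_(0 <= h < k * M) f h = (\sum_(0 <= h < M) f h) *+ k.
Proof.
move=> fM; have fk m h : f (h + m * M)%N = f h.
  by elim: m h => [|m IH] h; rewrite ?mul0n ?addn0// mulSn addnA IH fM.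
elim: k => [|k IH]; first by rewrite mul0n big_geq// mulr0n.
rewrite (big_cat_nat (n := k * M)) ?leq_mul2r ?leqnSn ?orbT//= IH mulrSr; congr (_ + _).
rewrite -{1}[(k * M)%N]add0n big_addn mulSn addnK.
by apply: eq_bigr => h _; rewrite fk.
Qed.

Lemma sum_residues (R : nmodType) (p M x : nat) (F : nat -> R) :
  (0 < p)%N -> coprime p M -> (forall h, F (h %% p)%N = F h) ->
  \sum_(0 <= y < p) F (x + M * y)%N = \sum_(0 <= z < p) F z.
Proof.
case: p => // p _ cop Fp.
pose h (y : 'I_p.+1) : 'I_p.+1 := Ordinal (ltn_pmod (x + M * y) (ltn0Sn p)).
have key (y y' : 'I_p.+1) : (y <= y')%N -> h y = h y' -> y = y'.
  move=> yy /(congr1 val) /= /eqP; rewrite eqn_modDl eq_sym eqn_mod_dvd; last first.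
    by rewrite leq_mul2l yy orbT.
  rewrite -mulnBr Gauss_dvdr// => d; apply/val_inj => /=.
  have [|d0] := posnP (y' - y); first by move/eqP; rewrite subn_eq0 => H; apply/eqP; rewrite eqn_leq yy.
  have := dvdn_leq d0 d; have := ltn_ord y'; lia.
have hinj : injective h.
  move=> y y' hyy; case: (leqP y y') => [|/ltnW] yy; first exact: key.
  by apply/esym/key.
rewrite !big_mkord [RHS](reindex_inj hinj); apply: eq_bigr => y _ /=.
by rewrite Fp.
Qed.

Lemma coprime_prod_primes (p : nat) (ps : seq nat) : prime p -> all prime ps -> p \notin ps ->
  coprime p (\prod_(q <- ps) q).
Proof.
move=> pp; elim: ps => [|q ps IH]; first by rewrite big_nil coprimen1.
rewrite /= inE negb_or => /andP[pq /IH {}IH] /andP[npq /IH cop].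
by rewrite big_cons coprimeMr cop andbT prime_coprime// dvdn_prime2.
Qed.

(** * Counting close fractions *)

(** Chinese remainder theorem, one prime [p] at a time: with [M] the product of the other primes,
    [x + M * y] runs through all classes modulo [p] while its classes modulo the other primes stay
    fixed. *)
Lemma crt_avg (R : realType) (ps : seq nat) (F : nat -> nat -> R) (L : nat) :
  all prime ps -> uniq ps -> (forall p h, p \in ps -> F p (h %% p)%N = F p h) ->
  (\prod_(p <- ps) p %| L)%N ->
  \sum_(0 <= h < L) \prod_(p <- ps) F p h =
  L%:R * \prod_(p <- ps) (p%:R^-1 * \sum_(0 <= x < p) F p x).
Proof.
move=> allp ups Fp; pose M := (\prod_(p <- ps) p)%N.
have per qs : {subset qs <= ps} -> forall h, \prod_(p <- qs) F p (h + \prod_(p <- qs) p)%N = \prod_(p <- qs) F p h.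
  move=> sub h; apply: eq_big_seq => p pqs; rewrite -[LHS]Fp ?sub// -[RHS]Fp ?sub//.
  congr (F p _); apply/eqP; rewrite -[X in _ == X %[mod _]]addn0 eqn_modDl mod0n.
  by rewrite (big_rem p pqs) /= modnMr.
have base : \sum_(0 <= h < M) \prod_(p <- ps) F p h = \prod_(p <- ps) \sum_(0 <= x < p) F p x.
  rewrite /M {M}; elim: ps allp ups Fp per => [|p ps IH] /=.
    by rewrite !big_nil big_nat1 big_nil.
  move=> /andP[pp allp] /andP[pps uniq_ps] Fp per.
  have {}IH : \sum_(0 <= h < \prod_(p <- ps) p) \prod_(p <- ps) F p h =
    \prod_(p <- ps) \sum_(0 <= x < p) F p x.
    apply: IH => // [q h qps|qs sub h]; first by apply: Fp; rewrite inE qps orbT.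
    by apply: per => q /sub qps; rewrite inE qps orbT.
  rewrite !big_cons; set M := (\prod_(q <- ps) q)%N in IH *.
  have perM h : \prod_(q <- ps) F q (h + M)%N = \prod_(q <- ps) F q h.
    by apply: per => q qps; rewrite inE qps orbT.
  have perMy h y : \prod_(q <- ps) F q (h + M * y)%N = \prod_(q <- ps) F q h.
    by elim: y => [|y IHy]; rewrite ?muln0 ?addn0// mulnS [(M + _)%N]addnC addnA perM.
  have M0 : (0 < M)%N.
    by rewrite /M big_seq_cond prodn_cond_gt0// => q /andP[/(allP allp) /prime_gt0].
  have split_sum (f : nat -> R) k : \sum_(0 <= h < k * M) f h =
      \sum_(0 <= y < k) \sum_(0 <= x < M) f (x + M * y)%N.
    elim: k => [|k IHk]; first by rewrite mul0n !big_geq.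
    rewrite (big_cat_nat (n := k * M)) ?leq_mul2r ?leqnSn ?orbT//= IHk big_nat_recr//=; congr (_ + _).
    rewrite -{1}[(k * M)%N]add0n big_addn mulSn addnK.
    by apply: eq_bigr => h _; rewrite [(M * k)%N]mulnC.
  rewrite split_sum exchange_big_nat /= -IH mulr_sumr; apply: eq_bigr => x _.
  transitivity (\sum_(0 <= y < p) F p (x + M * y)%N * \prod_(q <- ps) F q x).
    by apply: eq_bigr => y _; rewrite big_cons perMy.
  rewrite -mulr_suml (sum_residues x (prime_gt0 pp) (coprime_prod_primes pp allp pps))//.
  by move=> h; apply: Fp; rewrite inE eqxx.
move=> /dvdnP[k ->]; rewrite sum_periodic; last by move=> h; apply: per.
have M0 : M%:R != 0 :> R.
  rewrite pnatr_eq0 -lt0n /M big_seq_cond prodn_cond_gt0// => q /andP[qps _].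
  by rewrite prime_gt0// (allP allp).
have -> : \prod_(p <- ps) (p%:R^-1 * \sum_(0 <= x < p) F p x) =
    M%:R^-1 * \prod_(p <- ps) \sum_(0 <= x < p) F p x.
  by rewrite big_split /= prodfV natr_prod.
rewrite base -/M -mulr_natr natrM; field.
exact: M0.
Qed.

(** * Chebyshev's bound for the product of the primes up to [n] *)

Lemma prime_dvd_fact_leq p n : prime p -> (p %| n`!)%N -> (p <= n)%N.
Proof.
move=> pp; elim: n => [|n IH].
  by rewrite fact0 dvdn1 => /eqP p1; rewrite p1 in pp.
by rewrite factS Euclid_dvdM// => /orP[/dvdn_leq|/IH/leqW]//; apply.
Qed.

Lemma prod_primes_dvd (ps : seq nat) n : all prime ps -> uniq ps ->
  (forall p, p \in ps -> p %| n)%N -> (\prod_(p <- ps) p %| n)%N.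
Proof.
elim: ps => [|p ps IH] /=; first by rewrite big_nil dvd1n.
move=> /andP[pp allp] /andP[pps uniq_ps] H; rewrite big_cons Gauss_dvd.
  by rewrite H ?inE ?eqxx//= IH// => q qps; rewrite H// inE qps orbT.
exact: coprime_prod_primes.
Qed.

(** The coefficient occurs twice in the expansion of [(1 + 1)^(2m+1)]. *)
Lemma bin_odd_le m : ('C(m.*2.+1, m) <= 4 ^ m)%N.
Proof.
have : (2 * 'C(m.*2.+1, m) <= 2 ^ m.*2.+1)%N.
  rewrite -[2%N in X in (_ <= X)%N]/(1 + 1)%N expnDn.
  have e1 : 'C(m.*2.+1, m.+1) = 'C(m.*2.+1, m).
    by rewrite -bin_sub; [congr 'C(_, _)|]; lia.
  have lm : (m < m.*2.+2)%N by lia.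
  have lm1 : (m.+1 < m.*2.+2)%N by lia.
  rewrite (bigD1 (Ordinal lm)) //= (bigD1 (Ordinal lm1)) /=; last first.
    by rewrite -(inj_eq val_inj) /=; lia.
  rewrite !exp1n !muln1 e1 addnA mul2n -addnn; exact: leq_addr.
by rewrite expnS leq_pmul2l// -mul2n expnM.
Qed.

(** The classical argument of Erdos: for [n = 2m + 1], the primes from [m + 2] to [n] divide the
    binomial coefficient of [bin_odd_le]; an even [n > 2] adds no prime. *)
Lemma primorial_le n : (\prod_(p <- [seq p <- index_iota 2 n.+1 | prime p]) p <= 4 ^ n)%N.
Proof.
elim/ltn_ind: n => n IH; case: n IH => [|[|n]] IH; try by rewrite big_nil ?expn_gt0.
have [odd_n|even_n] := boolP (odd n); last first.
  have [->|n0] := eqVneq n 0%N; first by rewrite big_cons big_nil.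
  have npr : ~~ prime n.+2.
    apply/negP => pr; have [|] := even_prime pr; first lia.
    by rewrite /= negbK (negbTE even_n).
  rewrite /index_iota -[(n.+3 - 2)%N]addn1 -/(n.+1) iotaD filter_cat /= add2n (negbTE npr) cats0.
  rewrite (_ : iota 2 n = index_iota 2 n.+2); last by rewrite /index_iota subSS subn1.
  apply: leq_trans (IH n.+1 _) _; first lia.
  by rewrite leq_exp2l; lia.
have [m nE] : exists m, n.+2 = m.*2.+1 by exists n./2.+1; lia.
rewrite nE.
have -> : index_iota 2 m.*2.+2 = index_iota 2 m.+2 ++ index_iota m.+2 m.*2.+2.
  rewrite /index_iota (_ : (m.*2.+2 - 2 = m + m)%N); last by clear; lia.
  rewrite iotaD add2n; congr (iota _ _ ++ iota _ _); clear; lia.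
rewrite filter_cat big_cat /=.
have -> : (4 ^ m.*2.+1 = 4 ^ m.+1 * 4 ^ m)%N by rewrite -expnD; congr (_ ^ _)%N; lia.
apply: leq_mul; first by apply: IH; lia.
apply: leq_trans (bin_odd_le m); apply: dvdn_leq; first by rewrite bin_gt0; lia.
apply: prod_primes_dvd; first by apply/allP => p; rewrite mem_filter => /andP[].
  exact/filter_uniq/iota_uniq.
move=> p; rewrite mem_filter mem_index_iota => /and3P[pp mp pm].
have : (p %| 'C(m.*2.+1, m) * (m`! * (m.*2.+1 - m)`!))%N.
  rewrite bin_fact; last lia.
  by apply: dvdn_fact; rewrite prime_gt0//=.
rewrite !Euclid_dvdM// => /orP[//|/orP[]] d; have := prime_dvd_fact_leq pp d; clear -mp pm; lia.
Qed.

Lemma inv_prime_le (R : realType) p : prime p -> (1 - p%:R^-1)^-1 <= 1 + 2 / p%:R :> R.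
Proof.
move=> pp; have p2 : 2 <= p%:R :> R by rewrite ler_nat prime_gt1.
have p0 : 0 < p%:R :> R by rewrite ltr0n prime_gt0.
set u := p%:R^-1; have u0 : 0 < u by rewrite invr_gt0.
have u2 : u <= 2^-1 by rewrite lef_pV2 ?posrE.
rewrite -div1r ler_pdivrMr; last by clear -u2; lra.
have : 0 <= u * (1 - 2 * u) by rewrite mulr_ge0 ?(ltW u0)//; clear -u2; lra.
clear; lra.
Qed.

Lemma prodn_filter_le (P : seq nat) n (Q : pred nat) : all prime P -> uniq P -> (0 < n)%N ->
  (2 ^ size [seq p <- P | Q p && (p %| n)] <= n)%N.
Proof.
move=> Pp Pu n0; set S := seq.filter _ _.
have Sp : all prime S by apply/allP => p; rewrite mem_filter => /andP[_ /(allP Pp)].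
apply: leq_trans (_ : \prod_(p <- S) p <= n)%N.
  elim: S Sp => [|p S IH]; first by rewrite big_nil.
  by move=> /= /andP[pp /IH {}IH]; rewrite big_cons expnS leq_mul// prime_gt1.
apply: dvdn_leq => //; apply: prod_primes_dvd => //; first exact: filter_uniq.
by move=> p; rewrite mem_filter => /andP[/andP[]].
Qed.

(** At most [j + 1] primes divide [n], and each of those above [t] contributes at most [exp(2/t)];
    the exponents add up to at most [2 (j + 1) / t <= 8]. *)
Lemma prod_large_primes (R : realType) (P : seq nat) t j n : all prime P -> uniq P ->
  (0 < n <= 2 ^ j.+1)%N -> (0 < t)%N -> (j.+1 <= 4 * t)%N ->
  \prod_(p <- P | (t < p)%N && (p %| n)%N) (1 - p%:R^-1)^-1 <= expR 8 :> R.
Proof.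
move=> Pp Pu /andP[n0 nj] t0 jt.
have t0R : 0 < t%:R :> R by rewrite ltr0n.
rewrite -big_filter; set S := seq.filter _ _.
have sS : (size S <= j.+1)%N.
  by rewrite -(@leq_exp2l 2)//; apply: leq_trans nj; exact: prodn_filter_le.
apply: (@le_trans _ _ (\prod_(p <- S) expR (2 / t%:R))).
  rewrite big_seq [leRHS]big_seq; apply: ler_prod => p.
  rewrite mem_filter => /andP[/andP[tp _] /(allP Pp) pp].
  have p1 : (1 - p%:R^-1 : R) > 0 by rewrite subr_gt0 invf_lt1 ?ltr0n ?prime_gt0// ltr1n prime_gt1.
  rewrite invr_ge0 (ltW p1) /=; apply: le_trans (inv_prime_le R pp) _.
  apply: le_trans (expR_ge1Dx _); rewrite lerD2l; apply: ler_wpM2l => //.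
  by rewrite lef_pV2 ?posrE//; [rewrite ler_nat ltnW|rewrite ltr0n prime_gt0].
rewrite big_const_seq count_predT iter_mulr_1 -expRM_natr ler_expR.
have sR : (size S)%:R <= 4 * t%:R :> R.
  have : (size S)%:R <= (4 * t)%:R :> R by rewrite ler_nat; exact: leq_trans jt.
  by rewrite natrM.
rewrite mulrAC ler_pdivrMr//; clear -sR; lra.
Qed.

(* [p] runs through the primes where the valuations of the two denominators differ exactly when [dif p]; a difference [n] of numerators must be prime to those. *)
Definition sieve_weight (R : realType) (P : seq nat) (dif : pred nat) (n : nat) : R :=
  if all (fun p => dif p ==> ~~ (p %| n)%N) P then \prod_(p <- P | (p %| n)%N) (1 - p%:R^-1)^-1 else 0.

(** No combinatorial sieve is needed. Primes above [t] cost [exp 8] by [prod_large_primes]. Those up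
    to [t] have a product at most [4^t <= 2^(j+8)], so the sum can be extended to whole periods of
    total length at most [(2 + 256) 2^j] and computed by [crt_avg]. The factor [exp 1] bounds the
    product of the local averages [1 + 1/(p(p-1))]. *)
Lemma sieve_sum (R : realType) : exists2 C : R, 0 < C & forall (dif : pred nat) M t j N,
  (0 < t)%N -> (j.+1 <= 4 * t)%N -> (2 * t <= j + 8)%N -> (N <= 2 ^ j.+1)%N ->
  \sum_(1 <= n < N.+1) sieve_weight R (primes_below M) dif n <=
  C * 2 ^+ j * \prod_(p <- primes_below M | dif p && (p <= t)%N) (1 - p%:R^-1).
Proof.
exists (expR 8 * 258 * expR 1); first by rewrite !mulr_gt0 ?expR_gt0.
move=> dif M t j N t0 jt tj NJ.
set P := primes_below M.
have Pp : all prime P by apply/allP => p; rewrite mem_filter => /andP[].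
have Pu : uniq P by exact/filter_uniq/iota_uniq.
have k0 p : prime p -> 0 < 1 - p%:R^-1 :> R.
  by move=> pp; rewrite subr_gt0 invf_lt1 ?ltr0n ?prime_gt0// ltr1n prime_gt1.
pose Phi p n : R := if (p %| n)%N then (if dif p then 0 else (1 - p%:R^-1)^-1) else 1.
pose P1 := [seq p <- P | (p <= t)%N].
have P1p : all prime P1 by apply/allP => p; rewrite mem_filter => /andP[_ /(allP Pp)].
have P1u : uniq P1 by exact: filter_uniq.
have Phi0 p n : prime p -> 0 <= Phi p n.
  by move=> pp; rewrite /Phi; do 2 case: ifP => _ //; rewrite invr_ge0 ltW ?k0.
have PP0 n : 0 <= \prod_(p <- P1) Phi p n.
  by rewrite big_seq; apply: prodr_ge0 => p /(allP P1p) pp; exact: Phi0.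
have term n : (0 < n <= N)%N -> sieve_weight R P dif n <= expR 8 * \prod_(p <- P1) Phi p n.
  move=> /andP[n0 nN]; rewrite /sieve_weight; case: ifP => [/allP H|_]; last first.
    by rewrite mulr_ge0// expR_ge0.
  rewrite (bigID (fun p => t < p)%N) /=; apply: ler_pM.
  - by rewrite big_seq_cond; apply: prodr_ge0 => p /andP[/(allP Pp)/k0/ltW]; rewrite invr_ge0.
  - by rewrite big_seq_cond; apply: prodr_ge0 => p /andP[/(allP Pp)/k0/ltW]; rewrite invr_ge0.
  - rewrite (eq_bigl (fun p => (t < p)%N && (p %| n)%N)); last by move=> p; rewrite andbC.
    by apply: (@prod_large_primes _ _ _ j) => //; rewrite n0 (leq_trans nN).
  - rewrite /P1 big_filter big_mkcond [leRHS]big_mkcond /= le_eqVlt; apply/orP; left; apply/eqP.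
    apply: eq_big_seq => p pP; rewrite -leqNgt /Phi; case: (leqP p t) => _; rewrite ?andbF ?andbT//.
    case: ifP => // pn; case: ifP => // dp.
    by have := H p pP; rewrite dp pn.
pose Q := (\prod_(p <- P1) p)%N.
have Q0 : (0 < Q)%N by rewrite /Q big_seq_cond prodn_cond_gt0// => q /andP[/(allP P1p) /prime_gt0].
pose L := ((N %/ Q).+1 * Q)%N.
have NL : (N < L)%N by exact: ltn_ceil.
have LQ : (L <= N + Q)%N by rewrite /L mulSn addnC leq_add2r leq_trunc_div.
have Q4 : (Q <= 4 ^ t)%N.
  apply: leq_trans (primorial_le t); apply: dvdn_leq.
    by rewrite big_seq_cond prodn_cond_gt0// => q /andP[]; rewrite mem_filter => /andP[/prime_gt0].
  apply: prod_primes_dvd => // p; rewrite !mem_filter mem_index_iota => /andP[pt /andP[pp /andP[p2 _]]].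
  by rewrite (big_rem p) /= ?dvdn_mulr// mem_filter pp mem_index_iota p2.
have L258 : (L <= 258 * 2 ^ j)%N.
  apply: leq_trans LQ _.
  have : (4 ^ t <= 256 * 2 ^ j)%N.
    by rewrite -[256%N]/(2 ^ 8)%N -expnD -[4%N]/(2 ^ 2)%N -expnM leq_exp2l// addnC.
  by move: NJ Q4; rewrite expnS; clear; lia.
have s1 : \sum_(1 <= n < N.+1) sieve_weight R P dif n <= expR 8 * \sum_(0 <= n < L) \prod_(p <- P1) Phi p n.
  rewrite mulr_sumr big_nat; apply: (@le_trans _ _ (\sum_(1 <= i < N.+1) expR 8 * \prod_(p <- P1) Phi p i)).
    by rewrite [leRHS]big_nat; apply: ler_sum => n; rewrite ltnS; exact: term.
  rewrite [leRHS](big_cat_nat (n := N.+1))//= [X in _ <= X + _]big_ltn//= -addrA addrCA lerDl.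
  by rewrite addr_ge0 ?mulr_ge0 ?expR_ge0// sumr_ge0// => i _; rewrite mulr_ge0 ?expR_ge0.
apply: le_trans s1 _.
rewrite (@crt_avg _ P1 Phi L) => //; first last.
- exact: dvdn_mull.
- by move=> p h _; rewrite /Phi /dvdn modn_mod.
rewrite [leRHS](_ : _ = expR 8 * (258 * 2 ^+ j * (expR 1 * \prod_(p <- P | dif p && (p <= t)%N) (1 - p%:R^-1)))); last by ring.
apply: ler_wpM2l; first exact: expR_ge0.
(* If [dif p], the class 0 has weight 0 and the average is [1 - 1/p]; otherwise that class weighs
   [p/(p-1)] and the average is [1 + 1/(p(p-1))]. *)
have avg p : p \in P1 -> p%:R^-1 * \sum_(0 <= x < p) Phi p x <=
   expR ((p%:R * (p%:R - 1))^-1) * (if dif p then 1 - p%:R^-1 else 1).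
  move=> /(allP P1p) pp; have p0 := prime_gt0 pp.
  have pR : 0 < p%:R :> R by rewrite ltr0n.
  have pR1 : 0 < p%:R - 1 :> R by rewrite subr_gt0 ltr1n prime_gt1.
  rewrite big_ltn// [X in _ + X](_ : _ = p%:R - 1); last first.
    rewrite big_nat (eq_bigr (fun=> 1)) => [|x /andP[x0 xp]]; last by rewrite /Phi gtnNdvd.
    by rewrite -big_nat sumr_const_nat -[in LHS](prednK p0) subn1 /= -[in RHS](prednK p0) -natr1 addrK.
  have eg : 0 <= (p%:R * (p%:R - 1))^-1 :> R by rewrite invr_ge0 mulr_ge0// ltW.
  rewrite /Phi dvdn0; case: ifP => _.
    rewrite add0r mulrBr mulVf ?gt_eqF// mulr1; apply: ler_peMl; first by rewrite ltW// k0.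
    by rewrite -[leLHS]expR0 ler_expR.
  rewrite mulr1; apply: le_trans (expR_ge1Dx _); rewrite le_eqVlt; apply/orP; left; apply/eqP.
  field.
  by rewrite !gt_eqF.
apply: ler_pM; rewrite ?ler0n//.
- rewrite big_seq; apply: prodr_ge0 => p /(allP P1p) pp; rewrite mulr_ge0 ?invr_ge0// sumr_ge0// => x _.
  exact: Phi0.
- by rewrite -natrX -natrM ler_nat.
apply: (@le_trans _ _ (\prod_(p <- P1) (expR ((p%:R * (p%:R - 1))^-1) * (if dif p then 1 - p%:R^-1 else 1)))).
  rewrite big_seq [leRHS]big_seq; apply: ler_prod => p pP; rewrite avg// andbT.
  rewrite mulr_ge0 ?invr_ge0// sumr_ge0// => x _; apply: Phi0; exact: (allP P1p).
rewrite big_split /=; apply: ler_pM.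
- by apply: prodr_ge0 => p _; exact: expR_ge0.
- rewrite big_seq; apply: prodr_ge0 => p /(allP P1p) pp; case: ifP => // _; exact/ltW/k0.
- rewrite -expR_sum ler_expR /P1 big_filter.
  apply: (@le_trans _ _ (\sum_(2 <= p < M) (p%:R * (p%:R - 1))^-1)).
    rewrite /P big_filter_cond big_mkcond big_nat [leRHS]big_nat; apply: ler_sum => p /andP[p2 _].
    case: ifP => // _; rewrite invr_ge0 mulr_ge0// subr_ge0 ler1n; exact: leq_trans p2.
  apply: le_trans (telescope_le (h := fun n => n%:R^-1) _ _ _) _; rewrite ?invr1//.
  move=> n n0; rewrite le_eqVlt; apply/orP; left; apply/eqP.
  rewrite -natr1; field.
  by rewrite !gt_eqF ?ltr0n// ltr_wpDl.
- rewrite /P1 big_filter big_mkcond [leRHS]big_mkcond le_eqVlt; apply/orP; left; apply/eqP.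
  by apply: eq_bigr => p _; rewrite andbC; case: ifP => //=; case: ifP.
Qed.

(* The pairs of reduced fractions with [a / v - b / w = n / lcm(v,w)] for some [1 <= n <= N]. *)
Definition npos (v w N : nat) : nat :=
  (\sum_(1 <= n < N.+1) \sum_(1 <= a < v.+1 | coprime a v) \sum_(1 <= b < w.+1 | coprime b w)
     (a * (w %/ gcdn v w) == b * (v %/ gcdn v w) + n))%N.

Lemma sum_nat_mul_eq (R : realType) (lo hi c : nat) (x : R) :
  0 <= x -> \sum_(lo <= a < hi) (if a == c then x else 0) <= x.
Proof.
move=> x0; case: (boolP (c \in index_iota lo hi)) => cI.
  rewrite (bigD1_seq c) ?iota_uniq//= eqxx big1 ?addr0// => i; by case: ifP.
rewrite big_seq big1// => i iI; case: eqP => // ic; by rewrite -ic iI in cI.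
Qed.

Definition diflog (v w p : nat) : bool := logn p v != logn p w.

Lemma logn_gcd_parts p v w : prime p -> (0 < v)%N -> (0 < w)%N ->
  diflog v w p = (p %| v %/ gcdn v w)%N || (p %| w %/ gcdn v w)%N.
Proof.
move=> pp v0 w0; set g := gcdn v w.
have g0 : (0 < g)%N by rewrite gcdn_gt0 v0.
have vE : v = (g * (v %/ g))%N by rewrite mulnC divnK// dvdn_gcdl.
have wE : w = (g * (w %/ g))%N by rewrite mulnC divnK// dvdn_gcdr.
have v'0 : (0 < v %/ g)%N by move: v0; rewrite {1}vE muln_gt0 => /andP[].
have w'0 : (0 < w %/ g)%N by move: w0; rewrite {1}wE muln_gt0 => /andP[].
have cop : coprime (v %/ g) (w %/ g).
  rewrite /coprime; have : (g * gcdn (v %/ g) (w %/ g) == g * 1)%N.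
    by rewrite muln_gcdr -vE -wE muln1.
  by rewrite eqn_pmul2l.
rewrite /diflog {1}vE {1}wE !lognM// eqn_add2l !dvdn_logn//.
have : ~~ ((p %| v %/ g) && (p %| w %/ g))%N.
  by rewrite -dvdn_gcd (eqP cop) dvdn1; apply: contraL pp => /eqP ->.
rewrite !dvdn_logn//; lia.
Qed.

(* The solutions form one class: [a = a0 + h v'], [b = b0 + h w'] with [h] modulo the gcd, so the coprimality conditions are counted by the Chinese remainder theorem. *)
Lemma count_fixed (R : realType) (P : seq nat) (v w n : nat) :
  all prime P -> uniq P -> (0 < v)%N -> (0 < w)%N ->
  (\sum_(1 <= a < v.+1 | coprime a v) \sum_(1 <= b < w.+1 | coprime b w)
     (a * (w %/ gcdn v w) == b * (v %/ gcdn v w) + n) : nat)%:R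
  <= (gcdn v w)%:R *
     \prod_(p <- P | (p %| gcdn v w)%N) ((1 - p%:R^-1) * (if diflog v w p then 1 else 1 - p%:R^-1)) *
     sieve_weight R P (diflog v w) n.
Proof.
move=> Pp Pu v0 w0; set g := gcdn v w; set dif := diflog v w.
have g0 : (0 < g)%N by rewrite gcdn_gt0 v0.
have vE : v = (g * (v %/ g))%N by rewrite mulnC divnK// dvdn_gcdl.
have wE : w = (g * (w %/ g))%N by rewrite mulnC divnK// dvdn_gcdr.
set v' := (v %/ g)%N in vE *; set w' := (w %/ g)%N in wE *.
have v'0 : (0 < v')%N by move: v0; rewrite vE muln_gt0 => /andP[].
have w'0 : (0 < w')%N by move: w0; rewrite wE muln_gt0 => /andP[].
have cop : coprime v' w'.
  rewrite /coprime; have : (g * gcdn v' w' == g * 1)%N by rewrite muln_gcdr -vE -wE muln1.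
  by rewrite eqn_pmul2l.
have difE p : prime p -> dif p = (p %| v')%N || (p %| w')%N by move=> pp; exact: logn_gcd_parts.
have notboth p : prime p -> ~~ ((p %| v') && (p %| w'))%N.
  by move=> pp; rewrite -dvdn_gcd (eqP cop) dvdn1; apply: contraL pp => /eqP ->.
have k0 p : prime p -> 0 < 1 - p%:R^-1 :> R.
  by move=> pp; rewrite subr_gt0 invf_lt1 ?ltr0n ?prime_gt0// ltr1n prime_gt1.
have k1 p : 1 - p%:R^-1 <= 1 :> R by rewrite gerBl invr_ge0.
have sw0 : 0 <= sieve_weight R P dif n.
  rewrite /sieve_weight; case: ifP => // _; rewrite big_seq_cond; apply: prodr_ge0 => p.
  by move=> /andP[/(allP Pp)/k0/ltW + _]; rewrite invr_ge0.
have W0 : 0 <= \prod_(p <- P | (p %| g)%N) ((1 - p%:R^-1) * (if dif p then 1 else 1 - p%:R^-1)) :> R.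
  rewrite big_seq_cond; apply: prodr_ge0 => p /andP[/(allP Pp)/k0/ltW kp _].
  by rewrite mulr_ge0//; case: ifP.
pose valid a b := [&& (0 < a <= v)%N, coprime a v, (0 < b <= w)%N, coprime b w & (a * w' == b * v' + n)%N].
have cop_ndvd p a u : prime p -> coprime a u -> (p %| u)%N -> ~~ (p %| a)%N.
  move=> pp cau pu; apply/negP => pa; have : (p %| gcdn a u)%N by rewrite dvdn_gcd pa.
  by rewrite (eqP cau) dvdn1 => /eqP p1; rewrite p1 in pp.
pose va a := has (valid a) (iota 1 w).
have [/hasP[a1 a1I va1]|none] := boolP (has va (iota 1 v)); last first.
  rewrite [X in X%:R](_ : _ = 0%N); first by rewrite !mulr_ge0.
  rewrite big_nat_cond big1// => a /andP[aI ca]; rewrite big_nat_cond big1// => b /andP[bI cb].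
  case: eqP => // /eqP E; case/negP: none; apply/hasP; exists a; first by rewrite mem_iota add1n.
  apply/hasP; exists b; first by rewrite mem_iota add1n.
  by rewrite /valid ca cb E !andbT; clear -aI bI; lia.
have exa : exists a, va a by exists a1.
(* The solution with the smallest [a] is the origin, so that the others are [a0 + v' * h] with [h] a
   natural number. *)
case: (ex_minnP exa) => a0 /hasP[b0 _ val0] a0min.
have /and5P[/andP[a00 a0v] ca0 /andP[b00 b0w] cb0 /eqP eq0] := val0.
(* A prime dividing [v'] and [n] divides [a0 * w'], against coprimality; similarly for [w']. A
   solvable [n] therefore passes the test in [sieve_weight]. *)
have good_n : all (fun p => dif p ==> ~~ (p %| n)%N) P.
  apply/allP => p /(allP Pp) pp; apply/implyP; rewrite difE// => d; apply/negP => pn.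
  have pa0 : (p %| v')%N -> (p %| a0)%N = false.
    by move=> pv; apply/negbTE/(cop_ndvd p a0 v) => //; rewrite vE dvdn_mull.
  have pb0 : (p %| w')%N -> (p %| b0)%N = false.
    by move=> pv; apply/negbTE/(cop_ndvd p b0 w) => //; rewrite wE dvdn_mull.
  case/orP: d => d.
    have : (p %| a0 * w')%N by rewrite eq0 dvdn_add// dvdn_mull.
    by rewrite Euclid_dvdM// pa0//= => pw; have := notboth p pp; rewrite d pw.
  have : (p %| b0 * v' + n)%N by rewrite -eq0 dvdn_mull.
  rewrite dvdn_addl// Euclid_dvdM// pb0//= => pv; by have := notboth p pp; rewrite d pv.
pose ps := [seq p <- P | (p %| g)%N].
have psp : all prime ps by apply/allP => p; rewrite mem_filter => /andP[_ /(allP Pp)].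
pose F (p h : nat) : R := if ~~ (p %| a0 + v' * h)%N && ~~ (p %| b0 + w' * h)%N then 1 else 0.
have F0 p h : 0 <= F p h by rewrite /F; case: ifP.
have FF0 h : 0 <= \prod_(p <- ps) F p h by apply: prodr_ge0.
have step1 : (\sum_(1 <= a < v.+1 | coprime a v) \sum_(1 <= b < w.+1 | coprime b w)
     (a * w' == b * v' + n) : nat)%:R <= \sum_(0 <= h < g) \prod_(p <- ps) F p h.
  rewrite natr_sum.
  apply: (@le_trans _ _ (\sum_(1 <= a < v.+1) \sum_(0 <= h < g)
     if a == (a0 + v' * h)%N then \prod_(p <- ps) F p h else 0)); last first.
    rewrite exchange_big_nat /=; apply: ler_sum => h _; exact: sum_nat_mul_eq.
  rewrite big_mkcond big_nat [leRHS]big_nat; apply: ler_sum => a /andP[a1' av].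
  have rhs0 : 0 <= \sum_(0 <= h < g) (if a == (a0 + v' * h)%N then \prod_(p <- ps) F p h else 0).
    by apply: sumr_ge0 => h _; case: ifP.
  case: ifP => // ca.
  have [vaa|nva] := boolP (va a); last first.
    rewrite big_nat_cond big1// => b /andP[bI cb]; case: eqP => // /eqP E.
    case/negP: nva; apply/hasP; exists b; first by rewrite mem_iota add1n.
    by rewrite /valid ca cb E !andbT; clear -a1' av bI; lia.
  have /hasP[b _ /and5P[_ _ /andP[b1' bw] cb /eqP eqab]] := vaa.
  have aa0 := a0min a vaa.
  have bb0 : (b0 <= b)%N.
    by rewrite -(leq_pmul2r v'0) -(leq_add2r n) -eq0 -eqab leq_mul2r aa0 orbT.
  have diff : ((a - a0) * w' = (b - b0) * v')%N by rewrite !mulnBl eqab eq0 subnDr.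
  have /dvdnP[h hE] : (v' %| a - a0)%N.
    by rewrite -(Gauss_dvdl _ cop) diff dvdn_mull.
  have aE : a = (a0 + v' * h)%N by rewrite mulnC -hE subnKC.
  have bE : b = (b0 + w' * h)%N.
    rewrite -(subnKC bb0); congr (_ + _)%N; apply/eqP; rewrite -(eqn_pmul2r v'0) -diff hE.
    by rewrite mulnAC [(w' * h)%N]mulnC.
  have hg : (h < g)%N.
    by rewrite -(ltn_pmul2l v'0) [(v' * g)%N]mulnC -vE; move: av a00; rewrite aE; clear; lia.
  apply: (@le_trans _ _ 1).
    rewrite -[leRHS]/(1%:R) ler_nat.
    apply: leq_trans (_ : \sum_(1 <= b' < w.+1) (b' == b) <= 1)%N.
      rewrite [leqLHS]big_mkcond; apply: leq_sum => b' _; case: ifP => // _.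
      case: eqP => // E; suff -> : b' = b by rewrite eqxx.
      by apply/eqP; rewrite -(eqn_pmul2r v'0) -(eqn_add2r n) -E eqab.
    case: (boolP (b \in index_iota 1 w.+1)) => cI.
      rewrite (bigD1_seq b) ?iota_uniq//= eqxx big1 ?addn0// => i; by case: eqP.
    rewrite big_seq big1// => i iI; case: eqP => // ic; by rewrite -ic iI in cI.
  rewrite (bigD1_seq h) ?iota_uniq ?mem_index_iota//= aE eqxx.
  have -> : \prod_(p <- ps) F p h = 1.
    rewrite big_seq big1// => p; rewrite mem_filter => /andP[pg /(allP Pp) pp].
    rewrite /F -aE -bE (cop_ndvd p a v pp ca) ?(cop_ndvd p b w pp cb)//.
      by rewrite wE dvdn_mulr.
    by rewrite vE dvdn_mulr.
  by rewrite lerDl; apply: sumr_ge0 => i _; case: ifP.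
apply: (le_trans step1).
rewrite (@crt_avg _ ps F g) => //; first last.
- apply: prod_primes_dvd => //; first exact: filter_uniq.
  by move=> p; rewrite mem_filter => /andP[].
- move=> p h _; rewrite /F; congr (if ~~ _ && ~~ _ then _ else _).
    by rewrite /dvdn -modnDmr modnMmr modnDmr.
  by rewrite /dvdn -modnDmr modnMmr modnDmr.
- exact: filter_uniq.
have swE : sieve_weight R P dif n = \prod_(p <- P | (p %| n)%N) (1 - p%:R^-1)^-1.
  by rewrite /sieve_weight good_n.
rewrite swE -mulrA; apply: ler_wpM2l; first exact: ler0n.
have inv1 p : prime p -> 1 <= (1 - p%:R^-1)^-1 :> R.
  by move=> pp; rewrite invf_ge1 ?k0// k1.
apply: (@le_trans _ _ (\prod_(p <- ps) (((1 - p%:R^-1) * (if dif p then 1 else 1 - p%:R^-1)) *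
   (if (p %| n)%N then (1 - p%:R^-1)^-1 else 1)))); last first.
  rewrite big_split /=; apply: ler_pM.
  - rewrite big_seq; apply: prodr_ge0 => p /(allP psp)/k0/ltW kp; rewrite mulr_ge0//; by case: ifP.
  - rewrite big_seq; apply: prodr_ge0 => p /(allP psp)/k0/ltW kp; case: ifP => // _; by rewrite invr_ge0.
  - by rewrite big_filter.
  - rewrite /ps big_filter big_mkcond [leRHS]big_mkcond big_seq [leRHS]big_seq.
    apply: ler_prod => p /(allP Pp) pp; have i1 := inv1 p pp.
    have i0 : 0 <= (1 - p%:R^-1)^-1 :> R by rewrite invr_ge0 ltW ?k0.
    by case: (p %| g)%N; case: (p %| n)%N; rewrite ?i0 ?i1 ?lexx ?ler01.
rewrite big_seq [leRHS]big_seq; apply: ler_prod => p pps.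
have pp := allP psp p pps.
have pR : 0 < p%:R :> R by rewrite ltr0n prime_gt0.
rewrite mulr_ge0 ?invr_ge0 ?sumr_ge0//=.
have nd (x y : nat) : ~~ (p %| y)%N -> \sum_(0 <= h < p) (if (p %| x + y * h)%N then 0 else 1) = p%:R - 1 :> R.
  move=> py; rewrite (@sum_residues R p y x (fun z => if (p %| z)%N then 0 else 1)) ?prime_gt0 ?prime_coprime//.
    rewrite big_ltn ?prime_gt0// dvdn0 add0r big_nat (eq_bigr (fun=> 1)) => [|z /andP[z0 zp]].
      by rewrite -big_nat sumr_const_nat -[in RHS](prednK (prime_gt0 pp)) subn1 -natr1 addrK.
    by rewrite gtnNdvd.
  by move=> h; rewrite /dvdn modn_mod.
have single : p%:R^-1 * \sum_(0 <= x < p) F p x <= 1 - p%:R^-1.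
  rewrite mulrC ler_pdivrMr// mulrBl mul1r mulVf ?gt_eqF//.
  have := notboth p pp; rewrite negb_and => /orP[nv|nw].
    rewrite -(nd a0 v' nv); apply: ler_sum => h _; rewrite /F.
    by case: (p %| a0 + _)%N => //=; case: ifP.
  rewrite -(nd b0 w' nw); apply: ler_sum => h _; rewrite /F.
  by case: (p %| b0 + _)%N => //=; rewrite ?andbF//; case: ifP.
(* Local densities at a prime [p] dividing the gcd. If the valuations differ, it is enough to
   exclude one class. If they agree and [p] divides [n], the bound wanted, [(1 - 1/p)^2] times the
   sieve factor, is again [1 - 1/p]. In the remaining case two distinct classes are excluded, and
   [1 - 2/p <= (1 - 1/p)^2]. *)
have kp := k0 p pp; have kp1 := k1 p.
have [dp|dp] := boolP (dif p).
  rewrite mulr1; apply: (le_trans single); case: ifP => _; last by rewrite mulr1.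
  by rewrite ler_peMr ?inv1// ltW.
case: ifP => pn.
  by rewrite mulfK ?gt_eqF.
rewrite mulr1.
move: dp; rewrite difE// negb_or => /andP[nv nw].
have -> : \sum_(0 <= x < p) F p x = p%:R - 2.
  transitivity (\sum_(0 <= x < p) ((if (p %| a0 + v' * x)%N then 0 else 1) +
     (if (p %| b0 + w' * x)%N then 0 else 1) - 1) : R).
    apply: eq_bigr => h _; rewrite /F; case: ifP => [/andP[/negbTE -> /negbTE ->]|].
      by rewrite addrK.
    case: (boolP (p %| a0 + v' * h)%N) => [pa|_]; case: (boolP (p %| b0 + w' * h)%N) => [pb|_] //= _; rewrite ?add0r ?addr0 ?subrr//.
    (* The two excluded classes are distinct: a common [h] would make [p] divide [n], by the
       equation defining the pairs. *)
    exfalso; move/negP: pn; apply.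
    have : (p %| w' * (a0 + v' * h))%N by rewrite dvdn_mull.
    have -> : (w' * (a0 + v' * h) = v' * (b0 + w' * h) + n)%N.
      by rewrite mulnDr [(w' * a0)%N]mulnC eq0 mulnDr; clear; lia.
    by rewrite dvdn_addr// dvdn_mull.
  rewrite !big_split /= (nd a0 v' nv) (nd b0 w' nw) sumrN sumr_const_nat subn0.
  clear; lra.
set u := p%:R^-1; have -> : u * (p%:R - 2) = 1 - 2 * u.
  by rewrite mulrBr mulVf ?gt_eqF// [u * 2]mulrC.
have := sqr_ge0 u; clear; lra.
Qed.

Definition npairs (v w N : nat) : nat :=
  (\sum_(1 <= a < v.+1 | coprime a v) \sum_(1 <= b < w.+1 | coprime b w)
     (0 < ndist (a * (w %/ gcdn v w)) (b * (v %/ gcdn v w)) <= N))%N.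

Lemma diflogC v w p : diflog v w p = diflog w v p.
Proof. by rewrite /diflog eq_sym. Qed.

Lemma npairs_npos v w N : (npairs v w N <= npos v w N + npos w v N)%N.
Proof.
rewrite /npairs /npos [X in (_ <= _ + X)%N](_ : _ =
  \sum_(1 <= n < N.+1) \sum_(1 <= a < v.+1 | coprime a v) \sum_(1 <= b < w.+1 | coprime b w)
     (b * (v %/ gcdn v w) == a * (w %/ gcdn v w) + n))%N; last first.
  by apply: eq_bigr => n _; rewrite exchange_big /= gcdnC.
rewrite [X in (_ <= X + _)%N]exchange_big [X in (_ <= _ + X)%N]exchange_big /= -big_split /=.
apply: leq_sum => a _.
rewrite [X in (_ <= X + _)%N]exchange_big [X in (_ <= _ + X)%N]exchange_big /= -big_split /=.
apply: leq_sum => b _; set x := (a * _)%N; set y := (b * _)%N.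
have one (n : nat) (f : nat -> bool) : (0 < n <= N)%N -> f n -> (1 <= \sum_(1 <= i < N.+1) f i)%N.
  move=> nI fn; rewrite (bigD1_seq n) ?iota_uniq ?mem_index_iota//= fn; exact: leq_addr.
case: (boolP (0 < ndist x y <= N)%N) => //= /andP[d0 dN]; rewrite /ndist in d0 dN.
have [xy|yx] := leqP x y.
  rewrite addnC; apply: leq_trans (leq_addr _ _).
  by apply: (one (y - x)%N (fun n => y == x + n)%N); lia.
apply: leq_trans (leq_addr _ _).
by apply: (one (x - y)%N (fun n => x == y + n)%N); lia.
Qed.

(** A prime where the valuations differ gives one factor [1 - 1/p] too few in [count_fixed]. For
    [p <= t] the sieve restores it; for [p > t] it is made up by [1 <= (1 - 1/p)(1 + 2/p)]. *)
Lemma npos_le (R : realType) : exists2 C : R, 0 < C & forall v w M t j N,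
  (0 < v < M)%N -> (0 < w < M)%N ->
  (0 < t)%N -> (j.+1 <= 4 * t)%N -> (2 * t <= j + 8)%N -> (N <= 2 ^ j.+1)%N ->
  (npos v w N)%:R <= C * 2 ^+ j * (gcdn v w)%:R *
     ((kap R (primes_below M) v * kap R (primes_below M) w) *
      \prod_(p <- primes_below M | (t < p)%N && diflog v w p) (1 + 2 / p%:R)).
Proof.
have [C C0 HC] := sieve_sum R; exists C => // v w M t j N /andP[v0 vM] /andP[w0 wM] t0 jt tj NJ.
set P := primes_below M.
have Pp : all prime P by apply/allP => p; rewrite mem_filter => /andP[].
have Pu : uniq P by exact/filter_uniq/iota_uniq.
have k0 p : prime p -> 0 < 1 - p%:R^-1 :> R.
  by move=> pp; rewrite subr_gt0 invf_lt1 ?ltr0n ?prime_gt0// ltr1n prime_gt1.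
have k1 p : 1 - p%:R^-1 <= 1 :> R by rewrite gerBl invr_ge0.
set g := gcdn v w.
pose W : R := g%:R * \prod_(p <- P | (p %| g)%N) ((1 - p%:R^-1) * (if diflog v w p then 1 else 1 - p%:R^-1)).
have W0 : 0 <= W.
  rewrite mulr_ge0// big_seq_cond; apply: prodr_ge0 => p /andP[/(allP Pp)/k0/ltW kp _].
  by rewrite mulr_ge0//; case: ifP.
apply: (@le_trans _ _ (\sum_(1 <= n < N.+1) W * sieve_weight R P (diflog v w) n)).
  rewrite /npos natr_sum; apply: ler_sum => n _; exact: count_fixed.
rewrite -mulr_sumr.
apply: (le_trans (ler_wpM2l W0 (HC (diflog v w) M t j N t0 jt tj NJ))).
rewrite -/P /W.
rewrite [leLHS](_ : _ = C * 2 ^+ j * g%:R *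
  (\prod_(p <- P | (p %| g)%N) ((1 - p%:R^-1) * (if diflog v w p then 1 else 1 - p%:R^-1)) *
   \prod_(p <- P | diflog v w p && (p <= t)%N) (1 - p%:R^-1))); last by ring.
apply: ler_wpM2l; first by rewrite !mulr_ge0// ?exprn_ge0// ltW.
rewrite /kap (big_mkcond (fun p => (p %| g)%N)) (big_mkcond (fun p => diflog v w p && _)).
rewrite (big_mkcond (fun p => (p %| v)%N)) (big_mkcond (fun p => (p %| w)%N)).
rewrite (big_mkcond (fun p => (t < p)%N && _)) -!big_split /= big_seq [leRHS]big_seq.
apply: ler_prod => p /(allP Pp) pp.
have kp := k0 p pp; have kp1 := k1 p.
have big : 1 <= (1 - p%:R^-1) * (1 + 2 / p%:R) :> R.
  by rewrite mulrC -ler_pdivrMr// div1r; exact: inv_prime_le.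
have pg : (p %| g)%N = (p %| v)%N && (p %| w)%N by rewrite dvdn_gcd.
have dd : diflog v w p = false -> (p %| v)%N = (p %| w)%N.
  by move/eqP => E; rewrite !dvdn_logn// E.
have dd2 : diflog v w p -> (p %| v)%N || (p %| w)%N.
  by apply: contraTT; rewrite negb_or /diflog negbK !dvdn_logn// -!eqn0Ngt => /andP[/eqP -> /eqP ->].
rewrite pg; move: big kp kp1; set k := 1 - _; set bb := 1 + _ => big kp kp1.
have kk : k * bb >= 1 by [].
have b1 : 1 <= bb by rewrite lerDl divr_ge0.
have k0' := ltW kp.
have h1 : k <= k * k * bb by rewrite -mulrA ler_peMr.
have h2 : 0 <= k * k by rewrite mulr_ge0.
case: (boolP (diflog v w p)) dd dd2 => [d _ /(_ isT) d2|d /(_ erefl) -> _] /=.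
  by case: (leqP p t) => pt; case: (p %| v)%N d2 => //=; case: (p %| w)%N => //= _;
    apply/andP; split; clear -h1 h2 kk b1 k0' kp1; lra.
by rewrite andbF; case: (p %| w)%N => /=; apply/andP; split; clear -h1 h2 kk b1 k0' kp1; lra.
Qed.

Lemma npairs_le (R : realType) : exists2 C : R, 0 < C & forall v w M t j N,
  (0 < v < M)%N -> (0 < w < M)%N ->
  (0 < t)%N -> (j.+1 <= 4 * t)%N -> (2 * t <= j + 8)%N -> (N <= 2 ^ j.+1)%N ->
  (npairs v w N)%:R <= C * 2 ^+ j * (gcdn v w)%:R *
     ((kap R (primes_below M) v * kap R (primes_below M) w) *
      \prod_(p <- primes_below M | (t < p)%N && diflog v w p) (1 + 2 / p%:R)).
Proof.
have [C C0 HC] := npos_le R; exists (2 * C); first by rewrite mulr_gt0.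
move=> v w M t j N vM wM t0 jt tj NJ.
have := HC w v M t j N wM vM t0 jt tj NJ; have := HC v w M t j N vM wM t0 jt tj NJ.
rewrite (gcdnC w v) (mulrC (kap R _ w)) (eq_bigl (fun p => (t < p)%N && diflog v w p)) => [|p]; last by [].
rewrite [X in _ -> (_ <= _ * X) -> _](_ : _ = (kap R (primes_below M) v * kap R (primes_below M) w) *
      \prod_(p <- primes_below M | (t < p)%N && diflog v w p) (1 + 2 / p%:R)); last first.
  by congr (_ * _); apply: eq_bigl => p; rewrite diflogC.
move=> h1 h2; apply: (@le_trans _ _ ((npos v w N)%:R + (npos w v N)%:R)).
  by rewrite -natrD ler_nat npairs_npos.
by apply: le_trans (lerD h1 h2) _; rewrite le_eqVlt; apply/orP; left; apply/eqP; ring.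
Qed.

(** This is [lcm(v,w)] times the larger radius: for overlapping balls, the difference of the
    numerators over the denominator [lcm(v,w)] is at most [2 * Dlcm]. *)
Definition Dlcm (R : realType) (rho : nat -> R) (v w : nat) : R :=
  (v * w)%:R / (gcdn v w)%:R * Num.max (rho v) (rho w).

Definition nclose (R : realType) (rho : nat -> R) (v w : nat) : nat :=
  (\sum_(1 <= a < v.+1 | coprime a v) \sum_(1 <= b < w.+1 | coprime b w)
    ((a%:R / v%:R != b%:R / w%:R :> R) && (`|a%:R / v%:R - b%:R / w%:R| < rho v + rho w)%R))%N.

Lemma norm_natB (R : realDomainType) x y : `|x%:R - y%:R| = (ndist x y)%:R :> R.
Proof.
rewrite /ndist; have [xy|/ltnW yx] := leqP x y.
  by rewrite distrC -natrB// ger0_norm// (_ : x - y = 0)%N//; apply/eqP; rewrite subn_eq0.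
by rewrite -natrB// ger0_norm// (_ : y - x = 0)%N ?addn0//; apply/eqP; rewrite subn_eq0.
Qed.

Lemma nclose_npairs (R : realType) (rho : nat -> R) v w : (0 < v)%N -> (0 < w)%N ->
  (nclose rho v w <= npairs v w (Num.truncn (2 * Dlcm rho v w)))%N.
Proof.
move=> v0 w0; apply: leq_sum => a _; apply: leq_sum => b _.
set g := gcdn v w.
have g0 : (0 < g)%N by rewrite gcdn_gt0 v0.
have v'0 : (0 < v %/ g)%N by rewrite divn_gt0// dvdn_leq// dvdn_gcdl.
have w'0 : (0 < w %/ g)%N by rewrite divn_gt0// dvdn_leq// dvdn_gcdr.
have vE : v = (g * (v %/ g))%N by rewrite mulnC divnK// dvdn_gcdl.
have wE : w = (g * (w %/ g))%N by rewrite mulnC divnK// dvdn_gcdr.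
set v' := (v %/ g)%N in vE v'0 *; set w' := (w %/ g)%N in wE w'0 *.
have gR : 0 < g%:R :> R by rewrite ltr0n.
have vR : 0 < v'%:R :> R by rewrite ltr0n.
have wR : 0 < w'%:R :> R by rewrite ltr0n.
have dE : a%:R / v%:R - b%:R / w%:R = ((a * w')%:R - (b * v')%:R) / (g%:R * v'%:R * w'%:R) :> R.
  rewrite vE wE !natrM; field.
  by rewrite !gt_eqF.
case: (boolP (_ && _)) => //= /andP[ne lt].
rewrite lt0b; apply/andP; split.
  rewrite lt0n; apply: contraNneq ne => d0; rewrite -subr_eq0 dE.
  by rewrite -normr_eq0 normrM norm_natB d0 mul0r.
have M0 : 0 <= rho v + rho w by exact: le_trans (ltW lt).
have mx : rho v + rho w <= 2 * Num.max (rho v) (rho w).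
  by rewrite mulr_natl mulr2n lerD// le_max lexx ?orbT.
have D0 : 0 <= 2 * Dlcm rho v w.
  rewrite /Dlcm mulrCA mulr_ge0 ?divr_ge0//; exact: le_trans mx.
rewrite truncn_ge_nat// -norm_natB.
have -> : 2 * Dlcm rho v w = (g%:R * v'%:R * w'%:R) * (2 * Num.max (rho v) (rho w)).
  rewrite /Dlcm -/g natrM {1}vE {1}wE !natrM; field.
  by rewrite gt_eqF.
have dpos : 0 < g%:R * v'%:R * w'%:R :> R by rewrite !mulr_gt0.
rewrite [leRHS]mulrC -ler_pdivrMr//.
apply: le_trans mx; apply: ltW; move: lt; rewrite dE normrM [X in _ * X]ger0_norm// invr_ge0 ltW.
Qed.

Lemma bernoulli_upper (R : realFieldType) (x : R) k : 0 <= x -> 2 * k%:R * x <= 1 ->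
  (1 + x) ^+ k <= 1 + 2 * k%:R * x.
Proof.
move=> x0; elim: k => [|k IH] kx; first by rewrite expr0 mulr0 mul0r addr0.
have kR : 0 <= k%:R :> R by rewrite ler0n.
have kx' : 2 * k%:R * x <= 1.
  apply: le_trans kx; apply: ler_wpM2r => //; apply: ler_wpM2l => //.
  by rewrite ler_nat.
have := IH kx' => {}IH; rewrite exprSr.
apply: (@le_trans _ _ ((1 + 2 * k%:R * x) * (1 + x))).
  by apply: ler_wpM2r => //; rewrite addr_ge0.
have : 0 <= x * (1 - 2 * k%:R * x) by rewrite mulr_ge0// subr_ge0.
rewrite -[k.+1%:R]natr1; move: (k%:R : R) => c; clear; lra.
Qed.

(** * The overlap sum *)

Definition large_prime_factor (R : realType) (t : nat) (P : seq nat) (v w : nat) : R :=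
  \prod_(p <- P | (t < p)%N && diflog v w p) (1 + 2 / p%:R).

(** For [p > 4 u] the reverse Bernoulli inequality gives [(1 + 2/p)^u <= 1 + 4u/p], which is the
    factor of [wt] with parameter [4 u]. *)
Lemma large_prime_factor_wt (R : realType) u (P : seq nat) v w : (0 < u)%N ->
  large_prime_factor R (4 * u) P v w ^+ u <= wt R (4 * u) P v w.
Proof.
move=> u0; rewrite /large_prime_factor /wt -prodrXl; apply: ler_prod => p /andP[up _].
have p0 : 0 < p%:R :> R by rewrite ltr0n; apply: leq_ltn_trans up.
have x0 : 0 <= 2 / p%:R :> R by rewrite divr_ge0.
rewrite exprn_ge0 ?addr_ge0//=.
have E : 2 * u%:R * (2 / p%:R) = (4 * u)%:R / p%:R :> R by rewrite natrM; field; rewrite gt_eqF.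
rewrite -E; apply: bernoulli_upper => //.
by rewrite E ler_pdivrMr// mul1r ler_nat ltnW.
Qed.

(* Rankin's trick: the exponent [u] grows with the dyadic level and makes the contribution of the levels summable. *)
Lemma rankin_split (R : realFieldType) (X K W : R) u : 0 <= X -> 1 <= K -> (0 < u)%N -> X ^+ u <= W ->
  X <= K + K ^- u.-1 * W.
Proof.
move=> X0 K1; case: u => // u _ XW /=.
have K0 : 0 < K by exact: lt_le_trans K1.
have W0 : 0 <= W by apply: le_trans XW; exact: exprn_ge0.
have Ku : 0 < K ^- u by rewrite invr_gt0 exprn_gt0.
have [XK|KX] := lerP X K; first by apply: (le_trans XK); rewrite lerDl; exact: mulr_ge0 (ltW Ku) W0.
apply: (@le_trans _ _ (K ^- u * W)); last by rewrite lerDr ltW.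
rewrite mulrC ler_pdivlMr ?exprn_gt0//; apply: le_trans XW.
rewrite exprS; apply: ler_wpM2l => //.
by apply: lerXn2r; rewrite ?nnegrE ?(ltW K0)// ltW.
Qed.

Definition overlap_sum (R : realType) (rho : nat -> R) (Y : nat) : R :=
  \sum_(i < Y) \sum_(k < Y) 2 * Num.min (rho i.+1) (rho k.+1) * (nclose rho i.+1 k.+1)%:R.

(** By [block_mass_totient] this is the partial sum of [totient v * rho v]; it is written as an
    instance of [mass]. *)
Definition block_mass (R : realType) (rho : nat -> R) (Y : nat) : R :=
  \sum_(i < Y) i.+1%:R * rho i.+1 * kap R (primes_below Y.+1) i.+1.

Lemma min_max_mul (R : realDomainType) (x y : R) : Num.min x y * Num.max x y = x * y.
Proof. by rewrite minEle maxEle; case: leP => _; rewrite // mulrC. Qed.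

Lemma geom_cbrt (R : realType) J : \sum_(0 <= j < J) cbrt (2^-1 ^+ j : R) <= 5.
Proof.
set q : R := cbrt 2^-1.
have q0 : 0 <= q by exact: cbrt_ge0.
have q45 : q <= 4 / 5.
  apply: cube_le => //.
  by rewrite cbrtK ?invr_ge0//; clear; lra.
have E j : cbrt (2^-1 ^+ j : R) = q ^+ j.
  by apply: cbrt_uniq; rewrite ?exprn_ge0// -exprM mulnC exprM cbrtK.
under eq_bigr do rewrite E.
have q1 : 0 <= q < 1 by rewrite q0 (le_lt_trans q45)//; clear; lra.
case: J => [|J]; first by rewrite big_geq.
rewrite big_nat_recl// expr0; have := geom_le J q1.
have : q / (1 - q) <= 4 by rewrite ler_pdivrMr; clear -q45 ; lra.
clear; lra.
Qed.

(** Pairs are sorted by the dyadic level [j] of [2 * Dlcm]. Since minimum times maximum of the radii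
    is their product and [lcm * gcd = v w], a pair contributes at most [4 C mu_i mu_k] times its
    large prime factor. Rankin's trick splits that factor into a constant, giving the square of the
    mass, and [2^(-j)] times [wt]. The energy at level [j], with [tau = 2^j], is
    [O((2^j m^2)^(2/3))], so level [j] contributes [O(2^(-j/3) m^(4/3))]. *)
Lemma overlap_le (R : realType) : exists C1 C2 : R, [/\ 0 <= C1, 0 <= C2 & forall (rho : nat -> R) Y,
  (forall v, 0 <= rho v) ->
  overlap_sum rho Y <= C1 * block_mass rho Y ^+ 2 + C2 * cbrt (block_mass rho Y ^+ 2) ^+ 2].
Proof.
have [C C0 HC] := npairs_le R; have [C' C'0 HE] := energy_main R.
(* The Rankin exponent is [u = j %/ 16 + 1], so [K = 2^16] makes [K^(1-u)] of order [2^(-j)];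
   rounding in the division costs at most [2^15]. *)
have [K K1 [c15 c150 K16]] : exists2 K : R, 1 <= K & exists2 c : R, 0 <= c &
    forall j : nat, K ^- (j %/ 16) <= c * 2^-1 ^+ j.
  exists (2 ^+ 16); first by apply: exprn_ege1; rewrite ler1n.
  exists (2 ^+ 15); first by rewrite exprn_ge0.
  move=> j; rewrite -exprM -exprVn.
  have jE : (j <= 16 * (j %/ 16) + 15)%N by lia.
  rewrite -[leLHS](mulKf (x := 2 ^+ 15)) ?expf_neq0// mulrC -mulrA; apply: ler_wpM2l; first exact: exprn_ge0.
  rewrite -exprVn -exprD; apply: ler_wiXn2l => //; rewrite ?invf_le1 ?ler1n//.
exists (4 * C * K), (4 * C * c15 * C' * 5).
have K0 : 0 <= K by exact: le_trans K1.
split; first by rewrite !mulr_ge0// ltW.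
  by apply: mulr_ge0 => //; apply: mulr_ge0 (ltW C'0); apply: mulr_ge0 => //; apply: mulr_ge0 (ltW C0).
move=> rho Y rho0; set P := primes_below Y.+1; set m := block_mass rho Y.
have Pp : all prime P by apply/allP => p; rewrite mem_filter => /andP[].
pose f (i : 'I_Y) : R := i.+1%:R * rho i.+1.
have f0 i : 0 <= f i by rewrite mulr_ge0.
pose mu (i : 'I_Y) : R := f i * kap R P i.+1.
have mu0 i : 0 <= mu i by rewrite mulr_ge0// kap_ge0.
have mE : m = \sum_i mu i by [].
pose D i k : R := Dlcm rho (i : 'I_Y).+1 (k : 'I_Y).+1.
have D0 i k : 0 <= D i k.
  by rewrite /D /Dlcm mulr_ge0 ?divr_ge0// le_max rho0.
pose N i k := Num.truncn (2 * D i k).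
pose jj i k := trunc_log 2 (N i k).
pose J := (\max_i \max_k jj i k).+1.
have jJ i k : (jj i k < J)%N.
  by rewrite ltnS; apply: leq_trans (leq_bigmax i); exact: (leq_bigmax k).
(* This is [4 u], as [large_prime_factor_wt] requires; the divisor 16 keeps it in the window
   [j + 1 <= 4 t], [2 t <= j + 8] of the sieve. *)
pose t j := (4 * (j %/ 16).+1)%N.
have pair (i k : 'I_Y) : 2 * Num.min (rho i.+1) (rho k.+1) * (nclose rho i.+1 k.+1)%:R <=
    4 * C * K * (mu i * mu k) +
    (if (0 < N i k)%N then 4 * C * c15 * (2^-1 ^+ jj i k * (mu i * mu k * wt R (t (jj i k)) P i.+1 k.+1)) else 0).
  have min0 : 0 <= Num.min (rho i.+1) (rho k.+1) by rewrite le_min !rho0.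
  have first0 : 0 <= 4 * C * K * (mu i * mu k).
    by apply: mulr_ge0; [rewrite !mulr_ge0// ltW|exact: mulr_ge0].
  have nc := nclose_npairs rho (ltn0Sn i) (ltn0Sn k).
  rewrite -/(D i k) -/(N i k) in nc.
  case: (posnP (N i k)) => [N0|N0].
    rewrite N0 in nc; rewrite addr0 (_ : nclose _ _ _ = 0%N) ?mulr0//.
    apply/eqP; rewrite -leqn0; apply: leq_trans nc _.
    by rewrite /npairs big1// => a _; rewrite big1// => b _; case: ltnP => //=; case: leqP => //; lia.
  set j := jj i k.
  have /andP[jl ju] := trunc_log_bounds (ltnSn 1) N0; rewrite -/(jj i k) -/j in jl ju.
  have N2D : (N i k)%:R <= 2 * D i k by rewrite truncn_le mulr_ge0.
  have v1 : (0 < i.+1 < Y.+1)%N by rewrite !ltnS /=; exact: ltn_ord.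
  have w1 : (0 < k.+1 < Y.+1)%N by rewrite !ltnS /=; exact: ltn_ord.
  have t1 : (0 < t j)%N by rewrite /t muln_gt0.
  have t2 : (j.+1 <= 4 * t j)%N by rewrite /t; lia.
  have t3 : (2 * t j <= j + 8)%N by rewrite /t; lia.
  have := HC i.+1 k.+1 Y.+1 (t j) j (N i k) v1 w1 t1 t2 t3 (ltnW ju).
  rewrite -/P -/(large_prime_factor R (t j) P i.+1 k.+1) => hN.
  set X := large_prime_factor _ _ _ _ _ in hN.
  have X0 : 0 <= X by apply: prodr_ge0 => p _; rewrite addr_ge0// divr_ge0.
  have XK : X <= K + c15 * 2^-1 ^+ j * wt R (t j) P i.+1 k.+1.
    apply: le_trans (rankin_split X0 K1 (ltn0Sn (j %/ 16)) (large_prime_factor_wt R P i.+1 k.+1 (ltn0Sn (j %/ 16)))) _.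
    by rewrite lerD2l; apply: ler_wpM2r; [exact: wt_ge0|exact: K16].
  have j2D : 2 ^+ j <= 2 * D i k.
    by apply: le_trans N2D; rewrite -natrX ler_nat.
  have kk0 : 0 <= kap R P i.+1 * kap R P k.+1 by rewrite mulr_ge0// kap_ge0.
  have g0 : 0 < (gcdn i.+1 k.+1)%:R :> R by rewrite ltr0n gcdn_gt0.
  apply: (@le_trans _ _ (2 * Num.min (rho i.+1) (rho k.+1) *
    (C * (2 * D i k) * (gcdn i.+1 k.+1)%:R * (kap R P i.+1 * kap R P k.+1 * X)))).
    apply: ler_wpM2l; first by rewrite mulr_ge0.
    apply: (@le_trans _ _ (npairs i.+1 k.+1 (N i k))%:R); first by rewrite ler_nat.
    apply: (le_trans hN); apply: ler_wpM2r; first by rewrite mulr_ge0.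
    by apply: ler_wpM2r; [exact: ltW|apply: ler_wpM2l => //; exact: ltW].
  have -> : 2 * Num.min (rho i.+1) (rho k.+1) *
    (C * (2 * D i k) * (gcdn i.+1 k.+1)%:R * (kap R P i.+1 * kap R P k.+1 * X)) =
    4 * C * (mu i * mu k) * X.
    rewrite /mu /f /D /Dlcm natrM.
    rewrite (_ : i.+1%:R * rho i.+1 * kap R P i.+1 * (k.+1%:R * rho k.+1 * kap R P k.+1) =
      (i.+1%:R * k.+1%:R) * (rho i.+1 * rho k.+1) * (kap R P i.+1 * kap R P k.+1)); last by ring.
    rewrite -(min_max_mul (rho i.+1) (rho k.+1)).
    move: (Num.min _ _) (Num.max _ _) => mi ma; field.
    by rewrite gt_eqF.
  apply: (@le_trans _ _ (4 * C * (mu i * mu k) * (K + c15 * 2^-1 ^+ j * wt R (t j) P i.+1 k.+1))).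
    by apply: ler_wpM2l => //; apply: mulr_ge0; [rewrite mulr_ge0// ltW|exact: mulr_ge0].
  rewrite le_eqVlt; apply/orP; left; apply/eqP.
  by move: (2^-1 ^+ j : R) (wt _ _ _ _ _) => c2 c3; ring.
apply: (@le_trans _ _ (\sum_i \sum_k (4 * C * K * (mu i * mu k) +
    (if (0 < N i k)%N then 4 * C * c15 * (2^-1 ^+ jj i k * (mu i * mu k * wt R (t (jj i k)) P i.+1 k.+1)) else 0)))).
  by apply: ler_sum => i _; apply: ler_sum => k _; exact: pair.
rewrite (eq_bigr (fun i => \sum_k 4 * C * K * (mu i * mu k) + \sum_k
    (if (0 < N i k)%N then 4 * C * c15 * (2^-1 ^+ jj i k * (mu i * mu k * wt R (t (jj i k)) P i.+1 k.+1)) else 0))); last first.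
  by move=> i _; rewrite big_split.
rewrite big_split /=; apply: lerD.
  rewrite le_eqVlt; apply/orP; left; apply/eqP.
  under eq_bigr do rewrite -mulr_sumr -mulr_sumr.
  by rewrite -mulr_sumr -mulr_suml -mE expr2.
(* Positivity of [N] is part of the condition because [trunc_log] also returns 0 at 0; pairs with
   [N = 0] have no close fractions. *)
pose E j (i k : 'I_Y) := (0 < N i k)%N && (jj i k == j).
have level j : \sum_i \sum_(k | E j i k) mu i * mu k * wt R (t j) P i.+1 k.+1 <=
    C' * cbrt (2 ^+ j * m ^+ 2) ^+ 2.
  have inst : instance P (2 ^+ j) (fun i : 'I_Y => i.+1) (fun i : 'I_Y => i.+1) f f (E j).
    split=> //.
      by split=> i k _ _ [] /val_inj.
    move=> i k /andP[N0 /eqP jE].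
    have /andP[jl ju] := trunc_log_bounds (ltnSn 1) N0; rewrite -/(jj i k) jE in jl ju.
    have Dj : D i k <= 2 ^+ j.
      have : 2 * D i k < (N i k).+1%:R by exact: truncnS_gt.
      have : (N i k).+1%:R <= 2 ^+ j.+1 :> R by rewrite -natrX ler_nat.
      by rewrite exprS; clear; lra.
    have g0 : 0 < (gcdn i.+1 k.+1)%:R :> R by rewrite ltr0n gcdn_gt0.
    have vw0 : 0 <= i.+1%:R * k.+1%:R / (gcdn i.+1 k.+1)%:R :> R.
      by rewrite divr_ge0 ?mulr_ge0.
    split.
    - rewrite -ler_pdivrMr//; apply: le_trans Dj.
      rewrite /f (_ : _ / _ = i.+1%:R * k.+1%:R / (gcdn i.+1 k.+1)%:R * rho i.+1); last by ring.
      by rewrite /D /Dlcm natrM; apply: ler_wpM2l => //; rewrite le_max lexx.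
    - rewrite -ler_pdivrMr//; apply: le_trans Dj.
      rewrite /f (_ : _ / _ = i.+1%:R * k.+1%:R / (gcdn i.+1 k.+1)%:R * rho k.+1); last by ring.
      by rewrite /D /Dlcm natrM; apply: ler_wpM2l => //; rewrite le_max lexx orbT.
    - move=> p pp; rewrite dvdn_gcd => /andP[pi _]; rewrite mem_filter pp mem_index_iota prime_gt1//=.
      by rewrite ltnS; apply: leq_trans (ltn_ord i); exact: dvdn_leq.
  have := HE (t j) Y.+1 _ _ _ _ _ _ _ _ (exprn_gt0 j (ltr0n _ 2)) inst.
  by rewrite /mass -/m expr2.
have m0 : 0 <= m by rewrite mE sumr_ge0.
apply: (@le_trans _ _ (\sum_(j < J) 4 * C * c15 * (2^-1 ^+ j * (\sum_i \sum_(k | E j i k) mu i * mu k * wt R (t j) P i.+1 k.+1)))).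
  under [leRHS]eq_bigr do rewrite mulr_sumr mulr_sumr.
  rewrite [leRHS]exchange_big /=; apply: ler_sum => i _.
  under [leRHS]eq_bigr do rewrite mulr_sumr mulr_sumr big_mkcond.
  rewrite [leRHS]exchange_big /=; apply: ler_sum => k _.
  rewrite (bigD1 (Ordinal (jJ i k)))//= /E eqxx andbT big1 ?addr0// => j.
  rewrite -(inj_eq val_inj) /= eq_sym => /negbTE ->; by rewrite andbF.
rewrite -mulr_sumr -!mulrA; do 3 (apply: ler_wpM2l; first by rewrite ?c150// ltW).
rewrite mulrCA; apply: (@le_trans _ _ (\sum_(j < J) C' * (cbrt (m ^+ 2) ^+ 2 * cbrt (2^-1 ^+ j)))).
  apply: ler_sum => j _.
  apply: (@le_trans _ _ (2^-1 ^+ j * (C' * cbrt (2 ^+ j * m ^+ 2) ^+ 2))).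
    by apply: ler_wpM2l; [rewrite exprn_ge0|exact: level].
  rewrite mulrCA; apply: ler_wpM2l; first exact: ltW.
  rewrite cbrtM ?exprn_ge0// exprMn mulrA [leRHS]mulrC; apply: ler_wpM2r; first by rewrite exprn_ge0// cbrt_ge0.
  rewrite le_eqVlt; apply/orP; left; apply/eqP.
  have c2 : cbrt (2 ^+ j : R) != 0.
    by apply/eqP => z; have := cbrtK (exprn_ge0 j (ler0n R 2)); rewrite z expr0n => /esym/eqP; rewrite expf_eq0 pnatr_eq0 andbF.
  rewrite exprVn -{1}(cbrtK (exprn_ge0 j (ler0n R 2))).
  have -> : cbrt ((2 ^+ j)^-1 : R) = (cbrt (2 ^+ j))^-1.
    by apply: cbrt_uniq; rewrite ?invr_ge0 ?cbrt_ge0// exprVn cbrtK// exprn_ge0.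
  by field.
rewrite -mulr_sumr -mulr_sumr; apply: (@le_trans _ _ (C' * (cbrt (m ^+ 2) ^+ 2 * 5))).
  apply: ler_wpM2l; first exact: ltW.
  apply: ler_wpM2l; first by rewrite exprn_ge0// cbrt_ge0.
  by rewrite -(big_mkord xpredT (fun j => cbrt (2^-1 ^+ j : R))); exact: geom_cbrt.
by rewrite le_eqVlt; apply/orP; left; apply/eqP; ring.
Qed.

Import numFieldNormedType.Exports.
Local Open Scope classical_set_scope.

(** * Measure of unions of balls *)

Lemma measurable_affine (R : realType) (c d : R) :
  measurable_fun [set: R] (fun x : R => c * x + d).
Proof. by apply: measurable_funD => //; apply: measurable_funM. Qed.

Lemma affine_preimage (R : realType) (c d : R) (A : set R) : 0 < c -> measurable A ->
  lebesgue_measure ((fun x => c * x + d) @^-1` A) = (c^-1%:E * lebesgue_measure A)%E.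
Proof.
move=> c0 mA.
pose f : measurableTypeR R -> measurableTypeR R := fun x => c * x + d.
have E : lebesgue_measure A = mscale (NngNum (ltW c0)) (pushforward (@lebesgue_measure R) f) A.
  move=> mf; apply: lebesgue_measure_unique => //=.
  move=> _ [[a b]] _ <-; rewrite /mscale /= /pushforward.
  have -> : f @^-1` `]a, b]%classic = `](a - d) / c, (b - d) / c]%classic.
    apply/seteqP; split => x /=; rewrite !in_itv /= ltr_pdivrMr// ler_pdivlMr// ltrBlDr lerBrDr [x * c]mulrC //.
  rewrite !lebesgue_measure_itv /= !lte_fin ltr_pM2r ?invr_gt0// ltrD2r.
  case: ifP => _; last by rewrite mule0.
  by rewrite -EFinD -EFinM; congr (_%:E); field; rewrite gt_eqF.
move: (E (measurable_affine c d)); rewrite /mscale /= /pushforward => ->.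
by rewrite muleA -EFinM mulVf ?gt_eqF// mul1e.
Qed.

Lemma le_lebesgue (R : realType) (A B : set R) : measurable A -> measurable B -> A `<=` B ->
  (lebesgue_measure A <= lebesgue_measure B)%E.
Proof. by move=> mA mB AB; apply: le_measure; rewrite ?inE. Qed.

(* Rescaling by [q] shows that the density of [G] in every interval is at most its mean density [th]; covering [G] efficiently by intervals gives [th <= th * (th + e)]. *)
Lemma zero_one (R : realType) (G : set R) : measurable G ->
  (forall (x : R) (z : int), G x -> G (x + z%:~R)) ->
  (forall (x : R) (n : nat), (0 < n)%N -> G x -> G (n%:R * x)) ->
  (0 < lebesgue_measure (G `&` `]0%R, 1%R]))%E -> lebesgue_measure (G `&` `]0%R, 1%R]) = 1%E.
Proof.
move=> mG Gper Gmul; pose mu := @lebesgue_measure R.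
rewrite -/mu => pos.
have mI (a b : R) : measurable (G `&` `]a, b]) by apply: measurableI.
have le1 : (mu (G `&` `]0%R, 1%R]) <= 1%E)%E.
  apply: (@le_trans _ _ (mu `]0%R, 1%R]%classic)).
    by apply: le_lebesgue => //; exact: subIsetr.
  by rewrite /mu lebesgue_measure_itv /= lte_fin ltr01 oppr0 adde0.
pose th := fine (mu (G `&` `]0%R, 1%R])).
have thE : mu (G `&` `]0%R, 1%R]) = th%:E.
  by rewrite fineK// ge0_fin_numE ?measure_ge0// (le_lt_trans le1)// ltry.
have th0 : 0 < th by rewrite -lte_fin -thE.
have th1 : th <= 1 by rewrite -lee_fin -thE.
have shift (i : int) : mu (G `&` `]i%:~R, i%:~R + 1]) = th%:E.
  rewrite -thE.
  have -> : G `&` `]i%:~R, i%:~R + 1]%classic = (fun x => 1 * x + - i%:~R) @^-1` (G `&` `]0%R, 1%R]%classic).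
    apply/seteqP; split => x /=; rewrite !in_itv /= mul1r subr_gt0 lerBlDr [1 + _]addrC.
      by move=> [Gx ->]; split => //; have := Gper x (- i) Gx; rewrite mulrNz.
    by move=> [Gx ->]; split => //; have := Gper _ i Gx; rewrite subrK.
  by rewrite /mu affine_preimage// invr1 mul1e.
(* Multiplication by [q] sends the part of [G] in this cell into the part in a unit interval, and
   divides the measure of preimages by [q]. *)
have piece (q : nat) (i : int) : (0 < q)%N -> (mu (G `&` `](i%:~R / q%:R)%R, ((i%:~R + 1) / q%:R)%R]) <= (th / q%:R)%:E)%E.
  move=> q0; have qR : 0 < q%:R :> R by rewrite ltr0n.
  have -> : (th / q%:R)%:E = (q%:R^-1%:E * mu (G `&` `](i%:~R)%R, (i%:~R + 1)%R]))%E.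
    by rewrite shift -EFinM mulrC.
  rewrite /mu -(@affine_preimage _ _ 0)//; apply: le_lebesgue => //.
    by rewrite -[X in measurable X]setTI; exact: measurable_affine.
  move=> x /= [Gx]; rewrite !in_itv /= ltr_pdivrMr// ler_pdivlMr// addr0 [x * _]mulrC => ->.
  by split => //; exact: Gmul.
have itvq (q : nat) (a b : R) : (0 < q)%N -> a < b ->
    (mu (G `&` `]a, b]) <= ((q%:R * (b - a) + 2) * (th / q%:R))%:E)%E.
  move=> q0 ab; have qR : 0 < q%:R :> R by rewrite ltr0n.
  (* Cells of length [1/q]; the two extra ones account for the ends of the interval, an error that
     disappears as [q] grows. *)
  pose i0 := Num.floor (q%:R * a); pose K := (Num.truncn (q%:R * (b - a))).+2.
  pose B (k : nat) : set R := G `&` `](((i0 + k%:Z)%:~R) / q%:R)%R, (((i0 + k%:Z)%:~R + 1) / q%:R)%R].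
  have qab : 0 <= q%:R * (b - a) by rewrite mulr_ge0// subr_ge0 ltW.
  apply: (@le_trans _ _ (mu (\big[setU/set0]_(k < K) B k))).
    apply: le_lebesgue => //; first by apply: bigsetU_measurable => k _; exact: mI.
    move=> x /= [Gx]; rewrite in_itv /= => /andP[ax xb].
    rewrite -bigcup_mkord; pose i := Num.ceil (q%:R * x) - 1.
    have i1 : i%:~R < q%:R * x <= i%:~R + 1.
      by rewrite /i intrB; have := ceil_itv (q%:R * x); rewrite intrB; clear; lra.
    have i0a := floor_itv (q%:R * a); rewrite -/i0 in i0a.
    have lt1 : q%:R * a < q%:R * x by rewrite ltr_pM2l.
    have lt2 : q%:R * x <= q%:R * b by rewrite ler_pM2l.
    have ii0 : i0 <= i.
      rewrite -ltzD1 -(ltr_int R) intrD; clear -i1 i0a lt1; lra.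
    have kE : (`|i - i0|%N)%:Z = i - i0 by rewrite gez0_abs// subr_ge0.
    exists `|i - i0|%N => /=.
      rewrite /K -(ltr_nat R) -natr1.
      have := truncnS_gt (q%:R * (b - a)).
      have -> : (`|i - i0|%N)%:R = i%:~R - i0%:~R :> R by rewrite -intrB -kE.
      rewrite mulrBr -natr1; clear -i1 i0a lt1 lt2; lra.
    split => //=; rewrite in_itv /= kE addrC subrK.
    by rewrite ltr_pdivrMr// ler_pdivlMr// [x * _]mulrC.
  apply: le_trans (Boole_inequality _ _) _; first by move=> k _; exact: mI.
  apply: (@le_trans _ _ (\sum_(k < K) (th / q%:R)%:E)%E).
    by apply: lee_sum => k _; exact: piece.
  rewrite sumEFin lee_fin sumr_const card_ord -[leLHS]mulr_natl.
  apply: ler_wpM2r; first by rewrite divr_ge0// ltW.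
  have /andP[] := truncn_itv qab; rewrite /K -addn2 natrD; clear; lra.
have itv (a b : R) : (mu (G `&` `]a, b]) <= th%:E * mu `]a, b]%classic)%E.
  have [ab|ba] := ltP a b; last first.
    rewrite set_itv_ge; last by rewrite bnd_simp -leNgt.
    by rewrite setI0 /mu measure0 mule0.
  rewrite {2}/mu lebesgue_measure_itv /= lte_fin ab -EFinD -EFinM.
  apply/lee_addgt0Pr => e e0; rewrite -EFinD.
  pose q := (Num.truncn (2 * th / e)).+1.
  apply: (le_trans (@itvq q a b isT ab)); rewrite lee_fin.
  have qR : 0 < q%:R :> R by rewrite ltr0n.
  have : 2 * th / e < q%:R by exact: truncnS_gt.
  rewrite ltr_pdivrMr// => h.
  have -> : (q%:R * (b - a) + 2) * (th / q%:R) = th * (b - a) + 2 * th / q%:R.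
    by field; rewrite gt_eqF.
  by rewrite lerD2l ler_pdivrMr// [leRHS]mulrC ltW.
have key (e : R) : 0 < e -> 1 <= th + e.
  move=> e0; pose D := G `&` `]0%R, 1%R]%classic.
  have : (mu D < mu D + e%:E)%E by rewrite thE -EFinD lte_fin ltrDl.
  (* Lebesgue measure is an infimum over covers by half-open intervals: some cover of [D] has total
     length [z < th + e]. Summing [itv] over it gives [th <= th * z], and [th > 0] cancels. *)
  move=> /ereal_inf_lt[z [/= M covDM sMz] zDe].
  have [mM DM] := covDM.
  have oc k : exists a b : R, M k = `]a, b]%classic.
    by have [[a b] _ <-] := mM k; exists a, b.
  have MM k : measurable (M k : set R) by have [a [b ->]] := oc k.
  have mGM k : measurable (G `&` M k : set R) by apply: measurableI.
  have wM k : wlength idfun (M k) = mu (M k).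
    by have [a [b ->]] := oc k; rewrite wlength_itv /mu lebesgue_measure_itv.
  have h : (th%:E <= th%:E * z)%E.
    rewrite -thE -sMz.
    apply: (@le_trans _ _ (\sum_(0 <= k <oo) mu (G `&` M k))%E).
      apply: (measure_sigma_subadditive mu) => [k||x [Gx x01]]; [exact: mGM|exact: mI|].
      by have [k _ Mx] := DM x (conj Gx x01); exists k.
    rewrite thE -nneseriesZl => [|k _]; last by rewrite wM measure_ge0.
    apply: lee_nneseries => [k _ _|k _]; first exact: measure_ge0.
    by rewrite wM; have [a [b ->]] := oc k; exact: itv.
  have h2 : (th%:E * z <= (th * (th + e))%:E)%E.
    rewrite EFinM; apply: lee_wpmul2l; first by rewrite lee_fin ltW.
    by rewrite EFinD -thE ltW.
  have := le_trans h h2; rewrite lee_fin -[leLHS]mulr1 ler_pM2l//.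
apply/eqP; rewrite eq_le le1 /= thE lee_fin.
apply/ler_addgt0Pr => e e0; exact: key.
Qed.

(** * Overlaps of balls around reduced fractions *)

Lemma sum_coprime_totient v : (0 < v)%N -> (\sum_(1 <= a < v.+1 | coprime a v) 1 = totient v)%N.
Proof.
move=> v0; rewrite totient_count_coprime [LHS]big_mkcond big_nat_recr//= [RHS]big_ltn// addnC.
congr (_ + _)%N; last first.
  by apply: eq_bigr => a _; rewrite coprime_sym; case: coprime.
by rewrite /coprime gcdnn gcdn0; case: eqP.
Qed.

(** Coprimality to [v] is a product of conditions modulo the primes dividing [v], to which [crt_avg]
    applies. *)
Lemma totient_kap (R : realType) v M : (0 < v < M)%N ->
  (totient v)%:R = v%:R * kap R (primes_below M) v.
Proof.
move=> /andP[v0 vM]; set P := primes_below M.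
pose ps := [seq p <- P | (p %| v)%N].
have psp : all prime ps by apply/allP => p; rewrite !mem_filter => /andP[_ /andP[]].
have psu : uniq ps by apply/filter_uniq/filter_uniq/iota_uniq.
pose F (p h : nat) : R := if (p %| h)%N then 0 else 1.
have -> : (totient v)%:R = \sum_(0 <= h < v) \prod_(p <- ps) F p h.
  rewrite totient_count_coprime natr_sum; apply: eq_bigr => h _.
  have [cop|ncop] := boolP (coprime v h).
    rewrite big_seq big1// => p; rewrite mem_filter => /andP[pv]; rewrite mem_filter => /andP[pp _].
    rewrite /F; case: ifP => // ph; have : (p %| gcdn v h)%N by rewrite dvdn_gcd pv.
    by rewrite (eqP cop) dvdn1 => /eqP p1; rewrite p1 in pp.
  have g1 : (1 < gcdn v h)%N.
    by rewrite ltn_neqAle eq_sym ncop gcdn_gt0 v0.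
  have pg := pdiv_dvd (gcdn v h); have pp := pdiv_prime g1.
  move: pg; rewrite dvdn_gcd => /andP[pv ph].
  have pin : pdiv (gcdn v h) \in ps.
    rewrite mem_filter pv mem_filter pp mem_index_iota prime_gt1//=.
    by apply: leq_ltn_trans vM; exact: dvdn_leq.
  by rewrite (big_rem _ pin) /= /F ph mul0r.
rewrite (@crt_avg _ ps F v) => //; last first.
- by apply: prod_primes_dvd => // p; rewrite mem_filter => /andP[].
- by move=> p h _; rewrite /F /dvdn modn_mod.
congr (_ * _); rewrite /kap -[RHS]big_filter; apply: eq_big_seq => p /(allP psp) pp.
have p0 := prime_gt0 pp; have pR : p%:R != 0 :> R by rewrite pnatr_eq0 -lt0n.
rewrite big_ltn// /F dvdn0 add0r big_nat (eq_bigr (fun=> 1)) => [|x /andP[x0 xp]]; last by rewrite gtnNdvd.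
by rewrite -big_nat sumr_const_nat natrB// mulrBr mulVf// mulr1.
Qed.

Lemma boole_seq (R : realType) (T : Type) (s : seq T) (B : T -> set R) :
  (forall x, measurable (B x)) ->
  (lebesgue_measure (\big[setU/set0]_(x <- s) B x) <= \sum_(x <- s) lebesgue_measure (B x))%E.
Proof.
move=> mB; elim: s => [|x s IH]; first by rewrite !big_nil measure0.
rewrite !big_cons; apply: le_trans (leeD2l _ IH).
apply: measureU2; first exact: mB.
by apply: bigsetU_measurable => y _; exact: mB.
Qed.

(** Each intersection is counted in both orders, a factor 2 weaker than the sharp inequality, so
    that the double sum is indexed like [overlap_sum]. *)
Lemma bonferroni (R : realType) (T : eqType) (s : seq T) (B : T -> set R) : uniq s ->
  (forall x, measurable (B x)) -> (forall x, lebesgue_measure (B x) < +oo)%E ->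
  (\sum_(x <- s) lebesgue_measure (B x) <= lebesgue_measure (\big[setU/set0]_(x <- s) B x) +
   \sum_(x <- s) \sum_(y <- s) (if y == x then 0 else lebesgue_measure (B x `&` B y)))%E.
Proof.
move=> + mB fB.
have mU s' : measurable (\big[setU/set0]_(x <- s') B x).
  by apply: bigsetU_measurable => y _; exact: mB.
have t0 (x y : T) : (0 <= (if y == x then 0 else lebesgue_measure (B x `&` B y)))%E.
  by case: ifP => // _; exact: measure_ge0.
elim: s => [|x s IH]; first by rewrite !big_nil measure0 adde0.
move=> /= /andP[xs /IH {}IH]; rewrite !big_cons eqxx add0e.
set U := \big[setU/set0]_(y <- s) B y.
have UI : (lebesgue_measure (B x) + lebesgue_measure U = lebesgue_measure (B x `|` U) + lebesgue_measure (B x `&` U))%E.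
  rewrite measureUfinl; [|exact: mB|exact: mU|exact: fB].
  rewrite subeK// ge0_fin_numE; last exact: measure_ge0.
  apply: le_lt_trans (fB x); apply: le_lebesgue => //.
  by apply: measurableI; [exact: mB|exact: mU].
have inter : (lebesgue_measure (B x `&` U) <= \sum_(y <- s) (if y == x then 0 else lebesgue_measure (B x `&` B y)))%E.
  apply: (@le_trans _ _ (\sum_(y <- s) lebesgue_measure (B x `&` B y))%E).
    rewrite /U big_distrr /=; apply: boole_seq => y; exact: measurableI.
  rewrite big_seq [leRHS]big_seq; apply: lee_sum => y ys; case: eqP => // yx.
  by rewrite -yx ys in xs.
have rest : (\sum_(z <- s) \sum_(y <- s) (if y == z then 0 else lebesgue_measure (B z `&` B y)) <=
   \sum_(z <- s) \sum_(y <- x :: s) (if y == z then 0 else lebesgue_measure (B z `&` B y)))%E.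
  apply: lee_sum => z _; rewrite big_cons leeDr//.
apply: (le_trans (leeD2l (lebesgue_measure (B x)) IH)); rewrite addeA UI -addeA; apply: leeD2l.
by apply: leeD => //; apply: leeD.
Qed.

Lemma ball_inter_le (R : realType) (x y r s : R) : 0 <= r -> 0 <= s ->
  (lebesgue_measure (ball x r `&` ball y s) <=
   (if (`|x - y| < r + s)%R then 2 * Num.min r s else 0)%:E)%E.
Proof.
move=> r0 s0; case: ltP => [_|far].
  have [rs|sr] := leP r s.
    rewrite mulr_natl -(lebesgue_measure_ball x r0); apply: le_lebesgue.
    - by apply: measurableI; exact: measurable_ball.
    - exact: measurable_ball.
    - exact: subIsetl.
  rewrite mulr_natl -(lebesgue_measure_ball y s0); apply: le_lebesgue.
  - by apply: measurableI; exact: measurable_ball.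
  - exact: measurable_ball.
  - exact: subIsetr.
rewrite (_ : _ `&` _ = set0) ?measure0//; apply/seteqP; split => // z /= [].
rewrite /ball /= => xz yz; move: far; apply/negP; rewrite -ltNge.
apply: le_lt_trans (ler_distD z x y) _; rewrite [X in _ + X]distrC; exact: ltrD.
Qed.

Lemma reduced_frac_inj (R : realType) a v b w : (0 < v)%N -> (0 < w)%N ->
  coprime a v -> coprime b w -> a%:R / v%:R = b%:R / w%:R :> R -> a = b /\ v = w.
Proof.
move=> v0 w0 cav cbw /eqP; rewrite eqr_div ?pnatr_eq0 -?lt0n// -!natrM eqr_nat => /eqP E.
have vw : (v %| w)%N by rewrite -(Gauss_dvdr w (_ : coprime v a)) 1?coprime_sym// E dvdn_mull.
have wv : (w %| v)%N by rewrite -(Gauss_dvdr v (_ : coprime w b)) 1?coprime_sym// -E dvdn_mull.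
have vE : v = w by apply/eqP; rewrite eqn_dvd vw.
by split=> //; apply/eqP; rewrite -(eqn_pmul2r w0) -{2}vE E eqxx.
Qed.

Definition frac_balls (R : realType) (rho : nat -> R) (v : nat) : set R :=
  [set x | exists2 a : nat, (0 < a <= v)%N && coprime a v & `|a%:R / v%:R - x| < rho v].

Lemma frac_ballsE (R : realType) (rho : nat -> R) v :
  frac_balls rho v = \big[setU/set0]_(a <- [seq a <- index_iota 1 v.+1 | coprime a v]) ball (a%:R / v%:R : R) (rho v).
Proof.
rewrite -bigcup_seq; apply/seteqP; split => x /=.
  by move=> [a /andP[aI cop] xB]; exists a; rewrite //= mem_filter mem_index_iota ltnS cop.
move=> [a] /=; rewrite mem_filter mem_index_iota ltnS => /andP[cop aI] xB; exists a => //.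
by rewrite aI.
Qed.

(** All balls, indexed by denominator and numerator, enter [bonferroni] at once. Each has measure
    [2 * rho v], which explains the 2; distinct reduced fractions are distinct points, so [nclose]
    counts the intersecting pairs. *)
Lemma union_lower (R : realType) (rho : nat -> R) Y : (forall v, 0 <= rho v) ->
  ((2 * block_mass rho Y)%:E <= lebesgue_measure (\big[setU/set0]_(1 <= v < Y.+1) frac_balls rho v) + (overlap_sum rho Y)%:E)%E.
Proof.
move=> rho0; pose mu := @lebesgue_measure R; rewrite -/mu.
pose C v := [seq a <- index_iota 1 v.+1 | coprime a v].
pose s := [seq (v, a) | v <- index_iota 1 Y.+1, a <- C v].
pose B (x : nat * nat) : set R := ball (x.2%:R / x.1%:R : R) (rho x.1).
have us : uniq s.
  apply: allpairs_uniq_dep.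
  - exact: iota_uniq.
  - by move=> v _; apply/filter_uniq/iota_uniq.
  - by move=> [v a] [w b] _ _ [-> ->].
have mB x : measurable (B x) by exact: measurable_ball.
have muB x : mu (B x) = (rho x.1 *+ 2)%:E by rewrite /mu lebesgue_measure_ball.
have fB x : (mu (B x) < +oo)%E by rewrite muB ltry.
have := bonferroni us mB fB; rewrite -/mu.
have -> : (\sum_(x <- s) mu (B x))%E = (2 * block_mass rho Y)%:E.
  rewrite /s big_allpairs_dep /= (eq_bigr (fun v => (2 * ((totient v)%:R * rho v))%:E)); last first.
    move=> v _; under eq_bigr do rewrite muB /=.
    rewrite sumEFin; congr (_%:E); rewrite big_filter.
    have [->|v0] := posnP v; first by rewrite big_geq//= mul0r mulr0.
    rewrite -(sum_coprime_totient v0) natr_sum mulrA mulrC mulr_sumr mulr_sumr.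
    by apply: eq_bigr => a _; rewrite mulr1 mulr_natr.
  rewrite sumEFin -mulr_sumr; congr (_ * _)%:E.
  rewrite /block_mass big_add1 /= big_mkord; apply: eq_bigr => i _.
  rewrite (@totient_kap _ _ Y.+1)//; last by rewrite /= ltnS; exact: ltn_ord.
  by rewrite mulrAC.
have -> : \big[setU/set0]_(x <- s) B x = \big[setU/set0]_(1 <= v < Y.+1) frac_balls rho v.
  rewrite /s big_allpairs_dep /= big_nat [RHS]big_nat; apply: eq_bigr => v _.
  exact/esym/frac_ballsE.
move=> /le_trans; apply; apply: leeD2l.
rewrite /s big_allpairs_dep /= /overlap_sum.
rewrite -(big_mkord xpredT (fun i => \sum_(k < Y) 2 * Num.min (rho i.+1) (rho k.+1) * (nclose rho i.+1 k.+1)%:R)).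
rewrite -(big_add1 _ _ 0 Y.+1 xpredT (fun v => \sum_(k < Y) 2 * Num.min (rho v) (rho k.+1) * (nclose rho v k.+1)%:R)).
rewrite -sumEFin big_nat [leRHS]big_nat; apply: lee_sum => v /andP[v0 _].
rewrite -(big_mkord xpredT (fun k => 2 * Num.min (rho v) (rho k.+1) * (nclose rho v k.+1)%:R)).
rewrite -(big_add1 _ _ 0 Y.+1 xpredT (fun w => 2 * Num.min (rho v) (rho w) * (nclose rho v w)%:R)).
under eq_bigr do rewrite big_allpairs_dep /=.
rewrite exchange_big /= -sumEFin big_nat [leRHS]big_nat; apply: lee_sum => w /andP[w0 _].
rewrite /nclose natr_sum mulr_sumr -sumEFin big_filter; apply: lee_sum => a cav.
rewrite natr_sum mulr_sumr -sumEFin big_filter; apply: lee_sum => b cbw.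
case: eqP => [_|ne]; first by rewrite lee_fin !mulr_ge0// le_min !rho0.
apply: le_trans (ball_inter_le _ _ (rho0 v) (rho0 w)) _; rewrite lee_fin /=.
have -> : (a%:R / v%:R != b%:R / w%:R :> R).
  by apply/eqP => /(reduced_frac_inj v0 w0 cav cbw)[ab vw]; apply: ne; rewrite ab vw.
by case: ifP; rewrite /= ?mulr1 ?mulr0.
Qed.

Lemma block_measure (R : realType) : exists2 del : R, 0 < del <= 1 & forall (rho : nat -> R) Y,
  (forall v, 0 <= rho v) -> block_mass rho Y <= del ->
  ((block_mass rho Y)%:E <= lebesgue_measure (\big[setU/set0]_(1 <= v < Y.+1) frac_balls rho v))%E.
Proof.
have [C1 [C2 [C10 C20 HC]]] := overlap_le R.
(* For a mass [m <= del] each of [C1 m^2] and [C2 m^(4/3)] is at most [m / 2], so the overlap takes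
   at most half of the [2 m] in [union_lower]. *)
pose del : R := Num.min 1 (Num.min (2 * (C1 + 1))^-1 ((2 * (C2 + 1))^-1 ^+ 3)).
have c1 : 0 < (2 * (C1 + 1))^-1 by rewrite invr_gt0 mulr_gt0// ltr_wpDl.
have c2 : 0 < (2 * (C2 + 1))^-1 by rewrite invr_gt0 mulr_gt0// ltr_wpDl.
exists del; first by rewrite /del !lt_min ltr01 c1 exprn_gt0//= ge_min lexx.
move=> rho Y rho0 md; have := union_lower Y rho0; have := HC rho Y rho0.
set m := block_mass rho Y in md *; set mU := lebesgue_measure _ => ovle.
have m0 : 0 <= m.
  apply: sumr_ge0 => i _; rewrite mulr_ge0 ?mulr_ge0// kap_ge0//.
  by apply/allP => p; rewrite mem_filter => /andP[].
have cE : cbrt (m ^+ 2) ^+ 2 = m * cbrt m.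
  rewrite (expr2 m) cbrtM// (_ : _ ^+ 2 = cbrt m ^+ 3 * cbrt m); last by ring.
  by rewrite cbrtK.
have m1 : m <= (2 * (C1 + 1))^-1 by apply: (le_trans md); rewrite /del !ge_min lexx !orbT.
have m2 : cbrt m <= (2 * (C2 + 1))^-1.
  apply: cube_le; [exact: cbrt_ge0|exact: ltW|rewrite cbrtK//].
  by apply: (le_trans md); rewrite /del !ge_min lexx !orbT.
have ovm : overlap_sum rho Y <= m.
  apply: (le_trans ovle); rewrite cE.
  have h1 : C1 * m ^+ 2 <= m / 2.
    rewrite expr2 mulrCA; apply: ler_wpM2l => //.
    apply: (@le_trans _ _ ((C1 + 1) * (2 * (C1 + 1))^-1)).
      by apply: ler_pM => //; rewrite lerDl.
    by rewrite invfM mulrCA divff ?mulr1// gt_eqF// ltr_wpDl.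
  have h2 : C2 * (m * cbrt m) <= m / 2.
    rewrite mulrCA; apply: ler_wpM2l => //.
    apply: (@le_trans _ _ ((C2 + 1) * (2 * (C2 + 1))^-1)).
      by apply: ler_pM => //; [exact: cbrt_ge0|rewrite lerDl].
    by rewrite invfM mulrCA divff ?mulr1// gt_eqF// ltr_wpDl.
  by apply: (le_trans (lerD h1 h2)); rewrite -splitr.
move=> h; have : ((2 * m)%:E <= mU + m%:E)%E.
  by apply: (le_trans h); apply: leeD2l; rewrite lee_fin.
rewrite mulr_natl mulr2n EFinD; by rewrite leeD2rE.
Qed.

(** * The series and the set of the theorem *)

Lemma infinite_natP (A : set nat) :
  infinite_set A <-> (forall L, exists2 l, (L <= l)%N & A l).
Proof.
split=> [infA L|H finA].
  apply: contrapT => H; apply: infA; apply: (sub_finite_set _ (finite_II L)) => l Al /=.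
  by rewrite ltnNge; apply/negP => Ll; apply: H; exists l.
have /finite_seqP[s sE] := finA.
have [l + Al] := H (\max_(x <- s) x).+1; apply/negP; rewrite -leqNgt.
by move: Al; rewrite sE /= => ls; rewrite (big_rem _ ls) /= leq_maxl.
Qed.

Lemma nearest_int (R : realType) (x : R) : exists z : int, forall y : int, `|x - z%:~R| <= `|x - y%:~R|.
Proof.
exists (Num.floor (x + 1/2)) => y; set z := Num.floor _.
have /andP[h1 h2] := floor_itv (x + 1/2); rewrite -/z intrD in h1 h2.
have [->//|/eqP yz] := eqVneq y z.
apply: (@le_trans _ _ (1/2)).
  by rewrite ler_norml; apply/andP; split; clear -h1 h2; lra.
rewrite ler_normr; have [yl|zl] : (y + 1 <= z) \/ (z + 1 <= y) by lia.
  apply/orP; left; move: yl; rewrite -(ler_int R) intrD; clear -h1 h2; lra.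
apply/orP; right; move: zl; rewrite -(ler_int R) intrD; clear -h1 h2; lra.
Qed.

Lemma dist_int_le (R : realType) (x e : R) :
  dist_int x <= e <-> exists z : int, `|x - z%:~R| <= e.
Proof.
have lb : has_lbound [set `|x - z%:~R| | z in [set: int]] by exists 0 => _ [z _ <-].
split=> [|[z xz]].
  have [z Hz] := nearest_int x => H; exists z; apply: le_trans H.
  by apply: lb_le_inf => [|_ [y _ <-]//]; exists (`|x - z%:~R|); exists z.
by apply: le_trans xz; apply: (ge_inf lb); exists z.
Qed.

Lemma dist_int_ge0 (R : realType) (x : R) : 0 <= dist_int x.
Proof.
by apply: lb_le_inf => [|_ [y _ <-]//]; exists (`|x - 0%:~R|); exists 0.
Qed.

Lemma in_posdiff_mono (a : nat -> nat) l m n : (l <= m)%N -> in_posdiff a l n -> in_posdiff a m n.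
Proof.
move=> lm [n0 [i [j [/andP[i1 il] [/andP[j1 jl] E]]]]]; split=> //; exists i, j.
by rewrite i1 j1 (leq_trans il) ?(leq_trans jl).
Qed.

Lemma incr_leq (a : nat -> nat) : (forall n, (1 <= n)%N -> (a n < a n.+1)%N) ->
  forall i d, (1 <= i)%N -> (a i + d <= a (i + d))%N.
Proof.
move=> a_incr i d i1; elim: d => [|d IH]; first by rewrite !addn0.
by rewrite !addnS; apply: leq_ltn_trans IH (a_incr _ _); rewrite addn_gt0 i1.
Qed.

Lemma in_posdiff_le (a : nat -> nat) l n : (forall n, (1 <= n)%N -> (a n < a n.+1)%N) ->
  in_posdiff a l n -> (n <= a l)%N.
Proof.
move=> a_incr [n0 [i [j [/andP[i1 il] [/andP[j1 jl] E]]]]].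
have := incr_leq a_incr (l - i) i1; rewrite subnKC//; lia.
Qed.

Lemma in_posdiff_unbounded (a : nat -> nat) B : (forall n, (1 <= n)%N -> (a n < a n.+1)%N) ->
  exists l n, (B <= n)%N /\ in_posdiff a l n.
Proof.
move=> a_incr; have := incr_leq a_incr B.+1 (leqnn 1) => H.
exists B.+2, (a B.+2 - a 1%N)%N; split; first by move: H; rewrite add1n; lia.
split; first by move: H; rewrite add1n; lia.
by exists B.+2, 1%N; rewrite add1n in H; split; [|split]; lia.
Qed.

Lemma in_posdiff_gt1 (a : nat -> nat) l n : in_posdiff a l n -> (1 < l)%N.
Proof.
move=> [n0 [i [j [/andP[i1 il] [/andP[j1 jl] E]]]]]; rewrite ltnNge; apply/negP => l1.
have ij : i = j by lia.
by move: E; rewrite ij subrr => E; rewrite -ltz_nat -E in n0.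
Qed.

(** The infimum over finitely many pairs is attained, and the evenness of [dist_int] lets the pair
    be ordered so that the difference is positive. *)
Lemma delta_min_le (R : realType) (a : nat -> nat) l (x e : R) :
  (forall n, (1 <= n)%N -> (a n < a n.+1)%N) -> (2 <= l)%N ->
  delta_min a x l <= e <->
  exists2 n, in_posdiff a l n & exists z : int, `|n%:R * x - z%:~R| <= e.
Proof.
move=> a_incr l2.
pose F (i j : nat) : R := dist_int (((a i)%:Z - (a j)%:Z)%:~R * x).
have FC i j : F i j = F j i.
  have le i' j' : F i' j' <= F j' i'.
    have /dist_int_le[z Hz] := lexx (F j' i'); apply/dist_int_le; exists (- z).
    rewrite -normrN (_ : - _ = ((a j')%:Z - (a i')%:Z)%:~R * x - z%:~R)//.
    by rewrite !intrB mulrNz; ring.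
  by apply/eqP; rewrite eq_le !le.
have key i j : (1 <= j)%N -> (j < i <= l)%N -> F i j <= e ->
    exists2 n, in_posdiff a l n & exists z : int, `|n%:R * x - z%:~R| <= e.
  move=> j1 /andP[ji il] /dist_int_le[z Hz]; have := incr_leq a_incr (i - j) j1.
  rewrite (subnKC (ltnW ji)) => aij.
  exists (a i - a j)%N.
    by split; [lia|exists i, j; repeat split; lia].
  exists z; suff -> : (a i - a j)%:R = ((a i)%:Z - (a j)%:Z)%:~R :> R by [].
  by rewrite intrB natrB//; lia.
split=> [H|[n [n0 [i [j [iI [jI E]]]]] [z Hz]]]; last first.
  apply: (@le_trans _ _ (F i j)); last first.
    by apply/dist_int_le; exists z; rewrite E.
  apply: ge_inf; first by exists 0 => _ [mn _ <-]; exact: dist_int_ge0.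
  exists (i, j) => //=; do 2!split=> //; move=> ij; move: E; rewrite ij subrr => E.
  by rewrite -ltz_nat -E in n0.
pose P (p : 'I_l.+1 * 'I_l.+1) := [&& (0 < p.1)%N, (0 < p.2)%N & p.1 != p.2].
pose i0 : 'I_l.+1 * 'I_l.+1 := (inord 1, inord 2).
have Pi0 : P i0 by rewrite /P /= -(inj_eq val_inj) /= !inordK//; lia.
have [[i j] /and3P[/= i1 j1 ij] Hmin] := @arg_minP _ _ _ i0 P (fun p => F p.1 p.2) Pi0.
have Fij : F i j <= e.
  apply: le_trans H; apply: lb_le_inf.
    by exists (F 1%N 2%N); exists (1%N, 2%N) => //=; repeat split=> //; lia.
  move=> _ [[k m] /= [/andP[k1 kl] [/andP[m1 ml] km]] <-].
  have := Hmin (inord k, inord m); rewrite /P /= -(inj_eq val_inj) /= !inordK//; apply.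
  by rewrite k1 m1; apply/eqP.
have := ltn_ord i; have := ltn_ord j; rewrite !ltnS => jl il.
have [ji|ij'] := ltnP j i; first by apply: (key i j) => //; rewrite ji.
apply: (key j i) => //; last by rewrite FC.
by rewrite jl andbT ltn_neqAle ij'; move: ij; rewrite -(inj_eq val_inj) /= => ->.
Qed.

Lemma calN_some (a : nat -> nat) l n : in_posdiff a l n ->
  exists m, [/\ calN a n = Some m, (m <= l)%N & in_posdiff a m n].
Proof.
move=> H; rewrite /calN; case: pselect => [ex|[]]; last first.
  by exists l; split=> //; apply: ltnW; exact: in_posdiff_gt1 H.
case: ex_minnP => m /asboolP[m1 Hm] Hmin; exists m; split=> //.
by apply: Hmin; apply/asboolP; split=> //; apply: ltnW; exact: in_posdiff_gt1 H.
Qed.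

Lemma calN_someP (a : nat -> nat) n m : calN a n = Some m -> in_posdiff a m n.
Proof.
rewrite /calN; case: pselect => // ex [<-].
by case: ex_minnP => k /asboolP[].
Qed.

Lemma sup_tail_ge (R : realType) (a : nat -> nat) (eta : nat -> R) l n :
  in_posdiff a l n -> ((eta l)%:E <= sup_tail a eta n)%E.
Proof.
move=> /calN_some[m [E ml _]]; rewrite /sup_tail E; apply: ereal_sup_ubound.
by exists l.
Qed.

Lemma sup_tail_gt (R : realType) (a : nat -> nat) (eta : nat -> R) (t : R) n : 0 <= t ->
  (t%:E < sup_tail a eta n)%E -> exists2 l, in_posdiff a l n & t < eta l.
Proof.
move=> t0; rewrite /sup_tail; case E: calN => [m|]; last by rewrite lte_fin ltNge t0.
move=> /ereal_sup_gt[_ [l /= ml <-] tl]; exists l => //.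
exact: in_posdiff_mono ml (calN_someP E).
Qed.

Lemma sup_tail_ge0 (R : realType) (a : nat -> nat) (eta : nat -> R) n :
  (forall N, (1 <= N)%N -> 0 <= eta N) -> (0 <= sup_tail a eta n)%E.
Proof.
move=> eta0; rewrite /sup_tail; case E: calN => [m|//].
have /in_posdiff_gt1/ltnW m1 := calN_someP E.
apply: (@le_trans _ _ (eta m)%:E); first by rewrite lee_fin eta0.
by apply: ereal_sup_ubound; exists m => /=.
Qed.

Lemma series_term_ge0 (R : realType) (a : nat -> nat) (eta : nat -> R) k :
  (forall N, (1 <= N)%N -> 0 <= eta N) -> (0 <= series_term a eta k)%E.
Proof.
move=> eta0; apply: (@le_trans _ _ (sup_tail a eta (1 * k) * ((1 * k)%:R^-1)%:E)%E).
  by apply: mule_ge0; [exact: sup_tail_ge0|rewrite lee_fin invr_ge0].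
by apply: ereal_sup_ubound; exists 1%N.
Qed.

Lemma series_term_ge (R : realType) (a : nat -> nat) (eta : nat -> R) l b k :
  in_posdiff a l (b * k) -> ((eta l / (b * k)%:R)%:E <= series_term a eta k)%E.
Proof.
move=> H; have b0 : (0 < b)%N by case: H; rewrite muln_gt0 => /andP[].
apply: (@le_trans _ _ (sup_tail a eta (b * k) * ((b * k)%:R^-1)%:E)%E).
  by rewrite EFinM; apply: lee_wpmul2r; [rewrite lee_fin invr_ge0|exact: sup_tail_ge].
by apply: ereal_sup_ubound; exists b.
Qed.

Lemma series_term_gt (R : realType) (a : nat -> nat) (eta : nat -> R) (t : R) k :
  0 <= t -> (0 < k)%N -> (t%:E < series_term a eta k)%E ->
  exists b l, in_posdiff a l (b * k) /\ t * (b * k)%:R < eta l.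
Proof.
move=> t0 k0 /ereal_sup_gt[_ [b /= b1 <-]].
have bk : 0 < (b * k)%:R :> R by rewrite ltr0n muln_gt0 b1.
rewrite lte_pdivlMr// -EFinM => /sup_tail_gt[|l H Hl]; first by rewrite mulr_ge0.
by exists b, l.
Qed.

(* [e / n] is a lower bound for the [k]-th term whenever [k] divides [n], and Gauss' identity sums the totients over the divisors of [n]. *)
Lemma tail_ge (R : realType) (a : nat -> nat) (eta : nat -> R) (e : R) X :
  (forall n, (1 <= n)%N -> (a n < a n.+1)%N) -> (forall N, (1 <= N)%N -> 0 <= eta N) ->
  0 < e -> (0 < X)%N -> (forall L, exists2 l, (L <= l)%N & e <= eta l) ->
  exists Y, ((e / 2)%:E <= \sum_(X <= k < Y) ((totient k)%:R%:E * series_term a eta k))%E.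
Proof.
move=> a_incr eta0 e0 X0 He.
(* Divisors of [n] below [X] have totients adding up to at most [X ^ 2 <= n / 2], so those from [X]
   on keep at least [n / 2] of Gauss' sum. *)
have [L0 [n [Bn Hn]]] := in_posdiff_unbounded (2 * X ^ 2) a_incr.
have [l L0l el] := He L0; have {}Hn := in_posdiff_mono L0l Hn.
have n0 : (0 < n)%N by case: Hn.
have nR : 0 < n%:R :> R by rewrite ltr0n.
have s0 k := series_term_ge0 a k eta0.
have Xn : (X <= n.+1)%N by nia.
exists n.+1; apply: (@le_trans _ _ (\sum_(X <= k < n.+1 | (k %| n)%N) ((totient k)%:R * (e / n%:R))%:E)%E); last first.
  rewrite big_mkcond big_nat [leRHS]big_nat; apply: lee_sum => k /andP[Xk _]; case: ifP => [kn|_]; last first.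
    by apply: mule_ge0; rewrite // lee_fin.
  rewrite EFinM; apply: lee_wpmul2l; first by rewrite lee_fin.
  apply: (@le_trans _ _ (eta l / (n %/ k * k)%:R)%:E); last first.
    by apply: series_term_ge; rewrite divnK.
  by rewrite divnK// lee_fin ler_pM2r ?invr_gt0.
rewrite sumEFin lee_fin -mulr_suml -natr_sum.
have tle k : (totient k <= k)%N.
  case: k => // k; rewrite totient_count_coprime.
  apply: (@leq_trans (\sum_(0 <= i < k.+1) 1)%N); last by rewrite sum_nat_const_nat subn0 muln1.
  by apply: leq_sum => i _; case: coprime.
have tot : (n <= \sum_(X <= k < n.+1 | k %| n) totient k + X ^ 2)%N.
  rewrite -[X in (X <= _)%N](sum_totient_dvd n).
  rewrite -(big_mkord (fun k => (k %| n)%N) totient) (big_cat_nat _ Xn)//= addnC leq_add2l.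
  apply: (@leq_trans (\sum_(0 <= k < X | k %| n) X)%N).
    rewrite big_nat_cond [X in (_ <= X)%N]big_nat_cond; apply: leq_sum => k /andP[/andP[_ kX] _].
    by apply: leq_trans (ltnW kX); exact: tle.
  apply: (@leq_trans (\sum_(0 <= k < X) X)%N); last by rewrite sum_nat_const_nat subn0 mulnn.
  by rewrite big_mkcond; apply: leq_sum => k _; case: ifP.
have {}tot : n%:R / 2 <= (\sum_(X <= k < n.+1 | (k %| n)%N) totient k)%N%:R :> R.
  set T := (\sum_(_ <= k < _ | _) _)%N in tot *.
  have : n%:R <= T%:R + (X ^ 2)%:R :> R by rewrite -natrD ler_nat.
  have : 2 * (X ^ 2)%:R <= n%:R :> R by rewrite -natrM ler_nat.
  by clear; lra.
rewrite (_ : e / 2 = n%:R / 2 * (e / n%:R)); last by field; rewrite gt_eqF.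
by apply: ler_wpM2r => //; rewrite divr_ge0// ltW.
Qed.

Lemma tail_small (R : realType) (f : nat -> \bar R) (e : R) : (forall k, 0 <= f k)%E -> 0 < e ->
  (\sum_(1 <= k <oo) f k < +oo)%E ->
  exists2 X, (0 < X)%N & forall Y, (\sum_(X <= k < Y) f k < e%:E)%E.
Proof.
move=> f0 e0 Sfin; set S := (\sum_(1 <= k <oo) f k)%E in Sfin.
pose u n := (\sum_(1 <= k < n) f k)%E.
have S0 : (0 <= S)%E by apply: nneseries_ge0.
have Sf : S \is a fin_num by rewrite ge0_fin_numE.
have u_nd : {homo u : n m / (n <= m)%N >-> (n <= m)%E}.
  by move=> n m nm; apply: lee_sum_nneg_natr.
have SE : S = ereal_sup (range u) by apply/cvg_lim => //; exact: ereal_nondecreasing_cvgn.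
have : (S - e%:E < ereal_sup (range u))%E by rewrite -SE lteBlDr// lteDl// lte_fin.
move=> /ereal_sup_gt[_ [X _ <-] SX]; exists (maxn 1 X); first by rewrite leq_max.
move=> Y; have [YX|/ltnW XY] := leqP Y (maxn 1 X); first by rewrite big_geq// lte_fin.
have uX : (S - e%:E < u (maxn 1 X))%E by apply: lt_le_trans SX _; apply: u_nd; rewrite leq_maxr.
have : (u Y <= S)%E by rewrite SE; apply: ereal_sup_ubound; exists Y.
have : (u Y = u (maxn 1 X) + \sum_(maxn 1 X <= k < Y) f k)%E.
  by rewrite /u (big_cat_nat _ XY)// leq_maxl.
have uXf : u (maxn 1 X) \is a fin_num.
  rewrite ge0_fin_numE; last exact: sume_ge0.
  by apply: le_lt_trans Sfin; rewrite SE; apply: ereal_sup_ubound; exists (maxn 1 X).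
move=> -> h; rewrite lteBlDr// in uX.
by have := le_lt_trans h uX; rewrite lteD2lE.
Qed.

Lemma tail_large (R : realType) (f : nat -> \bar R) (M : R) X : (forall k, 0 <= f k)%E ->
  (\sum_(1 <= k <oo) f k = +oo)%E -> (forall k, (0 < k)%N -> f k < +oo)%E ->
  (0 < X)%N -> exists Y, (M%:E <= \sum_(X <= k < Y) f k)%E.
Proof.
move=> f0 Soo ffin X0.
have u_nd : {homo (fun n => (\sum_(X <= k < n) f k)%E) : n m / (n <= m)%N >-> (n <= m)%E}.
  by move=> n m nm; apply: lee_sum_nneg_natr.
have : (M%:E < \sum_(X <= k <oo) f k)%E.
  have := Soo; rewrite (@nneseries_split _ _ 1 X.-1)// add1n prednK//.
  have : (\sum_(1 <= k < X) f k < +oo)%E by rewrite big_nat_cond; apply: lte_sum_pinfty => k /andP[/andP[k0 _] _]; exact: ffin.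
  have : (0 <= \sum_(1 <= k < X) f k)%E by exact: sume_ge0.
  case: (\sum_(1 <= k < X) f k)%E => // r _ _.
  by case: (limn _) => //= _; rewrite ltry.
have -> : (\sum_(X <= k <oo) f k)%E = ereal_sup (range (fun n => (\sum_(X <= k < n) f k)%E)).
  by apply/cvg_lim => //; exact: ereal_nondecreasing_cvgn.
by move=> /ereal_sup_gt[_ [Y _ <-] /ltW]; exists Y.
Qed.

(** * Limsup sets and their measurability *)

Definition hits (R : realType) (a : nat -> nat) (B : nat -> set R) (l : nat) : set R :=
  [set x | exists2 n, in_posdiff a l n & exists z : int, B l (n%:R * x - z%:~R)].

Lemma measurable_lim_sup_set (R : realType) (F : nat -> set R) :
  (forall n, measurable (F n)) -> measurable (lim_sup_set F).
Proof.
move=> mF; apply: bigcapT_measurable => n; apply: bigcup_measurable => k _; exact: mF.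
Qed.

Lemma measurable_hits (R : realType) a (B : nat -> set R) l :
  measurable (B l) -> measurable (hits a B l).
Proof.
move=> mB.
have -> : hits a B l = \bigcup_(n in [set n | in_posdiff a l n])
    \bigcup_(z in [set: int]) ((fun x => n%:R * x + - z%:~R) @^-1` B l).
  apply/seteqP; split=> x /=; first by move=> [n Hn [z Hz]]; exists n => //; exists z.
  by move=> [n Hn [z _ Hz]]; exists n => //; exists z.
apply: bigcup_measurable => n _; apply: countable_bigcupT_measurable => // z.
by rewrite -[X in measurable X]setTI; exact: measurable_affine.
Qed.

Lemma calAE (R : realType) (a : nat -> nat) (eta : nat -> R) :
  (forall n, (1 <= n)%N -> (a n < a n.+1)%N) ->
  calA a eta = `[0, 1] `&` lim_sup_set (hits a (fun l => [set t | `|t| <= eta l])).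
Proof.
move=> a_incr; apply/seteqP; split=> x /=; rewrite in_itv /=.
  move=> [x01 /infinite_natP H]; split=> // L _; have [l Ll [l2]] := H L.
  by move=> /(delta_min_le _ _ a_incr l2)[n Hn Hz]; exists l => //; exists n.
move=> [x01 H]; split=> //; apply/infinite_natP => L; have [l Ll [n Hn Hz]] := H L I.
have l2 := in_posdiff_gt1 Hn; exists l => //; split=> //.
by apply/(delta_min_le _ _ a_incr l2); exists n.
Qed.

Lemma measurable_calA (R : realType) (a : nat -> nat) (eta : nat -> R) :
  (forall n, (1 <= n)%N -> (a n < a n.+1)%N) -> measurable (calA a eta).
Proof.
move=> a_incr; rewrite calAE//; apply: measurableI => //.
apply: measurable_lim_sup_set => l; apply: measurable_hits.
rewrite (_ : mkset _ = `[- eta l, eta l]%classic)//.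
by apply/seteqP; split=> x /=; rewrite in_itv /= ler_norml.
Qed.

Lemma measurable_frac_balls (R : realType) (rho : nat -> R) v : measurable (frac_balls rho v).
Proof. by rewrite frac_ballsE; apply: bigsetU_measurable => b _; exact: measurable_ball. Qed.

Lemma frac_balls_measure_le (R : realType) (rho : nat -> R) v : (0 < v)%N -> 0 <= rho v ->
  (lebesgue_measure (frac_balls rho v) <= ((totient v)%:R * (2 * rho v))%:E)%E.
Proof.
move=> v0 rho0; rewrite frac_ballsE; apply: le_trans (boole_seq _ _) _.
  by move=> b; exact: measurable_ball.
under eq_bigr do rewrite lebesgue_measure_ball//.
rewrite big_filter sumEFin lee_fin -(sum_coprime_totient v0) natr_sum mulr_suml.
by apply: ler_sum => i _; rewrite mul1r mulr_natl.
Qed.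

(** * The convergence case *)

Lemma dist_fracs_pos (R : realType) (x : R) K :
  (forall b k, (0 < k)%N -> x != b%:R / k%:R) ->
  exists2 d : R, 0 < d & forall b k, (0 < k < K)%N -> d <= `|x - b%:R / k%:R|.
Proof.
move=> irr; elim: K => [|K [d d0 Hd]]; first by exists 1 => // b k /andP[].
have [->|K0] := posnP K.
  by exists 1 => // b k /andP[]; case: k.
have KR : 0 < K%:R :> R by rewrite ltr0n.
have [z Hz] := nearest_int (K%:R * x).
have zb (y : R) : K%:R * `|x - y / K%:R| = `|K%:R * x - y|.
  by rewrite -[X in X * _](gtr0_norm KR) -normrM mulrBr mulrCA divff ?gt_eqF// mulr1.
have [e e0 He] : exists2 e : R, 0 < e & forall b, e <= `|x - b%:R / K%:R|.
  have [zE|zN] := eqVneq (K%:R * x) z%:~R; last first.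
    exists (`|K%:R * x - z%:~R| / K%:R); first by rewrite divr_gt0// normr_gt0 subr_eq0.
    by move=> b; rewrite ler_pdivrMr// [leRHS]mulrC zb (Hz b).
  (* Numerators are natural numbers, so the hypothesis does not prevent [x] from being a negative
     multiple of [1/K]; every [b / K] is then at distance at least [1/K]. *)
  have z0 : (z < 0)%R.
    rewrite ltNge; apply/negP => z0; have := irr `|z|%N K K0.
    have -> : (`|z|%N)%:R = z%:~R :> R by rewrite -[in RHS](gez0_abs z0).
    by rewrite -zE mulrAC (divff (lt0r_neq0 KR)) mul1r eqxx.
  exists (1 / K%:R); first by rewrite divr_gt0.
  move=> b; rewrite ler_pdivrMr// [leRHS]mulrC zb zE -[b%:R]/((b%:Z)%:~R) -intrB -intr_norm.
  by rewrite -[1]/(1%:~R) ler_int; lia.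
exists (Num.min d e); first by rewrite lt_min d0.
move=> b k; rewrite ltnS => /andP[k0]; rewrite leq_eqVlt => /orP[/eqP ->|kK].
  by rewrite ge_min He orbT.
by rewrite ge_min Hd// k0.
Qed.

Lemma clamp_int (R : realType) (n : nat) (x : R) (z : int) : 0 <= x <= 1 ->
  exists2 b : nat, (b <= n)%N & `|n%:R * x - b%:R| <= `|n%:R * x - z%:~R|.
Proof.
move=> /andP[x0 x1].
have nx0 : 0 <= n%:R * x by rewrite mulr_ge0.
have nx1 : n%:R * x <= n%:R by rewrite ler_piMr.
have [zn|nz] := lerP z n%:Z; last first.
  exists n => //; rewrite distrC ger0_norm ?subr_ge0// distrC.
  apply: le_trans (ler_norm _); rewrite lerB// -[n%:R]/((n%:Z)%:~R) ler_int; exact: ltW.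
have [z0|z0] := lerP 0 z.
  exists `|z|%N; first by lia.
  by rewrite (_ : (`|z|%N)%:R = z%:~R :> R) // -[in RHS](gez0_abs z0).
exists 0%N => //; rewrite subr0 ger0_norm//; apply: le_trans (ler_norm _).
by rewrite lerDl oppr_ge0 -[0]/(0%:~R) ler_int ltW.
Qed.

Lemma reduced_frac (R : realType) b n : (0 < n)%N ->
  exists c k, [/\ (0 < k)%N && coprime c k, (k %| n)%N, (b <= n)%N -> (c <= k)%N, (0 < b)%N -> (0 < c)%N & b%:R / n%:R = c%:R / k%:R :> R].
Proof.
move=> n0; pose g := gcdn b n; have g0 : (0 < g)%N by rewrite gcdn_gt0 n0 orbT.
have gb : (g %| b)%N by exact: dvdn_gcdl.
have gn : (g %| n)%N by exact: dvdn_gcdr.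
have k0 : (0 < n %/ g)%N by rewrite divn_gt0// dvdn_leq.
exists (b %/ g)%N, (n %/ g)%N; split=> //.
- by rewrite k0 /= /coprime -(eqn_pmul2r g0) muln_gcdl (divnK gb) (divnK gn) mul1n eqxx.
- exact: dvdn_div.
- by move=> bn; exact: leq_div2r.
- by move=> b0; rewrite divn_gt0// dvdn_leq.
rewrite -[in LHS](divnK gb) -[in LHS](divnK gn) !natrM -mulf_div divff ?mulr1//.
by rewrite pnatr_eq0 -lt0n.
Qed.

Lemma frac_balls0 (R : realType) (rho : nat -> R) : frac_balls rho 0 = set0.
Proof. by apply/seteqP; split=> x //= [b /andP[/andP[b0]]]; rewrite leqNgt b0. Qed.

Lemma convergence_case (R : realType) (a : nat -> nat) (eta : nat -> R) :
  (forall n, (1 <= n)%N -> (a n < a n.+1)%N) -> (forall N, (1 <= N)%N -> 0 <= eta N) ->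
  (\sum_(1 <= k <oo) ((totient k)%:R%:E * series_term a eta k) < +oo)%E ->
  lebesgue_measure (calA a eta) = 0%E.
Proof.
move=> a_incr eta0 Sfin; set f := fun k => ((totient k)%:R%:E * series_term a eta k)%E in Sfin.
have s0 k := series_term_ge0 a k eta0.
have f0 k : (0 <= f k)%E by apply: mule_ge0; rewrite // lee_fin.
have tot1 k : (0 < k)%N -> 1 <= (totient k)%:R :> R by move=> k0; rewrite ler1n totient_gt0.
have sfin k : (0 < k)%N -> (series_term a eta k < +oo)%E.
  move=> k0; apply: (@le_lt_trans _ _ (f k)).
    by rewrite -[leLHS]mul1e; apply: lee_wpmul2r => //; rewrite lee_fin tot1.
  apply: le_lt_trans Sfin; apply: le_trans (@nneseries_lim_ge _ f xpredT 1 k.+1 _) => //.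
  by rewrite big_nat_recr//= leeDr// sume_ge0.
have sE k : (0 < k)%N -> (fine (series_term a eta k))%:E = series_term a eta k.
  by move=> k0; rewrite fineK// ge0_fin_numE// sfin.
(* The balls are open while the approximation is only [<=]; for irrational [x] the distance is
   positive, so doubling the radius makes the inequality strict. *)
pose rho k : R := 2 * fine (series_term a eta k).
have rho0 k : 0 <= rho k by rewrite mulr_ge0// fine_ge0.
pose F := lim_sup_set (frac_balls rho).
have mF : measurable F by apply: measurable_lim_sup_set => v; exact: measurable_frac_balls.
have F_null : lebesgue_measure F = 0%E.
  apply: lim_sup_set_cvg0 => [v|]; first exact: measurable_frac_balls.
  rewrite nneseries_recl// frac_balls0 measure0 add0e.
  apply: (@le_lt_trans _ _ (\sum_(1 <= k <oo) (4%:E * f k))%E).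
    apply: lee_nneseries => [k _ _|k _]; first exact: measure_ge0.
    have [->|k0] := posnP k.
      by rewrite frac_balls0 measure0 mule_ge0 ?f0// lee_fin.
    apply: (le_trans (frac_balls_measure_le k0 (rho0 k))).
    rewrite /f -sE// -!EFinM lee_fin /rho; clear; lra.
  rewrite nneseriesZl//.
  apply: lte_mul_pinfty; [by rewrite lee_fin|by []|exact: Sfin].
pose Q : set R := range (ratr : rat -> R).
have mQ : measurable Q by rewrite /Q -bigcup_imset1; apply: countable_bigcupT_measurable.
have Q_null : lebesgue_measure Q = 0%E by exact: lebesgue_measure_rat.
suff sub : calA a eta `<=` Q `|` F.
  have : (lebesgue_measure (Q `|` F) <= lebesgue_measure Q + lebesgue_measure F)%E by apply: measureU2.
  rewrite Q_null F_null adde0 => QF; apply/eqP; rewrite eq_le measure_ge0 andbT.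
  apply: le_trans QF; apply: le_lebesgue => //; [exact: measurable_calA|exact: measurableU].
rewrite calAE// => x [/=]; rewrite in_itv /= => x01 Hx.
have [|xQ] := pselect (Q x); [by left|right].
have irr b k : (0 < k)%N -> x != b%:R / k%:R.
  move=> k0; apply/eqP => xE; apply: xQ; exists (b%:Q / k%:Q) => //.
  by rewrite xE rmorph_div/= ?unitfE ?intr_eq0 -?lt0n ?ratr_nat//; lia.
apply: contrapT => xF.
have [K Kx] : exists K, forall k, (K <= k)%N -> ~ frac_balls rho k x.
  apply: contrapT => nK; apply: xF => K _; apply: contrapT => nk; apply: nK.
  by exists K => k Kk xk; apply: nk; exists k.
(* Excluding the denominator 1 rules out the numerator 0, which is not among the centres of
   [frac_balls]. *)
have [d d0 Hd] := dist_fracs_pos (maxn 2 K) irr.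
have big L : exists2 l, (L <= l)%N & d <= eta l.
  have [l Ll [n Hn [z /= Hz]]] := Hx L I; exists l => //.
  have n0 : (0 < n)%N by case: Hn.
  have nR : 0 < n%:R :> R by rewrite ltr0n.
  have [b bn Hb] := clamp_int n z x01.
  have [c [k [/andP[k0 ck] kn bc cb E]]] := reduced_frac R b n0.
  have le1 : `|x - c%:R / k%:R| <= eta l / n%:R.
    rewrite ler_pdivlMr// -[X in _ * X](gtr0_norm nR) -normrM -E mulrBl.
    by rewrite divfK ?gt_eqF// [x * _]mulrC (le_trans Hb).
  have lt0 : 0 < `|x - c%:R / k%:R| by rewrite normr_gt0 subr_eq0 irr.
  (* A small reduced denominator keeps the fraction at distance [d] from [x], and then
     [eta l >= n * d >= d]. A large one would put [x] in a ball, against the choice of [K]. *)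
  have [kK|Kk] := ltnP k (maxn 2 K).
    apply: (@le_trans _ _ (eta l / n%:R)).
      by apply: le_trans le1; rewrite Hd// k0.
    rewrite ler_pdivrMr// ler_peMr ?ler1n// eta0//.
    exact: ltnW (in_posdiff_gt1 Hn).
  exfalso; apply: (Kx k); first by apply: leq_trans Kk; rewrite leq_maxr.
  have k2 : (1 < k)%N by apply: leq_trans Kk; rewrite leq_maxl.
  have c0 : (0 < c)%N.
    by rewrite lt0n; apply/eqP => c0; move: ck k2; rewrite c0 /coprime gcd0n => /eqP ->.
  exists c; first by rewrite c0 bc.
  have le2 : eta l / n%:R <= fine (series_term a eta k).
    rewrite -lee_fin sE// -(divnK kn); apply: series_term_ge; by rewrite divnK.
  rewrite distrC /rho; clear -lt0 le1 le2; lra.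
have [X X0 HX] := tail_small f0 (divr_gt0 d0 (ltr0n R 2)) Sfin.
have [Y] := tail_ge a_incr eta0 d0 X0 big.
by rewrite leNgt HX.
Qed.

(** * The divergence case *)

Lemma block_mass_totient (R : realType) (rho : nat -> R) Y :
  block_mass rho Y = \sum_(1 <= v < Y.+1) (totient v)%:R * rho v.
Proof.
rewrite /block_mass big_add1 /= big_mkord; apply: eq_bigr => i _.
rewrite (@totient_kap _ _ Y.+1)//; last by rewrite /= ltnS; exact: ltn_ord.
by rewrite mulrAC.
Qed.

Lemma limsup_measure_ge (R : realType) (F : nat -> set R) (q : R) (A : set R) :
  (forall n, measurable (F n)) -> (forall n, F n `<=` A) -> measurable A ->
  (lebesgue_measure A < +oo)%E ->
  (forall X, q%:E <= lebesgue_measure (\bigcup_(k in [set k | (X <= k)%N]) F k))%E ->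
  (q%:E <= lebesgue_measure (lim_sup_set F))%E.
Proof.
move=> mF FA mA Afin HF.
have mU X : measurable (\bigcup_(k in [set k | (X <= k)%N]) F k) by apply: bigcup_measurable.
have cv := @lim_sup_set_cvg _ _ _ (@lebesgue_measure R) F mF.
have : (lebesgue_measure (\bigcup_(k in [set k | (0 <= k)%N]) F k) < +oo)%E.
  by apply: le_lt_trans Afin; apply: le_lebesgue => // x [k _]; exact: FA.
move=> /cv {}cv; rewrite -(cvg_lim _ cv)//.
apply: lime_ge; first by apply/cvg_ex; eexists; exact: cv.
by apply: nearW => X; exact: HF.
Qed.

Lemma frac_balls_sub (R : realType) (rho : nat -> R) v : rho v <= 1 -> frac_balls rho v `<=` `]-1, 2].
Proof.
move=> rv x [b /andP[/andP[b0 bv] _]].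
have vR : 0 < v%:R :> R by rewrite ltr0n; apply: leq_trans bv.
have h0 : 0 <= b%:R / v%:R :> R by rewrite divr_ge0// ltW.
have h1 : b%:R / v%:R <= 1 :> R by rewrite ler_pdivrMr// mul1r ler_nat.
rewrite ltr_norml /= in_itv /= => /andP[h3 h4].
by apply/andP; split; clear -h0 h1 rv h3 h4; lra.
Qed.

(** Beyond any [X] there is a block whose mass lies between [del / 2] and [del], because single
    terms are at most [del / 2]. By [block_measure] all tail unions then have measure at least
    [del / 2], and continuity from above passes to the limsup set. *)
Lemma blocks_limsup (R : realType) : exists2 del : R, 0 < del <= 1 &
  forall rho : nat -> R, (forall v, 0 <= rho v) ->
  (forall v, (0 < v)%N -> (totient v)%:R * rho v <= del / 2) ->
  (forall X, (0 < X)%N -> exists Y, del / 2 <= \sum_(X <= v < Y) (totient v)%:R * rho v) ->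
  ((del / 2)%:E <= lebesgue_measure (lim_sup_set (frac_balls rho)))%E.
Proof.
have [del /andP[d0 d1] Hblock] := block_measure R; exists del; first by rewrite d0.
move=> rho rho0 small large.
have mF v : measurable (frac_balls rho v) by exact: measurable_frac_balls.
have rho1 v : (0 < v)%N -> rho v <= 1.
  move=> v0; apply: (@le_trans _ _ ((totient v)%:R * rho v)).
    by rewrite ler_peMl// ler1n totient_gt0.
  apply: (le_trans (small v v0)); clear -d0 d1; lra.
apply: (@limsup_measure_ge _ _ _ `]-1, 2]) => // [v | | X].
- have [->|v0] := posnP v; first by rewrite frac_balls0.
  by apply: frac_balls_sub; exact: rho1.
- by rewrite lebesgue_measure_itv /=; case: ifP => _; rewrite -?EFinD ltry.
pose X1 := X.+1.
have [Y0 HY0] := large X1 isT.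
pose P Y := del / 2 <= \sum_(X1 <= v < Y) (totient v)%:R * rho v.
have exP : exists Y, P Y by exists Y0.
(* By minimality, the mass before the last term is below [del / 2], so the block does not exceed
   [del]. *)
case: (ex_minnP exP) => -[|Y] PY Ymin.
  by move: PY; rewrite /P big_geq// leNgt divr_gt0.
have XY : (X1 <= Y)%N.
  by rewrite leqNgt; apply/negP => YX; move: PY; rewrite /P big_geq// leNgt divr_gt0.
have PYn : \sum_(X1 <= v < Y) (totient v)%:R * rho v < del / 2.
  by rewrite ltNge; apply/negP => /Ymin; rewrite ltnn.
pose rho' v := if (X1 <= v)%N then rho v else 0.
have rho'0 v : 0 <= rho' v by rewrite /rho'; case: ifP.
have mE : block_mass rho' Y = \sum_(X1 <= v < Y.+1) (totient v)%:R * rho v.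
  rewrite block_mass_totient (@big_cat_nat _ _ _ X1)//=; last exact: leqW.
  rewrite big_nat big1 ?add0r => [|v /andP[_ vX]]; last by rewrite /rho' leqNgt vX mulr0.
  by rewrite big_nat [RHS]big_nat; apply: eq_bigr => v /andP[Xv _]; rewrite /rho' Xv.
have md : block_mass rho' Y <= del.
  rewrite mE big_nat_recr//= [leRHS]splitr lerD ?(ltW PYn)// small//.
  exact: leq_trans XY.
have := Hblock rho' Y rho'0 md; rewrite mE => H.
apply: (@le_trans _ _ (\sum_(X1 <= v < Y.+1) (totient v)%:R * rho v)%:E); first by rewrite lee_fin.
apply: (le_trans H); apply: le_lebesgue.
- by apply: bigsetU_measurable => v _; exact: measurable_frac_balls.
- by apply: bigcup_measurable.
move=> x; rewrite -bigcup_seq => -[v /= _ [b bI]]; rewrite /rho'.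
case: ifP => Xv; last by rewrite ltNge normr_ge0.
by exists v => //=; [exact: ltnW|exists b].
Qed.

Definition well_approx (R : realType) (a : nat -> nat) (eta : nat -> R) (c : R) : set R :=
  lim_sup_set (hits a (fun l => [set t | `|t| < c * eta l])).

Lemma measurable_well_approx (R : realType) a (eta : nat -> R) c : measurable (well_approx a eta c).
Proof.
apply: measurable_lim_sup_set => l; apply: measurable_hits.
rewrite (_ : mkset _ = `](- (c * eta l)), (c * eta l)[%classic)//.
by apply/seteqP; split=> x /=; rewrite in_itv /= ltr_norml.
Qed.

Lemma well_approx_shift (R : realType) a (eta : nat -> R) c x (z : int) :
  well_approx a eta c x -> well_approx a eta c (x + z%:~R).
Proof.
move=> H L _; have [l Ll [n Hn [y Hy]]] := H L I; exists l => //; exists n => //.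
exists (y + n%:Z * z) => /=; rewrite (_ : _ - _ = n%:R * x - y%:~R)//.
by rewrite intrD intrM; ring.
Qed.

Lemma well_approx_mul (R : realType) a (eta : nat -> R) c x (m : nat) : (0 < m)%N ->
  well_approx a eta (c / m%:R) x -> well_approx a eta c (m%:R * x).
Proof.
move=> m0 H L _; have [l Ll [n Hn [y /= Hy]]] := H L I; exists l => //; exists n => //.
have mR : 0 < m%:R :> R by rewrite ltr0n.
exists (m%:Z * y) => /=; rewrite intrM mulrCA -mulrBr normrM gtr0_norm//.
by rewrite -ltr_pdivlMl// mulrA [m%:R^-1 * _]mulrC.
Qed.

Lemma well_approx_le (R : realType) a (eta : nat -> R) c d :
  (forall N, (1 <= N)%N -> 0 <= eta N) -> c <= d -> well_approx a eta c `<=` well_approx a eta d.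
Proof.
move=> eta0 cd x H L _; have [l Ll [n Hn [y /= Hy]]] := H L I; exists l => //; exists n => //.
exists y => /=; apply: lt_le_trans Hy _; apply: ler_wpM2r => //; apply: eta0.
exact: ltnW (in_posdiff_gt1 Hn).
Qed.

(** A single infinite term would make the series infinite without saying anything about its tails.
    Such a term forces [eta] to be unbounded, however, and [tail_ge] then makes every tail
    infinite. *)
Lemma series_tail_large (R : realType) (a : nat -> nat) (eta : nat -> R) (M : R) X :
  (forall n, (1 <= n)%N -> (a n < a n.+1)%N) -> (forall N, (1 <= N)%N -> 0 <= eta N) ->
  (\sum_(1 <= k <oo) ((totient k)%:R%:E * series_term a eta k) = +oo)%E -> (0 < X)%N ->
  exists Y, (M%:E <= \sum_(X <= k < Y) ((totient k)%:R%:E * series_term a eta k))%E.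
Proof.
move=> a_incr eta0 Soo X0.
have s0 k := series_term_ge0 a k eta0.
have [fin|] := pselect (forall k, (0 < k)%N -> (series_term a eta k < +oo)%E).
  apply: tail_large Soo _ X0 => k; first by apply: mule_ge0; rewrite // lee_fin.
  by move=> k0; apply: lte_mul_pinfty; rewrite ?lee_fin// fin.
move=> /existsNP[k /not_implyP[k0 /negP]]; rewrite -leNgt leye_eq => /eqP soo.
pose e : R := 2 * Num.max M 1.
have e0 : 0 < e by rewrite mulr_gt0// lt_max ltr01 orbT.
have big L : exists2 l, (L <= l)%N & e <= eta l.
  (* This level exceeds every [eta l] with [l < L], so the index found with [eta l > t] is at least
     [L]. *)
  pose t : R := e + \sum_(0 <= l < L) `|eta l|.
  have t0 : 0 <= t by rewrite addr_ge0 ?(ltW e0)// sumr_ge0.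
  have [|b [l [Hl tl]]] := @series_term_gt _ a eta t k t0 k0; first by rewrite soo ltry.
  have te : t < eta l.
    apply: le_lt_trans tl; rewrite ler_peMr// ler1n.
    by case: Hl.
  exists l; last first.
    by apply: le_trans (ltW te); rewrite lerDl sumr_ge0.
  rewrite leqNgt; apply/negP => lL; move: te; apply/negP; rewrite -leNgt.
  rewrite /t (@big_cat_nat _ _ _ l)//=; last exact: ltnW.
  rewrite [X in _ + (_ + X)]big_ltn//; have := ler_norm (eta l).
  have h1 : 0 <= \sum_(0 <= i < l) `|eta i| by rewrite sumr_ge0.
  have h2 : 0 <= \sum_(l.+1 <= i < L) `|eta i| by rewrite sumr_ge0.
  clear -h1 h2 e0; lra.
have [Y HY] := tail_ge a_incr eta0 e0 X0 big; exists Y; apply: le_trans HY.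
by rewrite lee_fin /e mulrC mulKf// le_max lexx.
Qed.

(** The bound [q] is chosen before [c]; this lets it survive the intersection over all [c] in
    [divergence_case]. *)
Lemma well_approx_measure_ge (R : realType) : exists2 q : R, 0 < q &
  forall (a : nat -> nat) (eta : nat -> R) (c : R),
  (forall n, (1 <= n)%N -> (a n < a n.+1)%N) -> (forall N, (1 <= N)%N -> 0 <= eta N) ->
  (\sum_(1 <= k <oo) ((totient k)%:R%:E * series_term a eta k) = +oo)%E -> 0 < c ->
  (q%:E <= lebesgue_measure (well_approx a eta c `&` `]0%R, 1%R]))%E.
Proof.
(* The balls lie in the interval from -1 to 2, which three unit intervals cover; by periodicity each
   carries the same measure, hence at least a third of [del / 2]. *)
have [del /andP[d0 d1] H] := blocks_limsup R; exists (del / 6); first by rewrite divr_gt0.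
move=> a eta c a_incr eta0 Soo c0.
have s0 k := series_term_ge0 a k eta0.
pose r k : \bar R := Order.min (c%:E * series_term a eta k)%E (del / 2 / (totient k)%:R)%:E.
have r0 k : (0 <= r k)%E.
  rewrite /r le_min; apply/andP; split; last by rewrite lee_fin !divr_ge0// ltW.
  by apply: mule_ge0 => //; rewrite lee_fin ltW.
have rfin k : r k \is a fin_num.
  by rewrite ge0_fin_numE// (le_lt_trans (y := (del / 2 / (totient k)%:R)%:E))// ?ltry// /r ge_min lexx orbT.
pose rho k := fine (r k).
have rE k : (rho k)%:E = r k by rewrite fineK.
have rho0 k : 0 <= rho k by rewrite -lee_fin rE.
have tot0 k : (0 < k)%N -> 0 < (totient k)%:R :> R by move=> k0; rewrite ltr0n totient_gt0.
have F_ge : ((del / 2)%:E <= lebesgue_measure (lim_sup_set (frac_balls rho)))%E.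
  apply: H => // [v v0|X X0].
    by rewrite mulrC -ler_pdivlMr ?tot0// -lee_fin rE /r ge_min lexx orbT.
  (* If the truncation is active at some [k >= X], that term alone has mass [del / 2]; otherwise the
     tail is [c] times the tail of the divergent series. *)
  have [[k Xk Hk]|nk] := pselect (exists2 k, (X <= k)%N & (r k = (del / 2 / (totient k)%:R)%:E)%E).
    exists k.+1; rewrite big_nat_recr//= /rho Hk /= [X in _ + X]mulrC divfK ?lerDr ?gt_eqF ?tot0//.
      by apply: sumr_ge0 => i _; apply: mulr_ge0 => //; exact: (rho0 i).
    exact: leq_trans Xk.
  have rs k : (X <= k)%N -> (r k = c%:E * series_term a eta k)%E.
    move=> Xk; rewrite /r minEle; case: ifP => // nle; exfalso; apply: nk; exists k => //.
    by rewrite /r minEle nle.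
  have [Y HY] := series_tail_large (del / 2 / c) a_incr eta0 Soo X0.
  exists Y; rewrite -lee_fin -sumEFin.
  have -> : (\sum_(X <= k < Y) ((totient k)%:R * rho k)%:E = c%:E * \sum_(X <= k < Y) ((totient k)%:R%:E * series_term a eta k))%E.
    rewrite ge0_sume_distrr => [|k _]; last by apply: mule_ge0; rewrite // lee_fin.
    rewrite big_nat [RHS]big_nat; apply: eq_bigr => k /andP[Xk _].
    by rewrite EFinM rE rs// muleCA.
  apply: (@le_trans _ _ (c%:E * (del / 2 / c)%:E)%E).
    by rewrite -EFinM [c * _]mulrC divfK ?gt_eqF.
  by apply: lee_wpmul2l => //; rewrite lee_fin ltW.
have sub : lim_sup_set (frac_balls rho) `<=` well_approx a eta c `&` `]-1, 2].
  move=> x Hx; split; last first.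
    have [k /= k0 xk] := Hx 1%N I; apply: frac_balls_sub xk; rewrite -lee_fin rE.
    apply: (@le_trans _ _ (del / 2 / (totient k)%:R)%:E); first by rewrite /r ge_min lexx orbT.
    rewrite lee_fin ler_pdivrMr ?tot0// mul1r (@le_trans _ _ 1)//; last by rewrite ler1n totient_gt0.
    clear -d0 d1; lra.
  (* Differences among the first [L] terms are at most [a L], so a denominator beyond [a L] forces
     the index [l] found below to be at least [L]. *)
  move=> L _; have [k Lk [b /andP[/andP[b0 bk] _] Hb]] := Hx (a L).+1 I.
  have k0 : (0 < k)%N by apply: leq_trans bk.
  have kR : 0 < k%:R :> R by rewrite ltr0n.
  have : ((`|b%:R / k%:R - x| / c)%:E < series_term a eta k)%E.
    rewrite EFinM muleC lte_pdivrMl//; apply: (@lt_le_trans _ _ (rho k)%:E); first by rewrite lte_fin.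
    by rewrite rE /r ge_min lexx.
  move=> /series_term_gt[||m [l [Hl lt]]] => //; first by rewrite divr_ge0// ltW.
  have mk0 : 0 < (m * k)%:R :> R by rewrite ltr0n; case: Hl.
  have m0 : (0 < m)%N by rewrite ltr0n muln_gt0 in mk0; case/andP: mk0.
  exists l.
    rewrite /= leqNgt; apply/negP => lL.
    have := in_posdiff_le a_incr (in_posdiff_mono (ltnW lL) Hl).
    apply/negP; rewrite -ltnNge; apply: leq_trans Lk _; exact: leq_pmull.
  exists (m * k)%N => //; exists (m * b)%N%:Z => /=.
  rewrite -[(_%:Z)%:~R]/((m * b)%:R) (_ : (m * b)%:R = (m * k)%:R * (b%:R / k%:R)); last first.
    by rewrite !natrM; field; rewrite gt_eqF.
  rewrite -mulrBr normrM gtr0_norm// distrC.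
  by rewrite mulrAC ltr_pdivrMr// mulrC [eta l * c]mulrC in lt.
have mG (A : set R) : measurable A -> measurable (well_approx a eta c `&` A).
  by move=> mA; apply: measurableI => //; exact: measurable_well_approx.
have shift (z : int) : lebesgue_measure (well_approx a eta c `&` `]z%:~R, z%:~R + 1]) = lebesgue_measure (well_approx a eta c `&` `]0%R, 1%R]).
  have -> : well_approx a eta c `&` `]z%:~R, z%:~R + 1]%classic = (fun x => 1 * x + - z%:~R) @^-1` (well_approx a eta c `&` `]0%R, 1%R]%classic).
    apply/seteqP; split => x /=; rewrite !in_itv /= mul1r subr_gt0 lerBlDr [1 + _]addrC.
      by move=> [Gx ->]; split => //; have := well_approx_shift (- z) Gx; rewrite mulrNz.
    by move=> [Gx ->]; split => //; have := well_approx_shift z Gx; rewrite subrK.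
  by rewrite affine_preimage ?invr1 ?mul1e//; exact: mG.
pose J (z : int) := well_approx a eta c `&` `]z%:~R, z%:~R + 1]%classic.
have mJ z : measurable (J z) by exact: mG.
have cover : well_approx a eta c `&` `]-1, 2] `<=` J (-1) `|` (J 0 `|` J 1).
  move=> x [Gx /=]; rewrite in_itv /= => /andP[x1 x2].
  have [xn|xp] := lerP x 0; first by left; split=> //=; rewrite in_itv /= mulrN1z addNr x1.
  have [xn|x1'] := lerP x 1; right; [left|right]; split=> //=; rewrite in_itv /=.
    by rewrite mulr0z add0r xp.
  by rewrite mulr1z x1' (_ : 1 + 1 = 2)//.
set T := lebesgue_measure (well_approx a eta c `&` `]0%R, 1%R]) in shift *.
have : ((del / 2)%:E <= T + (T + T))%E.
  apply: (le_trans F_ge); apply: (@le_trans _ _ (lebesgue_measure (J (-1) `|` (J 0 `|` J 1)))).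
    apply: le_lebesgue; last exact: subset_trans cover.
    - by apply: measurable_lim_sup_set => v; exact: measurable_frac_balls.
    - by do 2?[apply: measurableU => //].
  rewrite -{1}(shift (-1)) -{1}(shift 0) -(shift 1).
  have h : (lebesgue_measure (J 0%Z `|` J 1%Z) <= lebesgue_measure (J 0%Z) + lebesgue_measure (J 1%Z))%E by apply: measureU2; exact: mJ.
  apply: le_trans (leeD2l _ h); apply: measureU2; first exact: mJ.
  by apply: measurableU; exact: mJ.
have : (0 <= T)%E by exact: measure_ge0.
case: T {shift} => [t _|_ _|//]; last by rewrite leey.
rewrite -!EFinD !lee_fin; clear; lra.
Qed.

(* [G] is stable under multiplication by [m], which only costs the factor [m] in [c]. *)
Lemma divergence_case (R : realType) (a : nat -> nat) (eta : nat -> R) :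
  (forall n, (1 <= n)%N -> (a n < a n.+1)%N) -> (forall N, (1 <= N)%N -> 0 <= eta N) ->
  (\sum_(1 <= k <oo) ((totient k)%:R%:E * series_term a eta k) = +oo)%E ->
  lebesgue_measure (calA a eta) = 1%E.
Proof.
move=> a_incr eta0 Soo; have [q q0 Hq] := well_approx_measure_ge R.
pose G : set R := [set x | forall c, 0 < c -> well_approx a eta c x].
(* The sets decrease with [c], so a countable intersection suffices, which gives measurability and,
   by continuity from above, measure at least [q]. *)
have GE : G = \bigcap_j well_approx a eta (j.+1%:R^-1).
  apply/seteqP; split=> [x Gx j _|x Gx c c0]; first by apply: Gx; rewrite invr_gt0.
  apply: (@well_approx_le _ a eta (Num.truncn c^-1).+1%:R^-1 c eta0); last exact: Gx.
  by rewrite invf_ple ?posrE// ltW// truncnS_gt.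
have mG : measurable G.
  by rewrite GE; apply: bigcapT_measurable => j; exact: measurable_well_approx.
pose F j := well_approx a eta (j.+1%:R^-1) `&` `]0, 1]%classic.
have mF j : measurable (F j) by apply: measurableI => //; exact: measurable_well_approx.
have FE : \bigcap_j F j = G `&` `]0, 1].
  rewrite GE; apply/seteqP; split=> x; first by move=> Fx; split=> [j _|]; case: (Fx j I) || case: (Fx 0%N I).
  by move=> [Gx x01] j _; split=> //; exact: Gx.
have Gpos : (q%:E <= lebesgue_measure (G `&` `]0%R, 1%R]))%E.
  have cv : lebesgue_measure (F j) @[j --> \oo] --> lebesgue_measure (\bigcap_j F j).
    apply: nonincreasing_cvg_mu => //.
    - apply: (@le_lt_trans _ _ (lebesgue_measure `]0%R, 1%R]%classic)).
        by apply: le_lebesgue => //; exact: subIsetr.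
      by rewrite lebesgue_measure_itv /= lte_fin ltr01 -EFinD ltry.
    - by rewrite FE; exact: measurableI.
    - move=> m n mn; apply/subsetPset => x [Gx x01]; split=> //.
      by apply: well_approx_le Gx => //; rewrite lef_pV2 ?posrE// ler_nat.
  rewrite -FE -(cvg_lim _ cv)//; apply: lime_ge; first by apply/cvg_ex; eexists; exact: cv.
  by apply: nearW => j; apply: Hq; rewrite ?invr_gt0.
have G1 : lebesgue_measure (G `&` `]0%R, 1%R]) = 1%E.
  apply: zero_one => // [x z Gx c c0|x n n0 Gx c c0|].
  - by apply: well_approx_shift; exact: Gx.
  - by apply: well_approx_mul => //; apply: Gx; rewrite divr_gt0// ltr0n.
  - by apply: lt_le_trans Gpos; rewrite lte_fin.
have mA := @measurable_calA R a eta a_incr.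
apply/eqP; rewrite eq_le; apply/andP; split.
  apply: (@le_trans _ _ (lebesgue_measure `[0%R, 1%R]%classic)).
    by apply: le_lebesgue => //; rewrite calAE//; exact: subIsetl.
  by rewrite lebesgue_measure_itv /= lte_fin ltr01 oppr0 adde0.
rewrite -G1; apply: le_lebesgue => //; first exact: measurableI.
move=> x [Gx /=]; rewrite in_itv /= => /andP[x0 x1]; rewrite calAE//; split.
  by rewrite /= in_itv /= ltW.
move=> L _; have [l Ll [n Hn [z /= Hz]]] := Gx 1 ltr01 L I; exists l => //; exists n => //.
by exists z; rewrite /= -[eta l]mul1r ltW.
Qed.

Theorem theorem3 (R : realType) (a : nat -> nat) (eta : nat -> R)
  (a_pos : forall n, (1 <= n)%N -> (0 < a n)%N)
  (a_incr : forall n, (1 <= n)%N -> (a n < a n.+1)%N)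
  (eta_ge0 : forall N, (1 <= N)%N -> 0 <= eta N) :
  let S := (\sum_(1 <= k <oo) ((totient k)%:R%:E * series_term a eta k))%E in
  ((S < +oo)%E -> lebesgue_measure (calA a eta) = 0%E) /\
  (S = +oo%E -> lebesgue_measure (calA a eta) = 1%E).
Proof.
by split=> ?; [exact: convergence_case|exact: divergence_case].
Qed.
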